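(* Let $C$ be a longest cycle in a $(\delta-\lambda+2)$-connected graph $G$, where $\lambda$ is an integer with $1\le\lambda\le\delta$. If $\overline{c}\ge \lambda-1$, then $c\ge\lambda(\delta-\lambda+2)$.
   Context: All graphs are finite, undirected, without loops or multiple edges. For a graph $G$, $\delta$ denotes its minimum degree and $\kappa$ its connectivity. A cycle of order $t$ is a sequence $v_1\dots v_tv_1$ of distinct vertices with consecutive vertices adjacent; a single vertex is a cycle of order 1 and an edge a cycle of order 2. $C$ is a longest cycle of $G$, $c=|C|$ is the circumference, and $\overline{c}$ denotes the order of a longest cycle in $G-C$ (the subgraph obtained by deleting the vertices of $C$). *)

(* Defs.v *)
From mathcomp Require Import all_boot.

Set Implicit Arguments.
Unset Strict Implicit.
Unset Printing Implicit Defensive.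

Record sgraph := SGraph {
  vertex :> finType;
  adj : rel vertex;
  adj_sym : symmetric adj;
  adj_irrefl : irreflexive adj }.

Section Graph.
Variable G : sgraph.

Definition degree (x : G) : nat := #|[set y | adj x y]|.

(* The neutral element #|G| exceeds every degree, so it is only reached on the
   empty graph, where it is 0. *)
Definition min_degree : nat := \big[minn/#|G|]_(x : G) degree x.

Definition connected : bool := [forall x : G, forall y : G, connect (@adj G) x y].

(* Single vertices are cycles of order 1, which [ucycleb] rejects because [adj]
   is irreflexive; edges are cycles of order 2, which [ucycleb] accepts. *)
Definition is_cycle (s : seq G) : bool :=
  match s with
  | [::] => false
  | [:: _] => true
  | _ => ucycleb (@adj G) s
  end.

Definition longest_cycle (s : seq G) : Prop :=
  is_cycle s /\ forall t : seq G, is_cycle t -> size t <= size s.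

(* A cycle has no repeated vertex, so its order is at most #|G|. On the empty
   graph, which has no cycle, the value is 0. *)
Definition circumference : nat :=
  \max_(k < #|G|.+1 | [exists s : k.-tuple G, is_cycle s]) k.

Section Induced.
Variable A : {set G}.

Definition induced_adj : rel {x : G | x \in A} :=
  fun x y => adj (val x) (val y).

Lemma induced_sym : symmetric induced_adj.
Proof. by move=> x y; apply: adj_sym. Qed.

Lemma induced_irrefl : irreflexive induced_adj.
Proof. by move=> x; apply: adj_irrefl. Qed.

Definition induced : sgraph := SGraph induced_sym induced_irrefl.
End Induced.

Definition delete (X : {set G}) : sgraph := induced (~: X).

End Graph.

(* The bound on #|G| gives the complete graph on n vertices connectivity n - 1. *)
Definition k_connected (k : nat) (G : sgraph) : Prop :=
  k < #|G| /\ forall X : {set G}, #|X| < k -> connected (delete X).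

Lemma size_is_cycle (G : sgraph) (s : seq G) : is_cycle s -> size s <= #|G|.
Proof.
case: s => [|x [|y s]] //= => [_|/andP[_ Us]].
  by apply/card_gt0P; exists x.
by rewrite -[(size s).+2]/(size [:: x, y & s]) -(card_uniqP Us) max_card.
Qed.

Lemma size_longest_cycle (G : sgraph) (s : seq G) :
  longest_cycle s -> size s = circumference G.
Proof.
move=> [cs maxs]; apply/eqP; rewrite eqn_leq; apply/andP; split.
  have ls : size s < #|G|.+1 by rewrite ltnS size_is_cycle.
  rewrite -[size s]/(nat_of_ord (Ordinal ls)); apply: leq_bigmax_cond.
  by apply/existsP; exists (in_tuple s).
apply/bigmax_leqP => k /existsP[t ct].
by rewrite -(size_tuple t) maxs.
Qed.

(* Main.v *)
(* Let D be a longest cycle of G - C and h = |D|. If distinct vertices w, w' of C have neighbours joined by a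
   path with n edges in G - C, then they are at distance at least n + 2 on C; so |C| is bounded below by
   summing such gaps over the vertices of C that are attached to suitable parts of G - C.

   Put k = delta - lambda + 2 and m = lambda. If k <= h, Menger's theorem gives k disjoint links from D to C,
   and the successors on D of their feet carry disjoint tails in G - C - D, chosen lexicographically maximal.
   By maximality of D, an end of a tail with more than h/2 neighbours off C has all of them on its own tail.
   If no tail is bad in this way, the attachments of the ends of the tails fill the gaps between the links up
   to k m. Otherwise Posa rotations of a bad tail yield d ends, h/2 < d < h, with at most d neighbours off C
   each, and a cut vertex of G - C separates them from D. If d is small, it suffices to count the attachments
   of these ends together with k - 1 links of D. If d is large, both sides of the cut vertex contain a cycle
   of order at least max(k, m), and the links of two minimal such sides bound |C|.

   If k > h, then lambda <= h + 1 <= k, and (lambda, k) may be replaced by (h + 1, delta - h + 1), which has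
   the same sum and a product at least as large. In the remaining case 2 h <= delta the degrees are so large
   that all vertices of D can carry tails, without any use of connectivity. *)

Require Import Defs.
From mathcomp Require Import all_boot zify.
From Stdlib Require Import Classical.

Set Implicit Arguments.
Unset Strict Implicit.
Unset Printing Implicit Defensive.

(* [lia] is very slow in the presence of hypotheses on vertices and sets. *)
Ltac arith_prop P := idtac; lazymatch P with
  | is_true (leq _ _) => idtac
  | is_true (~~ leq _ _) => idtac
  | is_true (leq _ _ && leq _ _) => idtac
  | is_true (leq _ _ || leq _ _) => idtac
  | leq _ _ = _ => idtac
  | @eq ?T _ _ => unify T nat
  | ~ @eq ?T _ _ => unify T nat
  | is_true (@eq_op _ ?x _) => let T := type of x in unify T nat
  | is_true (~~ @eq_op _ ?x _) => let T := type of x in unify T nat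
  | ?P /\ ?Q => arith_prop P; arith_prop Q
  | ?P \/ ?Q => arith_prop P; arith_prop Q
  end.
Ltac nlia := intros; repeat match goal with
  | H : ?P |- _ => let T := type of P in unify T Prop; assert_fails (arith_prop P); clear H
  end; lia.

(** The bound is proved as k (mu + 2) <= |C| with k + mu = delta: k is the number of links and mu +
    2 the average gap wanted between consecutive ones. A path through D between two feet guarantees
    only a gap rho + 2, where rho may be smaller than mu. The missing mu - rho must come from the
    attachments of the tail ends: neighbours that such an end lacks off C it has on C, and at most k
    of those are ends of links. The balance holds only in total, because a base without a tail loses
    neighbours to the heads of other tails, and those tails must pay for it. The lexicographic
    choice serves this: the number of tails makes every outside neighbour of a tailless base the
    head of a tail, the total length keeps the neighbours of tail ends on D and the tails, and the
    value compares the bases adjacent to one head. The obstacle is an end whose neighbours off C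
    crowd on its own tail. The connectivity of G does not pass to G - C, so the ends obtained from
    such a tail need a separate count. *)

Lemma ex_max (T : Type) (P : T -> Prop) (f : T -> nat) (b : nat) :
  (exists x, P x) -> (forall x, P x -> f x <= b) ->
  exists2 x, P x & forall y, P y -> f y <= f x.
Proof.
move=> [x0 Px0] fb; have [k] := ubnP (b - f x0).
elim: k x0 Px0 => // k IH x Px lek.
have [[y [Py lt]]|nex] := classic (exists y, P y /\ f x < f y).
  by apply: (IH y) => //; have := fb _ Py; lia.
by exists x => // y Py; rewrite leqNgt; apply/negP => lt; apply: nex; exists y.
Qed.

Lemma ex_min (T : Type) (P : T -> Prop) (f : T -> nat) :
  (exists x, P x) -> exists2 x, P x & forall y, P y -> f x <= f y.
Proof.
move=> [x0 Px0]; have [k] := ubnP (f x0).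
elim: k x0 Px0 => // k IH x Px lek.
have [[y [Py lt]]|nex] := classic (exists y, P y /\ f y < f x).
  by apply: (IH y) => //; lia.
by exists x => // y Py; rewrite leqNgt; apply/negP => lt; apply: nex; exists y.
Qed.

(** * Long paths inside a vertex set *)

Section Paths.
Variable G : sgraph.
Implicit Types (A B : {set G}) (x y z : G) (p q s : seq G).
Notation e := (@adj G).

Definition spath A x y p :=
  [/\ path e x p, uniq (x :: p), last x p = y & {subset x :: p <= A}].

(** [n] only bounds the number of edges from below, so paths can be weakened freely, and
    [lp A x y 0] says that [x] and [y] are connected inside [A]. *)
Definition lp A x y n := exists2 p, spath A x y p & n <= size p.

Lemma adjC x y : e x y -> e y x.
Proof. by rewrite adj_sym. Qed.

Lemma adj_neq x y : e x y -> x != y.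
Proof. by apply: contraTneq => ->; rewrite adj_irrefl. Qed.

Lemma spath_rev A x y p : spath A x y p ->
  exists q, [/\ spath A y x q, size q = size p & y :: q =i x :: p].
Proof.
move=> [pp up lpy sA]; exists (rev (belast x p)).
have E : y :: rev (belast x p) = rev (x :: p).
  by rewrite (lastI x p) rev_rcons -lpy.
split; last by rewrite E => z; rewrite mem_rev.
  split.
  - rewrite -lpy rev_path (eq_path (e' := e)) // => a b; exact: adj_sym.
  - by rewrite E rev_uniq.
  - by rewrite -[LHS]/(last y (y :: _)) E rev_cons last_rcons.
  - by rewrite E => z; rewrite mem_rev; apply: sA.
by rewrite size_rev size_belast.
Qed.

Lemma spath_sub A B x y p : spath A x y p -> {subset x :: p <= B} -> spath B x y p.
Proof. by case=> ? ? ? _ ?; split. Qed.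

Lemma spath_in A x y p : spath A x y p -> x \in A /\ y \in A.
Proof.
case=> _ _ <- sA; split; apply: sA; [exact: mem_head | exact: mem_last].
Qed.

Lemma spath_cat A B x y z p q :
  spath A x y p -> spath B y z q -> (forall v, v \in x :: p -> v \in q -> False) ->
  spath (A :|: B) x z (p ++ q).
Proof.
move=> [pp up lpy sA] [qq uq lqz sB] dis; split.
- by rewrite cat_path pp lpy.
- rewrite -cat_cons cat_uniq up; move: uq; rewrite cons_uniq => /andP[_ ->].
  by rewrite andbT; apply/hasPn => v vq; apply/negP => vp; apply: dis vp vq.
- by rewrite last_cat lpy.
- move=> v; rewrite -cat_cons mem_cat in_setU => /orP[/sA->//|vq].
  by rewrite (sB v) ?orbT // inE vq orbT.
Qed.

Lemma lp_sub A B x y n : A \subset B -> lp A x y n -> lp B x y n.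
Proof. by move=> /subsetP AB [p [? ? ? sA] le]; exists p => //; split=> // v /sA/AB. Qed.

Lemma lp_le A x y m n : m <= n -> lp A x y n -> lp A x y m.
Proof. by move=> mn [p sp le]; exists p => //; lia. Qed.

Lemma lp_sym A x y n : lp A x y n -> lp A y x n.
Proof. by move=> [p /spath_rev[q [sq eq _]] le]; exists q => //; rewrite eq. Qed.

Lemma lp_in A x y n : lp A x y n -> x \in A /\ y \in A.
Proof. by move=> [p /spath_in]. Qed.

Lemma lp_refl A x : x \in A -> lp A x x 0.
Proof. by move=> xA; exists [::] => //; split=> // v; rewrite inE => /eqP->. Qed.

Lemma lp_cat A B x y z n m :
  lp A x y n -> lp B y z m -> (forall v, v \in A -> v \in B -> v = y) ->
  lp (A :|: B) x z (n + m).
Proof.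
move=> [p sp le] [q sq le'] AB; exists (p ++ q); last by rewrite size_cat; lia.
apply: (spath_cat sp sq) => v vp vq.
have E : v = y.
  by case: sp sq => _ _ _ sA [_ _ _ sB]; apply: AB; [exact: sA | apply: sB; rewrite inE vq orbT].
by case: sq => _ /andP[+ _] _ _; rewrite -E vq.
Qed.

Lemma lp_join A B x y y' z n m :
  lp A x y n -> lp B y' z m -> e y y' -> (forall v, v \in A -> v \in B -> False) ->
  lp (A :|: B) x z (n + m).+1.
Proof.
move=> lA [q [pq uq lq sB] le] yy' AB.
have yA : y \in A by have [] := lp_in lA.
have lB : lp (B :|: [set y]) y z m.+1.
  exists (y' :: q) => //; split => //=.
  - by rewrite yy' pq.
  - rewrite [X in _ && X]uq andbT; apply/negP => /sB; exact: AB.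
  - move=> v; rewrite in_cons => /orP[/eqP->|/sB vB]; first by rewrite !inE eqxx orbT.
    by rewrite inE vB.
rewrite -addnS; apply: lp_sub (lp_cat lA lB _).
  by apply/subsetP => v; rewrite !inE => /or3P[->|->|/eqP->] //; rewrite ?orbT // yA.
by move=> v vA; rewrite !inE => /orP[/(AB _ vA)//|/eqP].
Qed.

Lemma connect_lp A x y :
  x \in A -> connect (fun a b => e a b && (b \in A)) x y -> lp A x y 0.
Proof.
move=> xA /connectP[p pp ->]; case/shortenP: pp => q pq uq _.
exists q => //; split => //.
  by apply: sub_path pq => a b /andP[].
move=> v; rewrite inE => /orP[/eqP->//|]; elim: q x {xA uq} pq => //= a q IH x.
by move=> /andP[/andP[_ aA] pq]; rewrite inE => /orP[/eqP->//|]; apply: IH pq.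
Qed.

Lemma lp_connect A x y n : lp A x y n -> connect (fun a b => e a b && (b \in A)) x y.
Proof.
move=> [p [pp _ <- sA] _]; apply/connectP; exists p => //.
elim: p x pp sA => //= a p IH x /andP[xa pp] sA.
rewrite xa sA ?inE ?eqxx ?orbT //=; apply: IH => // v vp.
by apply: sA; rewrite inE vp orbT.
Qed.

Lemma lp_trans0 A x y z m n : lp A x y m -> lp A y z n -> lp A x z 0.
Proof.
move=> lxy lyz; apply: connect_lp; first by have [] := lp_in lxy.
exact: connect_trans (lp_connect lxy) (lp_connect lyz).
Qed.

Lemma lp_edge A x y : x \in A -> y \in A -> e x y -> lp A x y 1.
Proof.
move=> xA yA xy; exists [:: y] => //; split => //=; first by rewrite xy.
  by rewrite inE andbT (adj_neq xy).
by move=> v; rewrite !inE => /orP[] /eqP->.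
Qed.

Lemma spath_hit A x y p (T : {pred G}) :
  spath A x y p -> has T (x :: p) ->
  exists z p1 p2, [/\ p = p1 ++ p2, spath A x z p1, spath A z y p2, z \in T &
     forall v, v \in x :: p1 -> v \in T -> v = z].
Proof.
move=> [pp up lpy sA] hT.
have [xT|xT] := boolP (x \in T).
  exists x, [::], p; split => //; first by split => // v; rewrite inE => /eqP->; apply: sA; rewrite mem_head.
  by move=> v; rewrite inE => /eqP->.
have hp : has T p by move: hT => /= /orP[xx|//]; move: xT; rewrite -topredE /= xx.
case: (split_find hp) pp up lpy sA => z p1 p2 Tz nT.
rewrite cat_path rcons_path last_rcons last_cat last_rcons => /andP[/andP[pp1 e1] pp2].
rewrite -cat_cons cat_uniq -!rcons_cons => /and3P[up1 dis up2] ly sA.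
exists z, (rcons p1 z), p2; split => //.
- split => //; rewrite ?rcons_path ?pp1 ?last_rcons //.
  by move=> v vp; apply: sA; move: vp; rewrite !inE mem_cat => /orP[->|->]; rewrite ?orbT.
- split => //=; last first.
    move=> v vp; apply: sA; move: vp; rewrite !inE mem_cat mem_rcons inE.
    by move=> /orP[->|->]; rewrite ?orbT.
  rewrite up2 andbT; apply/negP => zp2; move/hasPn: dis => /(_ _ zp2).
  by rewrite inE mem_rcons mem_head orbT.
- move=> v; rewrite -rcons_cons mem_rcons !inE => /or3P[/eqP//|/eqP->|vp1] vT.
    by rewrite vT in xT.
  by move/hasPn: nT => /(_ _ vp1); rewrite -topredE /= in vT; rewrite vT.
Qed.

(** The path is cut at its first vertex in [T]. Removing the rest of [T] from the ambient set
    expresses this as a property of the set, the form that [lp_cat] and [lp_stay] consume. *)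
Lemma lp_hit A x y (T : {pred G}) : lp A x y 0 -> y \in T ->
  exists2 z, z \in T & lp (A :\: [set v | (v \in T) && (v != z)]) x z 0.
Proof.
move=> [p sp _] yT.
have hT : has T (x :: p).
  by apply/hasP; exists y => //; case: sp => _ _ <- _; apply: mem_last.
case: (spath_hit sp hT) => z [p1 [p2 [_ sp1 _ zT H]]]; exists z => //.
exists p1 => //; apply: spath_sub (sp1) _ => v vp; rewrite !inE.
case: sp1 => _ _ _ -> //; rewrite andbT; apply/negP => /andP[vT]; rewrite (H v) ?eqxx //.
Qed.

Definition seg s i j : {set G} := [set z in s | i <= index z s <= j].

Lemma lp_seg (x0 : G) s i j : sorted e s -> uniq s -> i <= j < size s ->
  lp (seg s i j) (nth x0 s i) (nth x0 s j) (j - i).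
Proof.
move=> ss us /andP[ij js].
have Es : take (j - i).+1 (drop i s) = nth x0 s i :: take (j - i) (drop i.+1 s).
  by rewrite (drop_nth x0) //; lia.
set p := take (j - i) (drop i.+1 s).
have szp : size p = j - i by rewrite size_takel // size_drop; lia.
exists p; last by rewrite szp.
split.
- have : sorted e (take (j - i).+1 (drop i s)) by apply/take_sorted/drop_sorted.
  by rewrite Es.
- by rewrite -Es take_uniq // drop_uniq.
- rewrite (last_nth x0) szp -Es nth_take ?nth_drop; [congr (nth _ _ _); lia|lia].
- move=> v; rewrite -Es => /(nthP x0)[l]; rewrite size_take size_drop => ll <-.
  have ll' : l < (j - i).+1 by move: ll; case: ifP; lia.
  rewrite nth_take // nth_drop inE mem_nth /=; last by lia.
  by rewrite index_uniq //; [lia | apply: leq_ltn_trans js; lia].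
Qed.

End Paths.

Ltac slia := first [nlia | simpl in *; nlia].

(** * Distances along a cycle *)

Section CyclicDistance.
Variables (T : finType) (s : seq T).
Hypothesis us : uniq s.
Implicit Types (x y z : T) (W : {set T}).

(** The distance is directed along [s], so that the two arcs between [x] and [y] can be bounded
    separately. *)
Definition cdist x y :=
  if index x s <= index y s then index y s - index x s
  else size s + index y s - index x s.

Arguments cdist : simpl never.

Lemma cdist_lt x y : x \in s -> y \in s -> cdist x y < size s.
Proof. by rewrite -!index_mem /cdist => ? ?; case: ifP; slia. Qed.

Lemma index_neq x y : x \in s -> y \in s -> x != y -> index x s != index y s.
Proof.
move=> xs ys; apply: contraNneq => E.
by rewrite -(nth_index x xs) E (nth_index x ys).
Qed.

Lemma cdistC x y : x \in s -> y \in s -> x != y -> cdist x y + cdist y x = size s.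
Proof.
move=> xs ys /(index_neq xs ys); move: xs ys; rewrite -!index_mem /cdist.
by case: ifP; case: ifP; slia.
Qed.

Lemma cdist_gt0 x y : x \in s -> y \in s -> x != y -> 0 < cdist x y.
Proof.
move=> xs ys /(index_neq xs ys); move: xs ys; rewrite -!index_mem /cdist.
by case: ifP; slia.
Qed.

Lemma cdistxx x : cdist x x = 0.
Proof. by rewrite /cdist leqnn; slia. Qed.

Lemma cdist_split x y z : x \in s -> y \in s -> z \in s ->
  cdist x y <= cdist x z -> cdist x y + cdist y z = cdist x z.
Proof. by rewrite -!index_mem /cdist; do !case: ifP; slia. Qed.

Lemma cdist_inj x y z : x \in s -> y \in s -> z \in s -> cdist x y = cdist x z -> y = z.
Proof.
move=> xs ys zs E; apply/eqP/negPn/negP => /(index_neq ys zs).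
by move: xs ys zs E; rewrite -!index_mem /cdist; do !case: ifP; slia.
Qed.

Lemma cdist_split2 x y z : x \in s -> y \in s -> z \in s -> x != z ->
  cdist x z <= cdist y z -> cdist y x + cdist x z = cdist y z.
Proof.
move=> xs ys zs /(index_neq xs zs).
by move: xs ys zs; rewrite -!index_mem /cdist; do !case: ifP; slia.
Qed.

#[global] Opaque cdist.

(* If [W] has no element other than [w], the value is [w]. *)
Definition nextin W w :=
  if [pick z in W :\ w] is Some z0 then [arg min_(z < z0 in W :\ w) cdist w z] else w.

Section Next.
Variable W : {set T}.
Hypothesis Ws : {subset W <= s}.
Hypothesis W1 : 1 < #|W|.
Notation nx := (nextin W).

Lemma nextinP w : w \in W ->
  [/\ nx w \in W, nx w != w & forall z, z \in W -> z != w -> cdist w (nx w) <= cdist w z].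
Proof.
move=> wW; rewrite /nextin; case: pickP => [z0 z0W|Wn]; last first.
  by move: W1; rewrite (cardsD1 w) wW (eq_card0 Wn).
case: arg_minnP => // z; rewrite !inE => /andP[zw zW] H; split => // z' z'W z'w.
by apply: H; rewrite !inE z'w.
Qed.

#[global] Opaque nextin.

(** If two elements had the same successor, the farther one would meet the nearer one first. *)
Lemma nextin_inj : {in W &, injective nx}.
Proof.
move=> w w' wW w'W E; apply/eqP/negPn/negP => ww'.
have [a1 b1 c1] := nextinP wW; have [a2 b2 c2] := nextinP w'W.
have ws := Ws wW; have w's := Ws w'W; have zs := Ws a1.
have [le|le] := leqP (cdist w (nx w)) (cdist w' (nx w)).
  have := cdist_split2 ws w's zs; rewrite eq_sym b1 => /(_ isT le).
  have := c2 _ wW ww'; rewrite -E; have := cdist_gt0 ws zs; rewrite eq_sym b1 => /(_ isT).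
  by slia.
have := cdist_split2 w's ws zs; rewrite E eq_sym b2 -E => /(_ isT (ltnW le)).
have := c1 _ w'W; rewrite eq_sym ww' => /(_ isT); have := cdist_gt0 w's zs.
by rewrite E eq_sym b2 => /(_ isT); rewrite -E; slia.
Qed.

(** A vertex in both arcs would put the nearer start inside the arc of the farther one. *)
Lemma nextin_disj w w' v : w \in W -> w' \in W -> v \in s ->
  cdist w v < cdist w (nx w) -> cdist w' v < cdist w' (nx w') -> w = w'.
Proof.
move=> wW w'W vs.
wlog le : w w' wW w'W / cdist w v <= cdist w' v.
  move=> H h1 h2; have [le|/ltnW le] := leqP (cdist w v) (cdist w' v); first exact: H.
  by rewrite (H w' w).
move=> h1 h2; apply/eqP/negPn/negP => ww'.
have [_ _ c2] := nextinP w'W; have := c2 _ wW ww'.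
have [E|vw] := eqVneq w v; first by rewrite E; slia.
by have := cdist_split2 (Ws wW) (Ws w'W) vs vw le; slia.
Qed.

Lemma card_arc w d : w \in s -> d <= size s -> d <= #|[set v in s | cdist w v < d]|.
Proof.
move=> ws ds; pose f (i : 'I_d) := nth w s ((index w s + i) %% size s).
have s0 : 0 < size s by rewrite -index_mem in ws; slia.
have fi i : index (f i) s = (index w s + i) %% size s.
  by apply: index_uniq => //; rewrite ltn_mod.
have wi : index w s < size s by rewrite index_mem.
have Ed (i : 'I_d) : (index w s + i) %% size s =
    if index w s + i < size s then index w s + i else index w s + i - size s.
  have id_ := ltn_ord i; case: (ltnP (index w s + i) (size s)) => le; first by rewrite modn_small.
  have -> : index w s + i = (index w s + i - size s) + size s by slia.
  by rewrite modnDr addnK modn_small //; slia.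
have inj : injective f.
  move=> i j E; apply/val_inj => /=; have := fi i; rewrite E fi !Ed.
  by have := ltn_ord i; have := ltn_ord j; case: ifP; case: ifP; slia.
rewrite -[leqLHS]card_ord -(card_imset _ inj); apply: subset_leq_card.
apply/subsetP => v /imsetP[i _ ->]; rewrite inE mem_nth ?ltn_mod //=.
Transparent cdist.
by rewrite /cdist fi Ed; have := ltn_ord i; case: ifP; case: ifP; slia.
Qed.

#[global] Opaque cdist.

Lemma sum_le1 (I : finType) (A : {set I}) (Q : pred I) :
  {in A &, forall i j, Q i -> Q j -> i = j} -> \sum_(i in A) Q i <= 1.
Proof.
move=> H; have [[i iA Qi]|no] := classic (exists2 i, i \in A & Q i).
  rewrite (bigD1 i) //= Qi big1 // => j /andP[jA ji].
  by apply/eqP; rewrite eqb0; apply/negP => Qj; rewrite (H _ _ jA iA Qj Qi) eqxx in ji.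
rewrite big1 // => i iA; apply/eqP; rewrite eqb0; apply/negP => Qi; apply: no; by exists i.
Qed.

(** The half-open arcs from the elements of [W] to their successors are pairwise disjoint, so each
    vertex of [s] is counted at most once. *)
Lemma nextin_sum : \sum_(w in W) cdist w (nx w) <= size s.
Proof.
have -> : size s = #|[set v in s]| by rewrite cardsE; apply/esym/card_uniqP.
apply: (@leq_trans (\sum_(w in W) \sum_(v in [set v in s]) (cdist w v < cdist w (nx w)))).
  apply: leq_sum => w wW; have [nW _ _] := nextinP wW.
  apply: leq_trans (card_arc (Ws wW) (ltnW (cdist_lt (Ws wW) (Ws nW)))) _.
  rewrite -sum1_card big_mkcond [leqRHS]big_mkcond /=; apply: leq_sum => v _.
  by rewrite !inE; case: (v \in s) => //=; case: ltnP.
rewrite exchange_big -sum1_card /=; apply: leq_sum => v; rewrite inE => vs.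
by apply: sum_le1 => w w' wW w'W; apply: nextin_disj.
Qed.

Lemma nextin_before w y : w \in W -> y \in s -> nx w != y ->
  cdist w (nx w) <= cdist w y -> cdist (nx w) y < cdist w y.
Proof.
move=> wW ys _ le; have [nW nw _] := nextinP wW.
have := cdist_split (Ws wW) (Ws nW) ys le.
by have := cdist_gt0 (Ws wW) (Ws nW); rewrite eq_sym nw => /(_ isT); slia.
Qed.

Lemma nextin_owner y : y \in s -> y \notin W ->
  exists2 w, w \in W & 0 < cdist w y < cdist w (nx w).
Proof.
move=> ys yW; have [w0 w0W] : exists w, w \in W by apply/card_gt0P; slia.
have [w wW H] := @ex_min T (fun w => w \in W) (cdist^~ y) (ex_intro _ w0 w0W).
have [nW nw _] := nextinP wW.
have wy : w != y by apply: contraNneq yW => <-.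
have ny : nx w != y by apply: contraNneq yW => <-.
exists w; rewrite // (cdist_gt0 (Ws wW) ys wy) ltnNge; apply/negP => le.
by have := H _ nW; rewrite leqNgt (nextin_before wW ys ny le).
Qed.

(** Among the elements satisfying [P], take one with the shortest forward distance to an element
    that fails it; if its successor satisfied [P], it would be closer still. *)
Lemma nextin_change (P : pred T) : (exists2 w, w \in W & P w) ->
  (exists2 w, w \in W & ~~ P w) -> exists w, [/\ w \in W, P w & ~~ P (nx w)].
Proof.
move=> [w0 w0W Pw0] [y yW nPy].
have [w [wW Pw] H] := @ex_min T (fun w => w \in W /\ P w) (cdist^~ y)
  (ex_intro _ w0 (conj w0W Pw0)).
exists w; split=> //; have [nW nw mn] := nextinP wW; apply/negP => Pn.
have yw : y != w by apply: contraNneq nPy => ->.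
have ny : nx w != y by apply: contraNneq nPy => <-.
by have := H _ (conj nW Pn); rewrite leqNgt (nextin_before wW (Ws yW) ny (mn _ yW yw)).
Qed.

Lemma nextin_reindex (om : T -> nat) : \sum_(w in W) om (nx w) = \sum_(w in W) om w.
Proof.
have E : nx @: W = W.
  apply/eqP; rewrite eqEcard (card_in_imset nextin_inj) leqnn andbT.
  by apply/subsetP => z /imsetP[w wW ->]; have [] := nextinP wW.
by rewrite -[in RHS]E big_imset //=; apply: nextin_inj.
Qed.

(** Each gap is charged the weights of both its ends; as the successor map permutes [W], every
    weight is charged twice. *)
Lemma weight_bound (om : T -> nat) (a : nat) :
  (forall w, w \in W -> om w + om (nx w) <= a * cdist w (nx w)) ->
  \sum_(w in W) om w * 2 <= a * size s.
Proof.
move=> H; apply: leq_trans (leq_mul (leqnn a) nextin_sum).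
rewrite big_distrr /= -big_distrl /= muln2 -addnn.
rewrite -{2}nextin_reindex -big_split /=; apply: leq_sum => w; exact: H.
Qed.

Lemma weight_bound_excess (om : T -> nat) (a E : nat) w0 : w0 \in W ->
  (forall w, w \in W -> om w + om (nx w) <= a * cdist w (nx w)) ->
  om w0 + om (nx w0) + E <= a * cdist w0 (nx w0) ->
  \sum_(w in W) om w * 2 + E <= a * size s.
Proof.
move=> w0W H H0; apply: leq_trans (leq_mul (leqnn a) nextin_sum).
rewrite big_distrr /= -big_distrl /= muln2 -addnn -{2}nextin_reindex -big_split /=.
rewrite (bigD1 w0) //= [leqRHS](bigD1 w0) //= addnAC leq_add //.
by apply: leq_sum => w /andP[wW _]; apply: H.
Qed.

End Next.
End CyclicDistance.

(** * Rerouting a cycle through a path off it *)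

Section Reroute.
Variable G : sgraph.
Implicit Types (A B : {set G}) (x y z w : G) (s : seq G).
Notation e := (@adj G).

Lemma arc_split (T : finType) (s : seq T) (x y : T) : uniq s -> x \in s -> y \in s -> x != y ->
  exists i (p1 p2 : seq T), rot i s = x :: p1 ++ y :: p2 /\ (size p1).+1 = cdist s x y.
Proof.
move=> us xs ys xy.
have spl (a b : T) : a \in s -> b \in s -> index a s < index b s ->
    exists s1 s2 s3 : seq T, [/\ s = s1 ++ a :: s2 ++ b :: s3, index a s = size s1
      & index b s = size s1 + (size s2).+1].
  move=> as_ bs lt.
  case/splitPr: as_ us bs lt => s1 s2 us bs.
  have na : a \notin s1.
    by move: us; rewrite cat_uniq => /and3P[_ /hasPn/(_ a) + _]; rewrite mem_head => /(_ isT).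
  rewrite !index_cat (negPf na) /= eqxx addn0.
  case: ifPn => [b1|b1]; first by rewrite -index_mem in b1; slia.
  move: bs; rewrite mem_cat (negPf b1) /= inE eq_sym; case: eqP => [_|_ /= bs] lt; first by slia.
  case/splitPr: bs us lt => s3 s4 us lt.
  exists s1, s3, s4; split => //; congr (_ + _.+1).
  rewrite index_cat /= eqxx addn0 ifN //.
  move: us; rewrite cat_uniq /= cat_uniq => /and3P[_ _ /and3P[_ _ /andP[/hasPn/(_ b) +_]]].
  by rewrite mem_head => /(_ isT).
have := index_neq xs ys xy; rewrite neq_ltn => /orP[lt|lt].
  have [s1 [s2 [s3 [E ix iy]]]] := spl _ _ xs ys lt.
  Transparent cdist.
  exists (size s1), s2, (s3 ++ s1); rewrite /cdist ix iy leq_addr; split; last by slia.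
  by rewrite {1}E rot_size_cat /= -catA.
have [s1 [s2 [s3 [E iy ix]]]] := spl _ _ ys xs lt.
exists (size (s1 ++ y :: s2)), (s3 ++ s1), s2; rewrite /cdist ix iy ifN; last by slia.
split; last by rewrite E !size_cat /= size_cat /=; slia.
by rewrite {1}E -cat_cons catA rot_size_cat /= -catA.
Qed.

#[global] Opaque cdist.

Lemma is_cycle_uniq s : is_cycle s -> uniq s.
Proof. by case: s => [|a [|b s]] //= /andP[]. Qed.

Lemma is_cycle_cycle s : is_cycle s -> 1 < size s -> cycle e s.
Proof. by case: s => [|a [|b s]] //= /andP[]. Qed.

Lemma is_cycleI s : uniq s -> cycle e s -> 0 < size s -> is_cycle s.
Proof. by case: s => [|a [|b s]] // us cs _; apply/andP. Qed.

Lemma size_gt1 (T : eqType) (s : seq T) (x y : T) : x \in s -> y \in s -> x != y -> 1 < size s.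
Proof.
by case: s => [|a [|b s]] //; rewrite !inE => /eqP-> /eqP->; rewrite eqxx.
Qed.

(** The inner vertices of the arc from [w] to [w'] are replaced by the path through [A], which has
    at least [n + 1] vertices; the count is written without subtraction. *)
Lemma reroute s A x y w w' n : is_cycle s -> w \in s -> w' \in s -> w != w' ->
  lp A x y n -> (forall v, v \in A -> v \notin s) -> e w x -> e w' y ->
  exists t, [/\ is_cycle t, size s + n + 2 <= size t + cdist s w w' & {subset t <= [predU s & A]}].
Proof.
move=> cs ws w's ww' [p [pp up lpy sA] le] dis wx w'y.
have us := is_cycle_uniq cs; have ce := is_cycle_cycle cs (size_gt1 ws w's ww').
have [i [p1 [p2 [E E']]]] := arc_split us ws w's ww'.
have us' : uniq (w :: p1 ++ w' :: p2) by rewrite -E rot_uniq.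
have ce' : cycle e (w :: p1 ++ w' :: p2) by rewrite -E rot_cycle.
have sz : size s = size (w :: p1 ++ w' :: p2) by rewrite -E size_rot.
have mi v : (v \in w :: p1 ++ w' :: p2) = (v \in s) by rewrite -E mem_rot.
exists (w :: x :: p ++ w' :: p2); split.
- apply: is_cycleI => //; last first.
    move: ce'; rewrite /= !rcons_cat !cat_path /= => /and3P[_ _ h].
    by rewrite wx pp lpy (adjC w'y).
  have : perm_eq (w :: x :: p ++ w' :: p2) ((x :: p) ++ (w :: w' :: p2)).
    by rewrite -cat_cons -[w :: _ ++ _]cat1s -[_ :: w' :: _]cat1s perm_catCA.
  move=> /perm_uniq->; rewrite cat_uniq up andTb.
  have sub : subseq (w :: w' :: p2) (w :: p1 ++ w' :: p2).
    by rewrite /= eqxx suffix_subseq.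
  rewrite (subseq_uniq sub us') andbT.
  apply/hasPn => v vs; apply/negP => /sA/dis; rewrite -mi => /negP; apply.
  exact: mem_subseq sub _ vs.
- by rewrite sz -E' /= !size_cat /=; slia.
- move=> v; rewrite -[w :: _]/([:: w] ++ (x :: p) ++ (w' :: p2)) !mem_cat mem_seq1 !inE.
  move=> /or4P[/eqP->|vp|/eqP->|vp2]; rewrite ?ws ?w's //.
    by rewrite (sA v) ?orbT // inE.
  by rewrite -mi inE mem_cat inE vp2 !orbT.
Qed.

Definition longest_in A s :=
  [/\ is_cycle s, {subset s <= A} & forall t, is_cycle t -> {subset t <= A} -> size t <= size s].

Lemma gap A B s x y w w' n : longest_in A s -> w \in s -> w' \in s -> w != w' ->
  lp B x y n -> B \subset A -> (forall v, v \in B -> v \notin s) -> e w x -> e w' y ->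
  n + 2 <= cdist s w w'.
Proof.
move=> [cs sA mx] ws w's ww' l /subsetP BA dis wx w'y.
have [t [ct st sub]] := reroute cs ws w's ww' l dis wx w'y.
have := mx _ ct; suff H : {subset t <= A} by move=> /(_ H); slia.
by move=> v /sub /orP[/sA|/BA].
Qed.

Lemma arc_lp s x y : is_cycle s -> x \in s -> y \in s -> x != y ->
  lp [set z in s] x y (cdist s x y).
Proof.
move=> cs xs ys xy.
have us := is_cycle_uniq cs; have ce := is_cycle_cycle cs (size_gt1 xs ys xy).
have [i [p1 [p2 [E E']]]] := arc_split us xs ys xy.
have us' : uniq (x :: p1 ++ y :: p2) by rewrite -E rot_uniq.
have ce' : cycle e (x :: p1 ++ y :: p2) by rewrite -E rot_cycle.
have mi v : (v \in x :: p1 ++ y :: p2) = (v \in s) by rewrite -E mem_rot.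
exists (rcons p1 y); last by rewrite size_rcons E'.
split.
- by rewrite rcons_path; move: ce'; rewrite /= rcons_cat cat_path /= => /and3P[-> -> _].
- by apply: subseq_uniq us'; rewrite /= eqxx -cat_rcons prefix_subseq.
- by rewrite last_rcons.
- by move=> v vp; rewrite inE -mi -cat_rcons -cat_cons mem_cat vp.
Qed.

Lemma long_arc s x y n : is_cycle s -> x \in s -> y \in s -> x != y ->
  n <= cdist s x y \/ n <= cdist s y x -> lp [set z in s] x y n.
Proof.
move=> cs xs ys xy [le|le]; first exact: lp_le le (arc_lp cs xs ys xy).
by apply: lp_le le (lp_sym (arc_lp cs ys xs _)); rewrite eq_sym.
Qed.

Lemma half_arc s x y : is_cycle s -> x \in s -> y \in s -> x != y ->
  lp [set z in s] x y (uphalf (size s)).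
Proof.
move=> cs xs ys xy; apply: long_arc => //.
by have := cdistC xs ys xy; slia.
Qed.

End Reroute.

(** * Menger's theorem *)

Section Menger.
Variable V : finType.
Implicit Types (r : rel V) (A B X S : {set V}) (f : V -> seq V).

Definition separates r A B X :=
  forall a p, a \in A -> path r a p -> last a p \in B -> exists2 v, v \in a :: p & v \in X.

Definition linkage r A B S f :=
  [/\ S \subset A,
      forall a, a \in S -> [/\ path r a (f a), uniq (a :: f a) & last a (f a) \in B]
    & forall a a' v, a \in S -> a' \in S -> v \in a :: f a -> v \in a' :: f a' -> a = a'].

(** The ends of [#|B|] disjoint paths exhaust [B], so [u] is the end of some path, and disjointness
    makes it the path of [a]. *)
Lemma linkage_end r A B S f : linkage r A B S f -> #|S| = #|B| ->
  forall a u, a \in S -> u \in B -> u \in a :: f a -> u = last a (f a).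
Proof.
move=> [_ Sf dis] SB a u aS uB ua.
have inj : {in S &, injective (fun a => last a (f a))}.
  move=> b c bS cS E; apply: (dis _ _ (last b (f b))) => //; first exact: mem_last.
  by rewrite [last b _]E mem_last.
have : u \in [set last a (f a) | a in S].
  suff -> : [set last a (f a) | a in S] = B by [].
  apply/eqP; rewrite eqEcard card_in_imset // SB leqnn andbT.
  by apply/subsetP => v /imsetP[b bS ->]; have [] := Sf b bS.
case/imsetP => b bS E; rewrite (dis a b u aS bS ua) //.
by rewrite E mem_last.
Qed.

Lemma split_at (a v : V) p : v \in a :: p ->
  exists p1 p2, p = p1 ++ p2 /\ last a p1 = v.
Proof.
rewrite inE => /orP[/eqP->|]; first by exists [::], p.
by case/splitPr => p1 p2; exists (rcons p1 v), p2; rewrite cat_rcons last_rcons.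
Qed.

Lemma first_in X r a (p : seq V) : path r a p -> last a p \in X ->
  exists p1 p2, [/\ p = p1 ++ p2, last a p1 \in X & {in belast a p1, forall v, v \notin X}].
Proof.
elim: p a => [|b p IH] a /=; first by exists [::], [::].
move=> /andP[ab pp] lX; have [aX|aX] := boolP (a \in X); first by exists [::], (b :: p).
have [p1 [p2 [-> l1 H]]] := IH _ pp lX; exists (b :: p1), p2; split => //.
by move=> v /=; rewrite inE => /orP[/eqP->|/H].
Qed.

Lemma last_in X a (p : seq V) : (exists2 v, v \in a :: p & v \in X) ->
  exists p1 p2, [/\ p = p1 ++ p2, last a p1 \in X & {in p2, forall v, v \notin X}].
Proof.
elim/last_ind: p => [|p b IH]; first by case=> v; rewrite inE => /eqP-> aX; exists [::], [::].
have [bX _|bX [v]] := boolP (b \in X).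
  by exists (rcons p b), [::]; rewrite cats0 last_rcons.
rewrite -rcons_cons mem_rcons inE => /orP[/eqP->|vp vX]; first by rewrite (negPf bX).
have [|p1 [p2 [-> l1 H]]] := IH; first by exists v.
exists p1, (rcons p2 b); rewrite rcons_cat; split => // u.
by rewrite mem_rcons inE => /orP[/eqP->|/H].
Qed.

Definition rmedge r x y : rel V := fun a b => r a b && ~~ ((a == x) && (b == y)).

Lemma path_rmedge_src r x y a p : path r a p -> {in belast a p, forall v, v != x} ->
  path (rmedge r x y) a p.
Proof.
elim: p a => //= b p IH a /andP[ab pp] H.
by rewrite /rmedge ab (negPf (H a (mem_head _ _))) /=; apply: IH => // v vp; apply: H; rewrite inE vp orbT.
Qed.

Lemma path_rmedge_tgt r x y a p : path r a p -> {in p, forall v, v != y} ->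
  path (rmedge r x y) a p.
Proof.
elim: p a => //= b p IH a /andP[ab pp] H.
rewrite /rmedge ab (negPf (H b (mem_head _ _))) andbF /=.
by apply: IH => // v vp; apply: H; rewrite inE vp orbT.
Qed.

Lemma subset_card_exists (A : {set V}) n : n <= #|A| -> exists2 B : {set V}, B \subset A & #|B| = n.
Proof.
move=> /card_geqP[s [us <- sA]]; exists [set v in s].
  by apply/subsetP => v; rewrite inE => /sA.
by rewrite cardsE; apply/card_uniqP.
Qed.

Section GoeringStep.
Variables (r : rel V) (A B S : {set V}) (x y : V) (n : nat).
Notation r' := (rmedge r x y).
Hypothesis rxy : r x y.
Hypothesis sepS : separates r' A B S.
Hypothesis cardP : #|x |: S| = n.
Hypothesis cardQ : #|y |: S| = n.
Hypothesis xS : x \notin S.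
Hypothesis yS : y \notin S.
Variables (SA SB : {set V}) (fA fB : V -> seq V).
Hypothesis lA : linkage r' A (x |: S) SA fA.
Hypothesis lB : linkage r' (y |: S) B SB fB.
Hypothesis cA : #|SA| = n.
Hypothesis cB : #|SB| = n.

Lemma goering_endA a u : a \in SA -> u \in x |: S -> u \in a :: fA a -> u = last a (fA a).
Proof. by apply: (linkage_end lA); rewrite cA cardP. Qed.

Lemma goering_SB : SB = y |: S.
Proof. by apply/eqP; rewrite eqEcard cB cardQ leqnn andbT; case: lB. Qed.

Lemma goering_startB q u : q \in SB -> u \in y |: S -> u \in q :: fB q -> u = q.
Proof.
case: (lB) => _ _ dis qS uQ uq; apply: (dis _ _ u) => //; first by rewrite goering_SB.
exact: mem_head.
Qed.

(** Splicing the two paths at [v] gives a path from [A] to [B] without the deleted edge, so it meets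
    [S]. The first path meets [S] only at its end and the second only at its start, which leaves
    only [v] itself. *)
Lemma goering_meet a q v : a \in SA -> q \in SB -> v \in a :: fA a -> v \in q :: fB q -> v \in S.
Proof.
move=> aS qS va vq; case: (lA) => sA HA _; case: (lB) => sB HB _.
have [pa ua la] := HA a aS; have [pq uq lq] := HB q qS.
have [p1 [p2 [Ep lp1]]] := split_at va; have [q1 [q2 [Eq lq1]]] := split_at vq.
have : exists2 v, v \in a :: (p1 ++ q2) & v \in S.
  apply: sepS; first exact: subsetP sA _ aS.
    move: pa pq; rewrite Ep Eq !cat_path lp1 lq1 => /andP[-> _] /andP[_ ->] //.
  by move: lq; rewrite last_cat lp1 Eq last_cat lq1.
case=> u; rewrite -cat_cons mem_cat => /orP[] uu uS.
  have E : u = last a (fA a).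
    apply: goering_endA => //; first by rewrite !inE uS orbT.
    by rewrite Ep -cat_cons mem_cat uu.
  move: ua E uu; rewrite Ep -cat_cons cat_uniq last_cat lp1.
  case: p2 {Ep} => [|b p2]; first by move=> _ /= <-.
  by move=> /and3P[_ /hasPn dis _] E uu; have := dis _ (mem_last b p2); rewrite E /= in uu *; rewrite uu.
have E : u = q.
  apply: goering_startB => //; first by rewrite !inE uS orbT.
  by rewrite Eq inE mem_cat uu !orbT.
by move: uq; rewrite Eq /= mem_cat -E uu orbT.
Qed.

(** A path ending in [x] continues over the deleted edge to [y]; one ending in [S] continues with
    the second path that starts there, whose first vertex it already contains. *)
Definition goering_tail p := if p == x then y :: fB y else fB p.
Definition goering_start p := if p == x then y else p.

Lemma goering_link : exists f, linkage r A B SA f.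
Proof.
exists (fun a => fA a ++ goering_tail (last a (fA a))).
case: (lA) => sA HA dA; case: (lB) => sB HB dB.
have subr' a p : path r' a p -> path r a p by apply: sub_path => ? ? /andP[].
have stP p : p \in x |: S -> goering_start p \in SB.
  rewrite goering_SB /goering_start !inE; case: eqP => [->|_] /=; first by rewrite eqxx.
  by move=> ->; rewrite orbT.
have tl p v : v \in goering_tail p -> v \in goering_start p :: fB (goering_start p).
  by rewrite /goering_tail /goering_start; case: eqP => // _ vp; rewrite inE vp orbT.
have tlP p : p \in x |: S ->
    path r p (goering_tail p) /\ last p (goering_tail p) \in B.
  move=> /stP; rewrite /goering_tail /goering_start.
  case: eqP => [->|_] /HB[pp _ lp] /=; last by split => //; apply: subr'.
  by rewrite rxy subr'.
have inj p p' : p \in x |: S -> p' \in x |: S -> goering_start p = goering_start p' -> p = p'.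
  rewrite /goering_start !inE; case: eqP => [->|_] /=; case: eqP => [->|_] //=.
    by move=> _ p'S E; rewrite -E (negPf yS) in p'S.
  by move=> pS _ E; rewrite E (negPf yS) in pS.
have meet a p v : a \in SA -> p \in x |: S -> v \in a :: fA a -> v \in goering_tail p ->
    v = last a (fA a) /\ v = p -> False.
  move=> aS pP va /[dup] /tl vt vt' [_ Ep].
  have vS := goering_meet aS (stP _ pP) va vt.
  have px : p != x by apply: contraNneq xS => <-; rewrite -Ep.
  have := HB _ (stP _ pP); rewrite /goering_start (negPf px) => -[_ /andP[/negP H _] _].
  by apply: H; move: vt'; rewrite /goering_tail (negPf px) Ep.
have meetS a p v : a \in SA -> p \in x |: S -> v \in a :: fA a -> v \in goering_tail p ->
    v = last a (fA a) /\ v = p.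
  move=> aS pP va vt; have vS := goering_meet aS (stP _ pP) va (tl _ _ vt); split.
    by apply: goering_endA => //; rewrite !inE vS orbT.
  have vQ : v \in y |: S by rewrite !inE vS orbT.
  have := goering_startB (stP _ pP) vQ (tl _ _ vt); rewrite /goering_start; case: eqP => // _ E.
  by move: yS; rewrite -E vS.
have noA a p v : a \in SA -> p \in x |: S -> v \in a :: fA a -> v \in goering_tail p -> False.
  by move=> aS pP va vt; apply: (meet a p v) => //; apply: meetS.
have inP a : a \in SA -> last a (fA a) \in x |: S by case/HA.
split => //.
- move=> a aS; have [pa ua la] := HA _ aS; have [tp tB] := tlP _ la; split.
  + by rewrite cat_path subr'.
  + rewrite -cat_cons cat_uniq ua /=; apply/andP; split.
      by apply/hasPn => v vt; apply/negP => va; case: (noA a _ v aS la va vt).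
    have := HB _ (stP _ la); rewrite /goering_tail /goering_start.
    by case: ifP => _ [_ /= /andP[h1 h2] _]; rewrite ?h1 ?h2.
  + by rewrite last_cat.
- move=> a a' v aS a'S; rewrite -!cat_cons !mem_cat => /orP[va|va] /orP[va'|va'].
  + exact: dA va va'.
  + by case: (noA a _ v _ (inP _ a'S) va va').
  + by case: (noA a' _ v _ (inP _ aS) va' va).
  + have E := dB _ _ _ (stP _ (inP _ aS)) (stP _ (inP _ a'S)) (tl _ _ va) (tl _ _ va').
    have {}E := inj _ _ (inP _ aS) (inP _ a'S) E.
    by apply: (dA _ _ (last a (fA a))) => //; rewrite ?mem_last // E mem_last.
Qed.

End GoeringStep.

(* Goering's proof: delete an edge and recurse. *)
Theorem menger r A B n : irreflexive r -> (forall X, separates r A B X -> n <= #|X|) ->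
  exists S f, linkage r A B S f /\ #|S| = n.
Proof.
have [m] := ubnP #|[set xy | r xy.1 xy.2]|.
elim: m r A B => // m IH r A B; rewrite ltnS => lem irr sep.
have [[x y] /= rxy|noe] := pickP (fun xy => r xy.1 xy.2); last first.
  have nor a p : path r a p -> p = [::].
    by case: p => //= b p /andP[ab _]; have := noe (a, b); rewrite /= ab.
  have /subset_card_exists[S sAB cS] : n <= #|A :&: B|.
    by apply: sep => a p aA /nor-> /= aB; exists a; rewrite !inE ?eqxx ?aA.
  exists S, (fun=> [::]); split => //; split.
  - by apply: subset_trans sAB _; rewrite subsetIl.
  - by move=> a aS; have := subsetP sAB _ aS; rewrite inE => /andP[].
  - by move=> a a' v _ _; rewrite !inE => /eqP-> /eqP.
pose r' := rmedge r x y.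
have irr' : irreflexive r' by move=> z; rewrite /r' /rmedge irr.
have subr' a p : path r' a p -> path r a p by apply: sub_path => ? ? /andP[].
have lt' : #|[set ab | r' ab.1 ab.2]| < m.
  apply: leq_trans lem; apply: proper_card; apply/properP; split.
    by apply/subsetP => ab; rewrite !inE => /andP[].
  by exists (x, y); rewrite !inE //= /r' /rmedge !eqxx andbF.
have [sep'|] := classic (forall X, separates r' A B X -> n <= #|X|).
  have [S [f [[h1 h2 h3] h4]]] := IH r' A B lt' irr' sep'.
  exists S, f; split => //; split => // a aS; have [h5 h6 h7] := h2 _ aS; split => //.
  exact: subr'.
move=> nsep; have [S nS] := not_all_ex_not _ _ nsep.
have [sepS /negP] := imply_to_and _ _ nS; rewrite -ltnNge => cS.
(* The only edge absent from [r'] leaves [x] and enters [y], so adding either of them to [S]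
   separates in [r]; this forces [#|S| = n - 1]. *)
have sepP : n <= #|x |: S|.
  apply: sep => a p aA pp lB; have [xp|xp] := boolP (x \in a :: p).
    by exists x; rewrite ?inE ?eqxx.
  have [|v vp vS] := sepS a p aA _ lB; last by exists v; rewrite ?inE ?vS ?orbT.
  by apply: path_rmedge_src => // v vp; apply: contraNneq xp => <-; apply: mem_belast vp.
have sepQ : n <= #|y |: S|.
  apply: sep => a p aA pp lB; have [yp|yp] := boolP (y \in a :: p).
    by exists y; rewrite ?inE ?eqxx.
  have [|v vp vS] := sepS a p aA _ lB; last by exists v; rewrite ?inE ?vS ?orbT.
  by apply: path_rmedge_tgt => // v vp; apply: contraNneq yp => <-; rewrite inE vp orbT.
have xS : x \notin S.
  by apply/negP => xS; move: sepP; rewrite cardsU1 xS add0n leqNgt cS.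
have yS : y \notin S.
  by apply/negP => yS; move: sepQ; rewrite cardsU1 yS add0n leqNgt cS.
have cP : #|x |: S| = n by apply/eqP; rewrite eqn_leq sepP andbT cardsU1 xS.
have cQ : #|y |: S| = n by apply/eqP; rewrite eqn_leq sepQ andbT cardsU1 yS.
(* Every path of [r] from [A] to [B] meets [x |: S], and up to its first vertex there it does not
   use the deleted edge. Hence a set separating [A] from [x |: S] in [r'] separates [A] from [B] in
   [r]. *)
have [|SA [fA [lA cA]]] := IH r' A (x |: S) lt' irr' _.
  move=> X sX; apply: sep => a p aA pp lB.
  have [|p1 [p2 [E l1 H]]] := @last_in (x |: S) a p.
    have [xp|xp] := boolP (x \in a :: p); first by exists x; rewrite ?inE ?eqxx.
    have [|v vp vS] := sepS a p aA _ lB; last by exists v; rewrite ?inE ?vS ?orbT.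
    by apply: path_rmedge_src => // v vp; apply: contraNneq xp => <-; apply: mem_belast vp.
  move: pp; rewrite E cat_path => /andP[pp1 _].
  have [q1 [q2 [E' l1' H']]] := first_in pp1 l1.
  have [|v vq vX] := sX a q1 aA _ l1'; last first.
    by exists v => //; rewrite E' -!cat_cons !mem_cat vq.
  apply: path_rmedge_src; first by move: pp1; rewrite E' cat_path => /andP[].
  by move=> v /H'; rewrite !inE; case: eqP.
have [|SB [fB [lB cB]]] := IH r' (y |: S) B lt' irr' _.
  move=> X sX; apply: sep => a p aA pp lB.
  have [|p1 [p2 [E l1 H]]] := @last_in (y |: S) a p.
    have [yp|yp] := boolP (y \in a :: p); first by exists y; rewrite ?inE ?eqxx.
    have [|v vp vS] := sepS a p aA _ lB; last by exists v; rewrite ?inE ?vS ?orbT.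
    by apply: path_rmedge_tgt => // v vp; apply: contraNneq yp => <-; rewrite inE vp orbT.
  have [||v vq vX] := sX (last a p1) p2 l1.
  - apply: path_rmedge_tgt; first by move: pp; rewrite E cat_path => /andP[].
    by move=> v /H; rewrite !inE; case: eqP.
  - by move: lB; rewrite E last_cat.
  - exists v => //; rewrite E -cat_cons mem_cat; move: vq; rewrite inE => /orP[/eqP->|->].
      by rewrite mem_last.
    by rewrite orbT.
have [f lf] := goering_link rxy sepS cP cQ xS yS lA lB cA cB.
by exists SA, f.
Qed.
End Menger.

Section MorePaths.
Variable G : sgraph.
Implicit Types (A : {set G}) (x y z p : G).
Notation e := (@adj G).

Lemma lp_uncons A p y n : p \notin A -> y != p -> lp (p |: A) p y n ->
  exists2 q, e p q & lp A q y n.-1.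
Proof.
move=> pA yp [[|q r] [pp up lr sA] le]; first by move: yp; rewrite -lr eqxx.
move: pp up => /= /andP[pq pr] /andP[/negP pn ur].
exists q => //; exists r; last by move: le => /=; case: (n) => // n' /=.
split => // v vr; have := sA v; rewrite inE vr orbT => /(_ isT).
by rewrite !inE => /orP[/eqP E|//]; rewrite E in vr.
Qed.

Lemma lp_cons A p q y n : p \notin A -> e p q -> lp A q y n -> lp (p |: A) p y n.+1.
Proof.
move=> pA pq lq; have lpp : lp [set p] p p 0 by apply: lp_refl; rewrite inE.
have := lp_join lpp lq pq; rewrite add0n; apply => v; rewrite !inE => /eqP->.
by move=> pA'; rewrite pA' in pA.
Qed.

Lemma lp_to_new_end A x y z n : x \notin A -> z \in A -> lp (x |: A) x y n ->
  (exists2 r, spath (x |: A) x y r & z \in r) -> lp A z y 0.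
Proof.
move=> xA zA _ [r [pr ur lr sA] zr].
case/splitPr: zr pr ur lr sA => r1 r2; rewrite cat_path last_cat /= cat_uniq.
move=> /and3P[_ _ p2] /and3P[xr _ /andP[_ /andP[z2 u2]]] l2 sA.
exists r2 => //; split => //; first by rewrite /= z2.
move=> v vr; have := sA v; rewrite inE mem_cat vr !orbT => /(_ isT).
rewrite !inE => /orP[/eqP E|//]; move: xr; rewrite mem_cat -E vr orbT //.
Qed.

End MorePaths.

Lemma card_cdist (T : finType) (s : seq T) (a : T) i j : a \in s ->
  #|[set z in s | i < cdist s a z <= j]| <= j - i.
Proof.
move=> as_; set A := [set z in s | _].
rewrite cardE -(size_map (cdist s a)) -[leqRHS](size_iota i.+1).
apply: uniq_leq_size.
  rewrite map_inj_in_uniq ?enum_uniq // => y z; rewrite !mem_enum !inE.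
  by move=> /andP[ys _] /andP[zs _]; apply: cdist_inj.
move=> n /mapP[z]; rewrite mem_enum inE => /andP[_ H] ->; rewrite mem_iota; lia.
Qed.

(** * A cycle cut open at one of its vertices *)

Section Linear.
Variables (G : sgraph) (D : seq G).
Hypothesis cD : is_cycle D.
Variables (a : G).
Hypothesis aD : a \in D.
Notation e := (@adj G).

Definition lin := rot (index a D) D.

Lemma lin_uniq : uniq lin.
Proof. by rewrite rot_uniq is_cycle_uniq. Qed.

Lemma mem_lin x : (x \in lin) = (x \in D).
Proof. exact: mem_rot. Qed.

Lemma size_lin : size lin = size D.
Proof. exact: size_rot. Qed.

Transparent cdist.
Lemma index_lin x : x \in D -> index x lin = cdist D a x.
Proof.
move=> xD; have us := is_cycle_uniq cD.
have ia : index a D < size D by rewrite index_mem.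
have ix : index x D < size D by rewrite index_mem.
rewrite /lin /rot /cdist index_cat.
have [xd|xd] := boolP (x \in drop (index a D) D).
  have E : x \notin take (index a D) D.
    move: us; rewrite -{1}(cat_take_drop (index a D) D) cat_uniq => /and3P[_ /hasPn/(_ x xd)] //.
  have : index x D = index a D + index x (drop (index a D) D).
    rewrite -{1}(cat_take_drop (index a D) D) index_cat (negPf E) size_takel //.
    exact: ltnW.
  by move=> ->; rewrite leq_addr addKn.
have xt : x \in take (index a D) D.
  by move: xD; rewrite -{1}(cat_take_drop (index a D) D) mem_cat (negPf xd) orbF.
have E : index x D = index x (take (index a D) D).
  by rewrite -{1}(cat_take_drop (index a D) D) index_cat xt.
have lt : index x D < index a D.
  by rewrite E; apply: leq_trans (_ : size (take (index a D) D) <= _); rewrite ?index_mem // size_take_min geq_minl.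
rewrite leqNgt lt /= -E size_drop; lia.
Qed.
#[global] Opaque cdist.

Lemma lin_cycle : 1 < size D -> cycle e lin.
Proof. by move=> h1; rewrite rot_cycle; apply: is_cycle_cycle. Qed.

Lemma lin_sorted : sorted e lin.
Proof.
case: (leqP (size D) 1) => h1; last first.
  by have := lin_cycle h1; case: lin => //= b s; rewrite rcons_path => /andP[].
by have := size_lin; case: lin => [|b [|c s]] //= E; rewrite -E in h1.
Qed.

Lemma lin_arc i j : i <= j < size D ->
  lp (seg lin i j) (nth a lin i) (nth a lin j) (j - i).
Proof. by move=> H; apply: lp_seg; rewrite ?lin_sorted ?lin_uniq ?size_lin. Qed.

Lemma nth_lin x : x \in D -> nth a lin (cdist D a x) = x.
Proof. by move=> xD; rewrite -index_lin // nth_index // mem_lin. Qed.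

Lemma lin_arc_to x y : x \in D -> y \in D -> cdist D a x <= cdist D a y ->
  lp (seg lin (cdist D a x) (cdist D a y)) x y (cdist D a y - cdist D a x).
Proof.
move=> xD yD le; have := @lin_arc (cdist D a x) (cdist D a y).
by rewrite le cdist_lt // => /(_ isT); rewrite !nth_lin.
Qed.

Lemma mem_seg_lin i j x : (x \in seg lin i j) = (x \in D) && (i <= cdist D a x <= j).
Proof.
by rewrite inE mem_lin; have [xD|//] := boolP (x \in D); rewrite index_lin.
Qed.

Lemma seg_lin_sub i j : seg lin i j \subset [set z in D].
Proof. by apply/subsetP => v; rewrite mem_seg_lin inE => /andP[]. Qed.

Lemma lp_seg_lin_disj i j i' j' v : j < i' -> v \in seg lin i j -> v \in seg lin i' j' -> False.
Proof. by move=> lt; rewrite !mem_seg_lin => /and3P[_ _ h1] /and3P[_ h2 _]; lia. Qed.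

Section Pred.
Variable p : G.
Hypothesis pD : p \in D.
Hypothesis pa : cdist D p a = 1.

Lemma pred_neq : a != p.
Proof. by apply: contra_eq_neq pa => ->; rewrite cdistxx. Qed.

Lemma pred_dist : (cdist D a p).+1 = size D.
Proof. by have := cdistC pD aD; rewrite eq_sym pred_neq pa => /(_ isT) <-. Qed.

Lemma pred_size : 1 < size D.
Proof. by apply: (size_gt1 aD pD); apply: pred_neq. Qed.

Lemma pred_adj : e p a.
Proof.
have := lin_cycle pred_size; have := pred_dist; have := nth_lin pD; have := nth_lin aD.
rewrite cdistxx -size_lin; case: lin => //= b s -> En [Es].
by rewrite rcons_path => /andP[_]; rewrite (last_nth a) -Es En.
Qed.

Lemma pred_lt x : x \in D -> x != p -> cdist D a x < cdist D a p.
Proof.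
move=> xD xp; have := cdist_lt aD xD.
have := index_neq xD pD xp; rewrite -pred_dist ltnS leq_eqVlt => _ /orP[/eqP E|//].
by have := cdist_inj aD xD pD E => /eqP; rewrite (negPf xp).
Qed.

(* From [p] run backwards to a neighbour of [a] lying beyond [x], jump to [a], run forwards to [x]. *)
Lemma pred_lp_degree x : x \in D -> x != p ->
  lp [set z in D] p x #|[set z in D | e a z]|.
Proof.
move=> xD xp; set N := [set z in D | e a z].
have pN : p \in N by rewrite inE pD (adjC pred_adj).
have := @ex_min G (fun z => z \in N /\ cdist D a x < cdist D a z) (cdist D a).
case; first by exists p; split => //; apply: pred_lt.
move=> l [lN xl] mn; move: (lN); rewrite inE => /andP[lD al].
have us := is_cycle_uniq cD.
have lep : cdist D a l <= cdist D a p.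
  by have [->//|lp] := eqVneq l p; apply/ltnW/pred_lt.
have l1 := lin_arc_to lD pD lep; have l2 := lin_arc_to aD xD.
rewrite cdistxx in l2.
have {l1 l2} := lp_join (lp_sym l1) (l2 isT) (adjC al).
move/(_ (fun v h1 h2 => lp_seg_lin_disj xl h2 h1)) => H.
apply: lp_sub (lp_le _ H); first by rewrite subUset !seg_lin_sub.
(* Neighbours of [a] up to [x] lie on the forward part of the path, all others at or beyond [l] on
   the backward part; the distances leave no room for more of them than the path has edges. *)
have sub : N \subset [set z in D | 0 < cdist D a z <= cdist D a x]
              :|: [set z in D | (cdist D a l).-1 < cdist D a z <= cdist D a p].
  apply/subsetP => z zN; move: (zN); rewrite !inE => /andP[zD az].
  rewrite zD /= cdist_gt0 //=; last exact: adj_neq az.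
  have zp : cdist D a z <= cdist D a p.
    by have [->//|lp] := eqVneq z p; apply/ltnW/pred_lt.
  have [//|lt /=] := leqP (cdist D a z) (cdist D a x).
  by rewrite zp andbT; have := mn _ (conj zN lt); nlia.
have := leq_trans (subset_leq_card sub) (leq_card_setU _ _).
have := card_cdist 0 (cdist D a x) aD; have := card_cdist (cdist D a l).-1 (cdist D a p) aD.
set n1 := #|_|; set n2 := #|_|; set n3 := #|N|; nlia.
Qed.

End Pred.
End Linear.

(** * Gaps on a cycle and on a longest cycle off it *)

Section Setup.
Variables (G : sgraph) (C D : seq G).
Implicit Types (A B K : {set G}) (x y z p u v w : G).
Notation e := (@adj G).

Definition off_cycle : {set G} := ~: [set x in C].
Definition off_both : {set G} := off_cycle :\: [set x in D].
Local Notation F := off_cycle.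
Local Notation O := off_both.
Local Notation SD := [set x in D].

Hypothesis HC : longest_in setT C.
Hypothesis HD : longest_in F D.

Lemma inF x : (x \in F) = (x \notin C).
Proof. by rewrite !inE. Qed.

Lemma inO x : (x \in O) = (x \notin C) && (x \notin D).
Proof. by rewrite !inE andbC. Qed.

Lemma D_F x : x \in D -> x \in F.
Proof. by case: HD => _ + _; apply. Qed.

Lemma D_notC x : x \in D -> x \notin C.
Proof. by move=> /D_F; rewrite inF. Qed.

Lemma O_notD x : x \in O -> x \notin D.
Proof. by rewrite inO => /andP[]. Qed.

Lemma O_F : O \subset F.
Proof. by apply: subsetDl. Qed.

Lemma SD_F : SD \subset F.
Proof. by apply/subsetP => x; rewrite inE => /D_F. Qed.

Lemma O_subF A : A \subset O -> A \subset F.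
Proof. by move/subset_trans; apply; apply: O_F. Qed.

Let cD : is_cycle D. Proof. by case: HD. Qed.
Let uD : uniq D. Proof. exact: is_cycle_uniq. Qed.

Lemma Cgap B x y w w' n : w \in C -> w' \in C -> w != w' -> lp B x y n -> B \subset F ->
  e w x -> e w' y -> n + 2 <= cdist C w w'.
Proof.
move=> wC w'C ww' l BF wx w'y; apply: (gap HC wC w'C ww' l _ _ wx w'y).
  exact: subsetT.
by move=> v /(subsetP BF); rewrite inF.
Qed.

Lemma Cgap2 B x y w w' n : w \in C -> w' \in C -> w != w' -> lp B x y n -> B \subset F ->
  e w x -> e w' y -> n + 2 <= cdist C w w' /\ n + 2 <= cdist C w' w.
Proof.
move=> wC w'C ww' l BF wx w'y; split; first exact: Cgap l BF wx w'y.
by apply: Cgap (lp_sym l) BF w'y wx => //; rewrite eq_sym.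
Qed.

Lemma Dgap B x y a b n : a \in D -> b \in D -> a != b -> lp B x y n -> B \subset O ->
  e a x -> e b y -> n + 2 <= cdist D a b.
Proof.
move=> aD bD ab l BO ax bY; apply: (gap HD aD bD ab l _ _ ax bY).
  exact: O_subF.
by move=> v /(subsetP BO); apply: O_notD.
Qed.

Lemma ear a b A z n : a \in D -> b \in D -> a != b -> A \subset O ->
  lp (a |: A) a z n -> e z b -> n.+1 <= cdist D a b.
Proof.
move=> aD bD ab AO; have aA : a \notin A by apply/negP => /(subsetP AO)/O_notD; rewrite aD.
have [->|za] := eqVneq z a.
  case: n => [|n] l zb; first exact: cdist_gt0.
  case: l => -[|q r] [_ /andP[/negP H _] lr _] //= _; case: H.
  by have := mem_last q r; rewrite -[last q r]/(last a (q :: r)) lr.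
move=> l zb; have [q aq lq] := lp_uncons aA za l.
have := Dgap aD bD ab lq AO aq (adjC zb); nlia.
Qed.

(** A surrogate for a path with [rho] edges between [u] and [x] of which only the effect on [C] is
    kept. The path to be used may depend on the outside sets [A] and [A'], namely on whether they
    contain the common neighbour over which a shortcut runs. *)
Definition linkgap u x rho := forall A A' z z' w w',
  A \subset O -> A' \subset O -> [disjoint A & A'] -> lp (u |: A) u z 0 -> lp (x |: A') x z' 0 ->
  w \in C -> w' \in C -> w != w' -> e w z -> e w' z' ->
  rho + 2 <= cdist C w w' /\ rho + 2 <= cdist C w' w.

Lemma linkgap_le u x rho rho' : rho' <= rho -> linkgap u x rho -> linkgap u x rho'.
Proof.
move=> le H A A' z z' w w' h1 h2 h3 h4 h5 h6 h7 h8 h9 h10.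
by have := H A A' z z' w w' h1 h2 h3 h4 h5 h6 h7 h8 h9 h10; nlia.
Qed.

Lemma disjP A B v : [disjoint A & B] -> v \in A -> v \in B -> False.
Proof. by move/pred0P/(_ v) => /=; case: (v \in A) => //= ->. Qed.

Lemma lp_links A A' B u x z z' n m n' :
  lp (u |: A) u z m -> lp B u x n -> lp (x |: A') x z' n' -> 
  [disjoint A & B] -> [disjoint A' & B] -> [disjoint A & A'] ->
  lp (A :|: B :|: A') z z' (m + n + n').
Proof.
move=> l1 l2 l3 dAB dA'B dAA'; have [uB xB] := lp_in l2.
have H : lp (A :|: B) z x (m + n).
  apply: lp_sub (lp_cat (lp_sym l1) l2 _).
    by apply/subsetP => v; rewrite !inE => /orP[/orP[/eqP->|->]|->]; rewrite ?uB ?orbT.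
  by move=> v; rewrite !inE => /orP[/eqP//|vA] vB; case: (disjP dAB vA vB).
apply: lp_sub (lp_cat H l3 _).
  by apply/subsetP => v; rewrite !inE => /orP[->//|/orP[/eqP->|->]]; rewrite ?xB ?orbT.
move=> v; rewrite !inE => /orP[vA|vB] /orP[/eqP//|vA'].
  by case: (disjP dAA' vA vA').
by case: (disjP dA'B vA' vB).
Qed.

Lemma lp_linkgap_gen B u x n A A' z z' w w' : lp B u x n -> B \subset F ->
  [disjoint A & B] -> [disjoint A' & B] ->
  A \subset O -> A' \subset O -> [disjoint A & A'] -> lp (u |: A) u z 0 -> lp (x |: A') x z' 0 ->
  w \in C -> w' \in C -> w != w' -> e w z -> e w' z' ->
  n + 2 <= cdist C w w' /\ n + 2 <= cdist C w' w.
Proof.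
move=> l BF dAB dA'B AO A'O dAA' l1 l2 wC w'C ww' wz w'z'.
have := lp_links l1 l l2 dAB dA'B dAA'; rewrite add0n addn0 => L.
by apply: Cgap2 L _ wz w'z' => //; rewrite !subUset BF !O_subF.
Qed.

Lemma O_disj A : A \subset O -> [disjoint A & SD].
Proof.
move=> AO; apply/pred0P => v /=; apply/negP => /andP[/(subsetP AO)/O_notD].
by rewrite inE => /negP.
Qed.

Lemma lp_linkgap u x n : lp SD u x n -> linkgap u x n.
Proof.
move=> l A A' z z' w w' AO A'O dAA' l1 l2.
by apply: (lp_linkgap_gen l SD_F (O_disj AO) (O_disj A'O) AO A'O dAA' l1 l2).
Qed.

(* Going around [D] through the common neighbour [y] (shortcutting the gap of [K] containing [x])
   or not: one of the two paths is long, provided [a] starts a widest gap of [K]. *)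
Lemma common_neighbor_linkgap K y : {subset K <= D} -> K != set0 -> y \in O ->
  (forall a, a \in K -> e a y) -> 1 < size D ->
  exists2 a, a \in K & forall p x rho, p \in D -> cdist D p a = 1 -> x \in D -> x != p ->
    2 * rho <= size D + 2 * (#|K| - 1) -> linkgap p x rho.
Proof.
(* [fg] is the length of the gap of [K] that starts at its argument; a single element has the whole
   cycle as its gap. *)
move=> KD K0 yO Ky h1; pose fg a := if #|K| == 1 then size D else cdist D a (nextin D K a).
have [a0 a0K] : exists a, a \in K by apply/set0Pn.
have c0 : 0 < #|K| by apply/card_gt0P; exists a0.
have [|a aK amax] := @ex_max G (fun a => a \in K) fg (size D) (ex_intro _ a0 a0K).
  move=> a aK; rewrite /fg; case: eqP => // /eqP K1.
  have K2 : 1 < #|K| by move: K1 c0; case: (#|K|) => [|[|]].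
  have [nK _ _] := nextinP D K2 aK; apply/ltnW/cdist_lt; exact: KD.
have yF : y \in F by apply: (subsetP O_F).
have lpy : lp [set y] y y 0 by apply: lp_refl; rewrite inE.
have y1O : [set y] \subset O by rewrite sub1set.
have Kgap b c : b \in K -> c \in K -> b != c -> 2 <= cdist D b c.
  by move=> bK cK bc; have := Dgap (KD _ bK) (KD _ cK) bc lpy y1O (Ky _ bK) (Ky _ cK).
have K2P b : b \in K -> b != a -> 1 < #|K|.
  by move=> bK ba; apply/card_gt1P; exists b, a.
have fgle b l : b \in K -> l <= size D ->
   (forall c, c \in K -> c != b -> l <= cdist D b c) -> l <= fg b.
  move=> bK lh H; rewrite /fg; case: eqP => // /eqP K1.
  have K2 : 1 < #|K| by move: K1 c0; case: (#|K|) => [|[|]].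
  by have [nK nb _] := nextinP D K2 bK; apply: H.
have fgsum2 b : b \in K -> b != a -> fg b + fg a + 2 * (#|K| - 2) <= size D.
  move=> bK ba; have K2 := K2P _ bK ba.
  have := nextin_sum uD KD K2; rewrite (bigD1 b) //= (bigD1 a) /=; last by rewrite aK eq_sym.
  have -> : fg b = cdist D b (nextin D K b) by rewrite /fg ifN // neq_ltn K2 orbT.
  have -> : fg a = cdist D a (nextin D K a) by rewrite /fg ifN // neq_ltn K2 orbT.
  suff : 2 * (#|K| - 2) <= \sum_(i | (i \in K) && (i != b) && (i != a)) cdist D i (nextin D K i) by nlia.
  apply: (@leq_trans (\sum_(i | (i \in K) && (i != b) && (i != a)) 2)).
    rewrite sum_nat_const mulnC leq_mul2r /=.
    have -> : #|[pred i | (i \in K) && (i != b) && (i != a)]| = #|K :\: [set a; b]|.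
      by apply: eq_card => i; rewrite !inE negb_or; do !case: (_ \in _); do !case: eqP.
    have -> : #|K :\: [set a; b]| = #|K| - 2.
      rewrite cardsD (setIidPr _) ?cards2 1?eq_sym ?ba //.
      by apply/subsetP => v; rewrite !inE => /orP[]/eqP->.
    by [].
  apply: leq_sum => i /andP[/andP[iK _] _].
  have [nK nb _] := nextinP D K2 iK; apply: Kgap => //; by rewrite eq_sym.
have fga : fg a + 2 * (#|K| - 1) <= size D.
  have [K1|K1] := leqP #|K| 1.
    have E : #|K| = 1 by nlia.
    by rewrite /fg E eqxx; nlia.
  have [b bK ba] : exists2 b, b \in K & b != a.
    by have [nK nb _] := nextinP D K1 aK; exists (nextin D K a).
  have := fgsum2 _ bK ba; suff : 2 <= fg b by nlia.
  rewrite /fg ifN; last by rewrite neq_ltn K1 orbT.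
  by have [nK nb _] := nextinP D K1 bK; apply: Kgap => //; rewrite eq_sym.
exists a => // p x rho pD pa xD xp rle.
have aD := KD _ aK; have ap := pred_neq pa; have pE := pred_dist aD pD pa.
have xlt := pred_lt aD pD pa xD xp.
move=> A A' z z' w w' AO A'O dAA' lA lA' wC w'C ww' wz w'z'.
have pA : p \notin A by apply/negP => /(subsetP AO)/O_notD; rewrite pD.
have xA' : x \notin A' by apply/negP => /(subsetP A'O)/O_notD; rewrite xD.
have yp : y != p by apply: contraTneq yO => ->; rewrite inO pD andbF.
have yx : y != x by apply: contraTneq yO => ->; rewrite inO xD andbF.
have ya : y != a by apply: contraTneq yO => ->; rewrite inO aD andbF.
have [p0 sp0 _] := lA; have [p' sp' _] := lA'.
have ya' := adjC (Ky _ aK).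
(* If the first outside path met [y], it would yield an ear between the consecutive vertices [p] and
   [a] of [D], which their distance 1 forbids. *)
have [yP|yP] := boolP (y \in p0).
  case/splitPr: yP sp0 => r1 r2 [pp up lr sA].
  have ly : lp (p |: A) p y 0.
    exists (rcons r1 y) => //; split; last 1 first.
    - by move=> v vr; apply: sA; move: vr; rewrite !inE mem_cat mem_rcons !inE => /orP[->//|/orP[->|->]]; rewrite !orbT.
    - by move: pp; rewrite -cat_rcons cat_path => /andP[].
    - by move: up; rewrite -cat_rcons -cat_cons cat_uniq => /andP[].
    - by rewrite last_rcons.
  have [q pq lq] := lp_uncons pA yp ly.
  have := Dgap pD aD _ lq AO pq (Ky _ aK); rewrite eq_sym ap pa => /(_ isT); nlia.
(* If the second one meets [y], go from [p] backwards around all of [D] to [a] and on to [y]: this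
   already has [size D] edges. *)
have [yP'|yP'] := boolP (y \in p').
  have yA' : y \in A'.
    by case: sp' => _ _ _ /(_ y); rewrite !inE yP' orbT (negPf yx) => /(_ isT).
  have ly : lp A' y z' 0 by apply: (lp_to_new_end xA' yA' lA'); exists p'.
  have yB : y \notin SD by rewrite inE O_notD.
  have l1 : lp SD p a (cdist D p a) by apply: arc_lp => //; rewrite eq_sym.
  have l2 : lp SD a p (cdist D a p) by apply: arc_lp.
  have l3 : lp (p |: A :|: SD) z a (0 + cdist D a p).
    apply: lp_cat (lp_sym lA) (lp_sym l2) _ => v; rewrite !inE => /orP[/eqP//|vA] vD.
    by have := O_notD (subsetP AO _ vA); rewrite vD.
  have l4 := lp_join l3 ly (Ky _ aK).
  have lv v : v \in p |: A :|: SD -> v \in A' -> False.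
    rewrite !inE => /orP[/orP[/eqP->|vA]|vD] vA'; last 1 first.
    - by move/(subsetP A'O): vA' => /O_notD; rewrite vD.
    - by move/(subsetP A'O): vA' => /O_notD; rewrite pD.
    - exact: disjP dAA' vA vA'.
  have := Cgap2 wC w'C ww' (l4 lv) _ wz w'z'.
  rewrite !subUset sub1set (D_F pD) SD_F !O_subF // => /(_ isT).
  move: fga rle pE c0; clear; nlia.
have SDy : SD \subset y |: SD by apply: subsetUr.
have BF : y |: SD \subset F by rewrite subUset sub1set yF SD_F.
have ltD c : c \in D -> cdist D a c < size D by apply: cdist_lt.
have ltA c : c \in K -> c != a -> 0 < cdist D a c.
  by move=> cK ca; apply: cdist_gt0 => //; [exact: KD | rewrite eq_sym].
have l2 : lp (y |: SD) p x (cdist D a p - cdist D a x).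
  have := lin_arc_to cD aD xD pD (ltnW xlt) => /lp_sym; apply: lp_sub.
  by apply: subset_trans SDy; apply: seg_lin_sub.
have lax := lin_arc_to cD aD aD xD; rewrite cdistxx in lax.
have {}lax := lax isT; rewrite subn0 in lax.
have [i [iK ix] imax] : exists2 i, i \in K /\ cdist D a i <= cdist D a x &
    forall c, c \in K /\ cdist D a c <= cdist D a x -> cdist D a c <= cdist D a i.
  apply: (@ex_max _ _ _ (size D)); first by exists a; rewrite cdistxx.
  by move=> c [cK _]; apply/ltnW/ltD/KD.
have iD := KD _ iK.
(* [i] starts the gap of [K] that contains [x], and [L] is the position of its end. The path runs
   back from [p] to [L], jumps over [y] to [a] and goes forward to [x]; when no element of [K]
   follows [x], the edge from [p] to [a] replaces the jump. *)
have [L [Lh xL Li lL]] : exists L, [/\ L <= size D, cdist D a x < L, L - cdist D a i <= fg i &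
    lp (y |: SD) p x (size D + 1 + cdist D a x - L)].
  have cless c : c \in K -> c != i -> cdist D a c <= cdist D a x ->
      size D - cdist D a i <= cdist D i c.
    move=> cK ci cx; have le := imax _ (conj cK cx).
    have h1' := cdist_split aD (KD _ cK) iD le; have := cdistC iD (KD _ cK).
    rewrite eq_sym ci => /(_ isT) h2'; move: h1' h2'; clear; nlia.
  have [[l1 [l1K l1x]]|nol] := classic (exists l, l \in K /\ cdist D a x < cdist D a l); last first.
    exists (size D); split => //.
    - exact: ltD.
    - apply: fgle => //; first by rewrite leq_subr.
      move=> c cK ci; apply: cless => //; rewrite leqNgt; apply/negP => lt.
      by apply: nol; exists c.
    - have lpp : lp [set p] p p 0 by apply: lp_refl; rewrite inE.
      have dj v : v \in [set p] -> v \in seg (lin D a) 0 (cdist D a x) -> False.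
        by rewrite inE => /eqP->; rewrite mem_seg_lin // => /and3P[_ _]; nlia.
      apply: lp_le (lp_sub _ (lp_join lpp lax (pred_adj cD aD pD pa) dj)); first by nlia.
      by rewrite subUset sub1set !inE pD orbT (subset_trans _ SDy) // seg_lin_sub.
  have [l [lK lx] lmin] := @ex_min G (fun l => l \in K /\ cdist D a x < cdist D a l)
     (cdist D a) (ex_intro _ l1 (conj l1K l1x)).
  have lD := KD _ lK.
  have lp_ : cdist D a l <= cdist D a p by have := ltD _ lD; nlia.
  exists (cdist D a l); split => //; first exact/ltnW/ltD.
    apply: fgle => //; first by have := ltD _ lD; nlia.
    move=> c cK ci; have [cx|cx] := leqP (cdist D a c) (cdist D a x).
      by have := cless _ cK ci cx; have := ltD _ lD; nlia.
    have lc := lmin _ (conj cK cx); have ic : cdist D a i <= cdist D a c by nlia.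
    by have := cdist_split aD iD (KD _ cK) ic; nlia.
  have ys t1 t2 : y \in seg (lin D a) t1 t2 -> False.
    by rewrite mem_seg_lin // (negPf (O_notD yO)).
  have dj1 v : v \in seg (lin D a) (cdist D a l) (cdist D a p) -> v \in [set y] -> False.
    by move=> vs; rewrite inE => /eqP E; apply: (ys (cdist D a l) (cdist D a p)); rewrite -E.
  have l3 := lp_join (lp_sym (lin_arc_to cD aD lD pD lp_)) lpy (Ky _ lK) dj1.
  have dj2 v : v \in seg (lin D a) (cdist D a l) (cdist D a p) :|: [set y] ->
      v \in seg (lin D a) 0 (cdist D a x) -> False.
    rewrite in_setU in_set1 => /orP[h h'|/eqP->]; last exact: ys.
    exact: (lp_seg_lin_disj cD aD lx h' h).
  apply: lp_le (lp_sub _ (lp_join l3 lax ya' dj2)); first by have := ltD _ lD; nlia.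
  rewrite !subUset (subset_trans (seg_lin_sub _ _ _ _) SDy) //.
  by rewrite sub1set !inE eqxx (subset_trans (seg_lin_sub _ _ _ _) SDy).
have [B lB] : exists2 B, lp B p x rho & B \subset y |: SD.
  have [le|lt] := leqP rho (cdist D a p - cdist D a x).
    by exists (y |: SD) => //; apply: lp_le l2.
  exists (y |: SD) => //; apply: lp_le lL.
  (* If [x] lies in the widest gap, the two candidate paths have [2 * size D - L] edges together, so
     one of them is long. Otherwise the widest gap is a second one of at least the same length, and
     the path over [y] alone suffices. *)
  have [ia|ia] := eqVneq i a.
    by move: Li; rewrite ia cdistxx; move: fga rle lt pE Lh xL; clear; nlia.
  have := fgsum2 _ iK ia; have := amax _ iK; have := K2P _ iK ia.
  by move: Li rle lt pE Lh xL ix; clear; nlia.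
move=> BS; have dis A1 : A1 \subset O -> y \notin A1 -> [disjoint A1 & B].
  move=> A1O yA1; apply/pred0P => v /=; apply/negP => /andP[vA /(subsetP BS)].
  rewrite !inE => /orP[/eqP E|vD]; first by rewrite -E vA in yA1.
  by have := O_notD (subsetP A1O _ vA); rewrite vD.
pose A2 := A :\ y; pose A2' := A' :\ y.
have A2O : A2 \subset O by apply: subset_trans AO; apply: subD1set.
have A2O' : A2' \subset O by apply: subset_trans A'O; apply: subD1set.
apply: (lp_linkgap_gen lB (subset_trans BS BF) (dis _ A2O _) (dis _ A2O' _) A2O A2O') => //; rewrite ?inE ?eqxx //.
- apply/pred0P => v /=; rewrite !inE; apply/negP => /andP[/andP[_ h] /andP[_ h']].
  exact: disjP dAA' h h'.
- exists p0 => //; apply: (spath_sub (sp0)) => v vp; case: sp0 => _ _ _ /(_ v vp).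
  rewrite !in_setU1 in_setD1 => /orP[->//|->]; rewrite andbT orbC.
  have [E|//] := eqVneq v y; move: vp; rewrite E inE (negPf yP) orbF => /eqP E'.
  by rewrite E' eqxx in yp.
- exists p' => //; apply: (spath_sub (sp')) => v vp; case: sp' => _ _ _ /(_ v vp).
  rewrite !in_setU1 in_setD1 => /orP[->//|->]; rewrite andbT orbC.
  have [E|//] := eqVneq v y; move: vp; rewrite E inE (negPf yP') orbF => /eqP E'.
  by rewrite E' eqxx in yx.
- exact: wz.
- exact: w'z'.
Qed.

End Setup.

(** * Tails *)

Section Tails.
Variables (G : sgraph) (C D : seq G).
Implicit Types (A B : {set G}) (x y z u v w : G) (tl : G -> seq G).
Notation e := (@adj G).
Notation F := (off_cycle C).
Notation O := (off_both C D).
Notation SD := [set x in D].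
Hypothesis HD : longest_in F D.

Definition nb A x : {set G} := [set z in A | e x z].

Lemma ear_lp a b A n : a \in D -> b \in D -> a != b -> A \subset O ->
  lp (a |: (b |: A)) a b n -> n <= cdist D a b.
Proof.
move=> aD bD ab AO [r [pr ur lr sA] le].
case/lastP: r pr ur lr sA le => [|r b']; first by move=> _ _ /= E; rewrite E eqxx in ab.
rewrite rcons_path last_rcons -rcons_cons rcons_uniq size_rcons => /andP[pr zb] /andP[bn ur] E sA le.
subst b'; apply: leq_trans le _; apply: (ear HD aD bD ab AO _ zb); exists r => //; split => // v vr.
have := sA v; rewrite mem_rcons inE vr orbT => /(_ isT).
by rewrite !inE => /or3P[->//|/eqP E|->]; rewrite ?orbT //; rewrite E (negPf bn) in vr.
Qed.

Variables (P : {set G}) (val : G -> nat).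

Definition tails tl :=
  [/\ forall v, v \notin P -> tl v = [::],
      forall v, [/\ path e v (tl v), uniq (tl v) & {subset tl v <= O}]
    & forall u v z, z \in tl u -> z \in tl v -> u = v].

Definition tset tl v : {set G} := [set z in v :: tl v].
Definition upd tl u q : G -> seq G := fun x => if x == u then q else tl x.

Lemma upd_neq tl u v q : v != u -> upd tl u q v = tl v.
Proof. by move=> /negPf vu; rewrite /upd vu. Qed.

Lemma tails_upd tl u q : tails tl -> u \in P -> path e u q -> uniq q -> {subset q <= O} ->
  (forall v z, v != u -> z \in q -> z \notin tl v) -> tails (upd tl u q).
Proof.
move=> [h1 h2 h3] uP pq uq qO dis; split => [v vP|v|v w z]; rewrite /upd.
- by case: eqP => [E|_]; [rewrite E uP in vP | apply: h1].
- by case: eqP => [->|_ //].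
- case: eqP => [->|/eqP vu]; case: eqP => [->//|/eqP wu].
  + by move=> zq zw; have := dis _ _ wu zq; rewrite zw.
  + by move=> zv zq; have := dis _ _ vu zq; rewrite zv.
  + exact: h3.
Qed.

Definition score (f : G -> seq G -> nat) tl := \sum_(v in P) f v (tl v).
Definition tail_count := score (fun _ q => nat_of_bool (0 < size q)).
Definition tail_length := score (fun _ q => size q).
Definition tail_value := score (fun v q => (0 < size q) * val v).

Lemma score_upd f tl u q : u \in P ->
  score f (upd tl u q) + f u (tl u) = score f tl + f u q.
Proof.
move=> uP; rewrite /score (bigD1 u) //= [in RHS](bigD1 u) //= {1}/upd eqxx.
have -> : \sum_(i in P | i != u) f i (upd tl u q i) = \sum_(i in P | i != u) f i (tl i).
  by apply: eq_bigr => i /andP[_ /negPf iu]; rewrite /upd iu.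
lia.
Qed.

(* Lexicographic maximality: number of nontrivial tails, total length, total value of the feet. *)
Definition best_tails tl := tails tl /\ forall tl', tails tl' ->
  [/\ tail_count tl' <= tail_count tl, tail_count tl' = tail_count tl -> tail_length tl' <= tail_length tl
    & tail_count tl' = tail_count tl -> tail_length tl' = tail_length tl -> tail_value tl' <= tail_value tl].

Lemma best_tails_exist : exists tl, best_tails tl.
Proof.
have b1 tl : tail_count tl <= #|P|.
  by rewrite -sum1_card; apply: leq_sum => v _; case: (0 < _).
have [|tl1 t1 m1] := @ex_max (G -> seq G) tails tail_count #|P| _ (fun tl _ => b1 tl).
  exists (fun=> [::]); split => //; by split => // z.
have [tl2 [t2 e2] m2] : exists2 tl, tails tl /\ tail_count tl = tail_count tl1 &
    forall tl', tails tl' /\ tail_count tl' = tail_count tl1 -> tail_length tl' <= tail_length tl.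
  apply: (@ex_max _ _ _ (#|P| * #|G|)); first by exists tl1.
  move=> tl [[_ h _] _]; rewrite /tail_length /score -sum_nat_const; apply: leq_sum => v _.
  by have [_ uq _] := h v; rewrite -(card_uniqP uq) max_card.
have [tl3 [t3 e3 e3'] m3] : exists2 tl, [/\ tails tl, tail_count tl = tail_count tl1 & tail_length tl = tail_length tl2] &
    forall tl', [/\ tails tl', tail_count tl' = tail_count tl1 & tail_length tl' = tail_length tl2] -> tail_value tl' <= tail_value tl.
  apply: (@ex_max _ _ _ (\sum_(v in P) val v)); first by exists tl2.
  by move=> tl _; apply: leq_sum => v _; case: (0 < _); rewrite ?mul1n.
exists tl3; split => // tl' t'; split; first by rewrite e3; apply: m1.
  by rewrite e3 e3' => E; apply: m2.
by rewrite e3 e3' => E E'; apply: m3.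
Qed.

Section Best.
Variable tl : G -> seq G.
Hypothesis bt : best_tails tl.

(** Otherwise [z] could start a tail at [v]: alone if it is on no tail, or with all that follows it
    on a tail of which it is not the first vertex. Either raises the number of nontrivial tails. *)
Lemma best_start v z : v \in P -> tl v = [::] -> z \in O -> e v z ->
  exists2 u, u \in P & exists r, tl u = z :: r.
Proof.
move=> vP tv zO vz; have [tt mx] := bt; have [h1 h2 h3] := tt.
have [[u zu]|no] := classic (exists u, z \in tl u); last first.
  have t' : tails (upd tl v [:: z]).
    apply: tails_upd => //=; first by rewrite vz.
      by move=> x; rewrite inE => /eqP->.
    by move=> w x wv; rewrite inE => /eqP->; apply/negP => zw; apply: no; exists w.
  have [m1 _ _] := mx _ t'; have := score_upd (fun _ q => nat_of_bool (0 < size q)) tl [:: z] vP.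
  by rewrite tv; move: m1; rewrite /tail_count /=; nlia.
have uP : u \in P by apply: contraLR zu => /h1->.
have uv : u != v by apply: contraTneq zu => ->; rewrite tv.
exists u => //; have [pu uu uO] := h2 u.
case/splitPr: {-1}(tl u) / zu (erefl (tl u)) => -[|a r1] r2 E; first by exists r2.
have t1 : tails (upd tl u (a :: r1)).
  apply: tails_upd => //.
  - by move: pu; rewrite E cat_path => /andP[].
  - by move: uu; rewrite E cat_uniq => /and3P[].
  - by move=> x xr; apply: uO; rewrite E mem_cat xr.
  - by move=> w x wu xr; apply/negP => xw; have := h3 w u x xw; rewrite E mem_cat xr => /(_ isT)/eqP; rewrite (negPf wu).
have t' : tails (upd (upd tl u (a :: r1)) v (z :: r2)).
  apply: tails_upd => //=.
  - by move: pu; rewrite E cat_path /= vz => /and3P[].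
  - by move: uu; rewrite E cat_uniq => /and3P[].
  - by move=> x xr; apply: uO; rewrite E mem_cat xr orbT.
  - move=> w x wv xr; rewrite /upd; case: eqP => [_|/eqP wu].
      by move: uu; rewrite E cat_uniq => /and3P[_ /hasPn/(_ x xr)].
    by apply/negP => xw; have := h3 w u x xw; rewrite E mem_cat xr orbT => /(_ isT)/eqP; rewrite (negPf wu).
have [m1 _ _] := mx _ t'; have := score_upd (fun _ q => nat_of_bool (0 < size q)) (upd tl u (a :: r1)) (z :: r2) vP.
have := score_upd (fun _ q => nat_of_bool (0 < size q)) tl (a :: r1) uP.
rewrite upd_neq 1?eq_sym // tv E; move: m1; rewrite /tail_count /=; nlia.
Qed.

(** Handing the whole tail from [u] to [v] keeps the number and the total length, so the value
    decides. *)
Lemma best_swap u v z r : u \in P -> v \in P -> tl v = [::] -> tl u = z :: r -> e v z ->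
  val v <= val u.
Proof.
move=> uP vP tv tu vz; have [tt mx] := bt; have [h1 h2 h3] := tt.
have uv : u != v by apply: contra_eq_neq tu => ->; rewrite tv.
have [pu uu uO] := h2 u; rewrite tu in pu uu uO.
have t1 : tails (upd tl u [::]) by apply: tails_upd.
have t' : tails (upd (upd tl u [::]) v (z :: r)).
  apply: tails_upd => //=; first by rewrite vz; case/andP: pu.
  move=> w x wv xr; rewrite /upd; case: eqP => [//|/eqP wu].
  by apply/negP => xw; have := h3 w u x xw; rewrite tu => /(_ xr)/eqP; rewrite (negPf wu).
have E f : score f (upd (upd tl u [::]) v (z :: r)) + f v [::] + f u (z :: r)
    = score f tl + f u [::] + f v (z :: r).
  have := score_upd f tl [::] uP; have := score_upd f (upd tl u [::]) (z :: r) vP.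
  by rewrite upd_neq 1?eq_sym // tv tu; nlia.
have [m1 m2 m3] := mx _ t'.
have e1 : tail_count (upd (upd tl u [::]) v (z :: r)) = tail_count tl.
  by have := E (fun _ q => nat_of_bool (0 < size q)); rewrite /tail_count /=; nlia.
have e2 : tail_length (upd (upd tl u [::]) v (z :: r)) = tail_length tl.
  by have := E (fun _ q => size q); rewrite /tail_length /=; nlia.
have := E (fun v q => (0 < size q) * val v); have := m3 e1 e2; rewrite /tail_value /=; nlia.
Qed.

(** A neighbour outside [D] and all tails would lengthen the tail; any reordering [q] may be used in
    place of the tail, since it occupies the same vertices. *)
Lemma best_end u q z : u \in P -> perm_eq q (tl u) -> path e u q -> z \in F -> e (last u q) z ->
  z \in D \/ exists v, z \in tl v.
Proof.
move=> uP pe pq zF lz; have [tt mx] := bt; have [h1 h2 h3] := tt.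
have [zD|zD] := boolP (z \in D); first by left.
right; apply: NNPP => no; have [pu uu uO] := h2 u.
have mq x : (x \in q) = (x \in tl u) by apply: perm_mem.
have nz w : z \notin tl w by apply/negP => zw; apply: no; exists w.
have t' : tails (upd tl u (rcons q z)).
  apply: tails_upd => //.
  - by rewrite rcons_path pq.
  - by rewrite rcons_uniq mq nz (perm_uniq pe).
  - move=> x; rewrite mem_rcons inE => /orP[/eqP->|]; last by rewrite mq => /uO.
    by rewrite inO zD andbT; move: zF; rewrite inF.
  - move=> w x wu; rewrite mem_rcons inE => /orP[/eqP->//|]; rewrite mq => xu.
    by apply/negP => xw; have := h3 w u x xw xu => /eqP; rewrite (negPf wu).
have [m1 m2 _] := mx _ t'.
have := score_upd (fun _ q => nat_of_bool (0 < size q)) tl (rcons q z) uP.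
rewrite size_rcons => E1.
have := score_upd (fun _ q => size q) tl (rcons q z) uP; rewrite size_rcons (perm_size pe) => E2.
have E : tail_count (upd tl u (rcons q z)) = tail_count tl by move: E1 m1; rewrite /tail_count /=; nlia.
by move: (m2 E) E2; rewrite /tail_length /=; nlia.
Qed.

End Best.

Section Base.
Variable tl : G -> seq G.
Hypothesis tt : tails tl.

Lemma tset_uniq v : v \in D -> uniq (v :: tl v).
Proof.
move=> vD; have [_ h2 _] := tt; have [_ uv vO] := h2 v; rewrite /= uv andbT.
by apply/negP => /vO /O_notD; rewrite vD.
Qed.

Lemma tset_disj u v z : u \in D -> v \in D -> z \in tset tl u -> z \in tset tl v -> u = v.
Proof.
have [_ h2 h3] := tt; move=> uD vD; rewrite !inE => /orP[/eqP->|zu] /orP[/eqP//|zv].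
- by have [_ _ vO] := h2 v; have := O_notD (vO _ zv); rewrite uD.
- by move=> E; have [_ _ uO] := h2 u; have := O_notD (uO _ zu); rewrite E vD.
- exact: h3 zu zv.
Qed.

Lemma tset_sub v A : [set z in tl v] \subset A -> v \in A -> tset tl v \subset A.
Proof.
by move=> /subsetP sA vA; apply/subsetP => z; rewrite inE in_cons => /orP[/eqP->//|zv]; apply: sA; rewrite inE.
Qed.

Lemma tail_O v : [set z in tl v] \subset O.
Proof. by apply/subsetP => z; rewrite inE; have [_ h2 _] := tt; have [_ _ vO] := h2 v; apply: vO. Qed.

Lemma tset_F v : v \in D -> tset tl v \subset F.
Proof.
move=> vD; apply: tset_sub; first exact: subset_trans (tail_O v) (O_F _ _).
exact: (D_F HD).
Qed.

Lemma lp_tail_to v z : v \in D -> z \in tset tl v ->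
  lp (tset tl v) v z (index z (v :: tl v)).
Proof.
move=> vD; rewrite inE => zv; have [_ h2 _] := tt; have [pv _ _] := h2 v.
have := @lp_seg G v (v :: tl v) 0 (index z (v :: tl v)) pv (tset_uniq vD).
rewrite index_mem => /(_ zv); rewrite nth_index // subn0 [nth _ _ 0]/=.
by apply: lp_sub; apply/subsetP => x; rewrite !inE => /andP[].
Qed.

Lemma lp_tail_end v z : v \in D -> z \in tset tl v ->
  exists2 B : {set G}, lp B z (last v (tl v)) (size (tl v) - index z (v :: tl v)) &
    B \subset tset tl v /\ forall y, y \in B -> index z (v :: tl v) <= index y (v :: tl v).
Proof.
move=> vD; rewrite inE => zv; have [_ h2 _] := tt; have [pv _ _] := h2 v.
have iz : index z (v :: tl v) < (size (tl v)).+1.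
  by move: zv; rewrite -index_mem.
have := @lp_seg G v (v :: tl v) (index z (v :: tl v)) (size (tl v)) pv (tset_uniq vD).
rewrite -ltnS iz ltnSn => /(_ isT); rewrite nth_index // nth_last [last _ (_ :: _)]/=.
move=> l; exists (seg (v :: tl v) (index z (v :: tl v)) (size (tl v))) => //.
split; first by apply/subsetP => x; rewrite !inE => /andP[].
by move=> y; rewrite inE => /and3P[].
Qed.

Lemma lp_tail v : v \in D -> lp (tset tl v) v (last v (tl v)) (size (tl v)).
Proof.
move=> vD; have vt : v \in tset tl v by rewrite inE mem_head.
have [B] := lp_tail_end vD vt; rewrite /= eqxx subn0 => l [sB _].
exact: lp_sub sB l.
Qed.

(* The levels reached by the neighbours of the end of a tail are packed around [D] with at least twice
   their number of vertices: two of them with distinct bases give an ear of [D]. *)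
Lemma tail_dichotomy u : u \in D -> tl u != [::] ->
  (forall z, z \in nb F (last u (tl u)) -> exists2 v, v \in D & z \in tset tl v) ->
  2 * #|nb F (last u (tl u))| <= size D \/ nb F (last u (tl u)) \subset tset tl u.
Proof.
move=> uD tu clo; set x := last u (tl u); set N := nb F x.
have [_ h2 h3] := tt.
have cD : is_cycle D by case: HD.
have xtl : x \in tl u by rewrite /x; case: (tl u) tu => //= a r _; apply: mem_last.
have xu : x \in tset tl u by rewrite inE in_cons xtl orbT.
have xO : x \in O by apply: (subsetP (tail_O u)); rewrite inE.
(* The level counts the vertices of the tail up to [z], base included. Neighbours on one tail have
   distinct levels, so [M v] bounds their number. *)
pose lev v z := (index z (v :: tl v)).+1.
pose M v := \max_(z in N :&: tset tl v) lev v z.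
have Mwit v : 0 < M v -> exists2 z, z \in N :&: tset tl v & M v = lev v z.
  move=> M0; have [z zN] : exists z, z \in N :&: tset tl v.
    apply/set0Pn; apply: contraTneq M0; rewrite /M => ->; by rewrite big_set0.
  by have [z' z'N E] := @eq_bigmax_cond _ (mem (N :&: tset tl v)) (lev v) (ltac:(apply/card_gt0P; by exists z)); exists z'.
have cN v : v \in D -> #|N :&: tset tl v| <= M v.
  move=> vD; rewrite cardE -(size_map (fun z => index z (v :: tl v))) -(size_iota 0 (M v)).
  apply: uniq_leq_size.
    rewrite map_inj_in_uniq ?enum_uniq // => a b; rewrite !mem_enum !inE => /andP[_ av] /andP[_ bv] E.
    by rewrite -[a](nth_index v (av : a \in v :: tl v)) E (nth_index v (bv : b \in v :: tl v)).
  move=> n /mapP[z]; rewrite mem_enum => zN ->; rewrite mem_iota /= add0n.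
  by apply: (@leq_bigmax_cond _ (mem (N :&: tset tl v)) (lev v)).
have [sub|nsub] := boolP (N \subset tset tl u); first by right.
left; case/subsetPn: nsub => y yN yu; have [b bD yb] := clo y yN.
have bu : b != u by apply: contraNneq yu => <-.
pose W := [set v in D | 0 < M v].
have memW v z : v \in D -> z \in N -> z \in tset tl v -> v \in W.
  move=> vD zN zv; rewrite inE vD /=; apply: leq_trans (_ : 0 < lev v z) _ => //.
  have zz : z \in N :&: tset tl v by rewrite in_setI zN.
  exact: (@leq_bigmax_cond _ (mem (N :&: tset tl v)) (lev v) z zz).
have bW : b \in W by apply: memW yN yb.
(* The vertex before the end of the tail is a neighbour of the end, so [u] too has a positive level
   and [W] has two elements. *)
have pre : exists2 z, z \in N & z \in tset tl u.
  have [pu uu uO] := h2 u.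
  have [r Er] : exists r, tl u = rcons r x.
    by rewrite /x; case/lastP: (tl u) tu => // r a _; exists r; rewrite last_rcons.
  have lr : last u r \in tset tl u by rewrite inE Er -rcons_cons mem_rcons inE mem_last orbT.
  exists (last u r) => //; rewrite inE (subsetP (tset_F uD) _ lr) /=.
  by move: pu; rewrite Er rcons_path => /andP[_ /adjC].
have [z0 z0N z0u] := pre.
have uW : u \in W by apply: memW z0N z0u.
have W1 : 1 < #|W| by apply/card_gt1P; exists b, u.
have WD : {subset W <= D} by move=> v; rewrite inE => /andP[].
have gapW v w : v \in W -> w \in W -> v != w -> M v + M w <= cdist D v w.
  rewrite !inE => /andP[vD Mv] /andP[wD Mw] vw.
  have [z zN Ez] := Mwit _ Mv; have [z' z'N Ez'] := Mwit _ Mw.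
  move: zN z'N; rewrite !in_setI => /andP[zN zv] /andP[z'N z'w].
  have xz : e x z by move: zN; rewrite inE => /andP[].
  have xz' : e x z' by move: z'N; rewrite inE => /andP[].
  have AO s t : [set a in tl s] :|: [set a in tl t] \subset O by rewrite subUset !tail_O.
  have dj s t : s \in D -> t \in D -> s != t -> forall a, a \in tset tl s -> a \in tset tl t -> False.
    by move=> sD tD st a as_ at_; have := tset_disj sD tD as_ at_ => /eqP; rewrite (negPf st).
  have szu : forall z, z \in tset tl u -> z \in N -> lev u z <= size (tl u).
    move=> a au aN; have : index a (u :: tl u) < (size (tl u)).+1 by move: au; rewrite inE -index_mem.
    rewrite ltnS leq_eqVlt => /orP[/eqP E|//].
    have : a = x by rewrite -[a](nth_index u (_ : a \in u :: tl u)) ?E ?nth_last //; move: au; rewrite inE.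
    by move: aN; rewrite inE => /andP[_ /adj_neq + E']; rewrite E' eqxx.
  have own t (c : G) : t \in D -> u != t -> c \in N -> c \in tset tl t ->
      (size (tl u) + index c (t :: tl t)).+1 <= cdist D u t /\
      (size (tl u) + index c (t :: tl t)).+1 <= cdist D t u.
    move=> tD ut cN_ ct; have xc : e x c by move: cN_; rewrite inE => /andP[].
    have l := lp_join (lp_tail uD) (lp_sym (lp_tail_to tD ct)) xc (dj _ _ uD tD ut).
    split.
      apply: (ear_lp uD tD ut (AO u t)); apply: lp_sub l.
      by apply/subsetP => a; rewrite !inE => /orP[/orP[->|->]|/orP[->|->]]; rewrite ?orbT.
    rewrite eq_sym in ut; apply: (ear_lp tD uD ut (AO u t)); apply: lp_sub (lp_sym l).
    by apply/subsetP => a; rewrite !inE => /orP[/orP[->|->]|/orP[->|->]]; rewrite ?orbT.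
  (* If one base is [u], the ear uses the whole tail of [u] up to [x]; the neighbours on this tail
     come before [x], which is not its own neighbour. If neither base is [u], the ear passes from
     one tail to the other through [x]. *)
  have [E|vu] := eqVneq v u.
    rewrite E in Ez zv vw *; have := szu _ zv zN; have [] := own w z' wD vw z'N z'w.
    by rewrite Ez Ez' /lev => h _ h'; apply: leq_trans h; rewrite addnS ltnS leq_add2r.
  have [E|wu] := eqVneq w u.
    rewrite E in Ez' z'w vw *; rewrite eq_sym in vw.
    have := szu _ z'w z'N; have [] := own v z vD vw zN zv.
    by rewrite Ez Ez' /lev => _ h h'; apply: leq_trans h; rewrite addSn ltnS addnC leq_add2r.
  have xt t : t \in D -> t != u -> x \in tset tl t -> False.
    by move=> tD tu' xt; apply: (dj _ _ tD uD tu' x xt xu).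
  have lx : lp [set x] x x 0 by apply: lp_refl; rewrite inE.
  have l1 := lp_join (lp_tail_to vD zv) lx (adjC xz).
  have {}l1 := l1 (fun a h1 h2 => xt _ vD vu (ltac:(by move: h2 h1; rewrite inE => /eqP->))).
  have l2 := lp_join l1 (lp_sym (lp_tail_to wD z'w)) xz'.
  have : lp (v |: (w |: ([set a in tl v] :|: [set a in tl w] :|: [set x]))) v w
     ((index z (v :: tl v) + 0).+1 + index z' (w :: tl w)).+1.
    apply: lp_sub (l2 _); last first.
      move=> a; rewrite in_setU in_set1 => /orP[av aw|/eqP->]; last exact: xt.
      exact: dj vD wD vw a av aw.
    by apply/subsetP => a; rewrite !inE => /orP[/orP[/orP[->|->]|->]|/orP[->|->]]; rewrite ?orbT.
  move/ear_lp; rewrite Ez Ez' /lev => /(_ vD wD vw).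
  rewrite subUset AO sub1set xO => /(_ isT); nlia.
have uD' : uniq D by apply: is_cycle_uniq.
have := @weight_bound G D uD' W WD W1 M 1; rewrite mul1n => H.
have {}H : \sum_(w in W) M w * 2 <= size D.
  apply: H => w wW; rewrite mul1n; have [nW nw _] := nextinP D W1 wW.
  by apply: gapW => //; rewrite eq_sym.
apply: leq_trans H; rewrite -big_distrl mulnC leq_mul2r /=.
have : #|N| <= \sum_(v in SD) #|N :&: tset tl v|.
  have sub : N \subset \bigcup_(v in SD) (N :&: tset tl v).
    apply/subsetP => z zN; have [v vD zv] := clo z zN.
    by apply/bigcupP; exists v; rewrite inE ?zN.
  apply: leq_trans (subset_leq_card sub) _.
  apply: (big_ind2 (fun (A : {set G}) n => #|A| <= n)); first by rewrite cards0.
    by move=> A n B m hA hB; apply: leq_trans (leq_card_setU _ _) (leq_add hA hB).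
  by [].
move=> /leq_trans; apply.
rewrite big_mkcond [leqRHS]big_mkcond; apply: leq_sum => v _; rewrite !inE.
by case: ifP => // vD /=; have := cN v vD; case: posnP => [->|].
Qed.

End Base.
End Tails.

(** * Counting attachments between two links *)

Section ChainSums.
Variables (T : Type) (g : T -> T -> nat) (s : T -> nat) (triv : rel T) (h : nat).

Fixpoint gap_sum p (ps : seq T) := if ps is q :: ps' then g p q + gap_sum q ps' else 0.
Fixpoint nontriv p (ps : seq T) := if ps is q :: ps' then ~~ triv p q + nontriv q ps' else 0.
Fixpoint all_gaps (R : T -> T -> Prop) p (ps : seq T) :=
  if ps is q :: ps' then R p q /\ all_gaps R q ps' else True.

Lemma gap_sum_rcons p ps q : gap_sum p (rcons ps q) = gap_sum p ps + g (last p ps) q.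
Proof. by elim: ps p => [|a ps IH] p /=; [rewrite addn0 | rewrite IH addnA]. Qed.

Lemma nontriv_rcons p ps q : nontriv p (rcons ps q) = nontriv p ps + ~~ triv (last p ps) q.
Proof. by elim: ps p => [|a ps IH] p /=; [rewrite addn0 | rewrite IH addnA]. Qed.

Lemma all_gaps_rcons R p ps q : all_gaps R p (rcons ps q) <-> all_gaps R p ps /\ R (last p ps) q.
Proof. by elim: ps p => [|a ps IH] p /=; [tauto | rewrite IH; tauto]. Qed.

(** [s] is the number of bases attached to a point. Two points attached to a single common base are
    only known to be 2 apart; any others can use a long arc of a cycle of order [h]. Gaps are
    doubled to avoid halves. *)
Definition good_gap p q :=
  if triv p q then [/\ 2 <= g p q, s p = 1 & s q = 1]
  else 2 + h + maxn (s p) (s q) <= 2 * g p q /\ s q <= h.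

(** Only none, one, or at least two nontrivial gaps need be told apart: each of the first two
    contributes half of [h + 2], and both together the full [h + 2] wanted between two links. *)
Lemma chain_bound p ps : all_gaps good_gap p ps ->
  [/\ 0 < nontriv p ps \/ 2 * (\sum_(q <- ps) s q) <= 2 * gap_sum p ps,
      0 < nontriv p ps ->
        2 * (\sum_(q <- ps) s q) + 2 + h <= 2 * gap_sum p ps + s (last p ps)
    & 1 < nontriv p ps ->
        2 * (\sum_(q <- ps) s q) + 2 * h + 4 <= 2 * gap_sum p ps + 2 * s (last p ps)].
Proof.
elim/last_ind: ps => [|ps q IH]; first by rewrite big_nil; split => //; right.
rewrite all_gaps_rcons nontriv_rcons gap_sum_rcons last_rcons -cats1 big_cat big_seq1 /=.
move=> [/IH[i0 i1 i2]]; rewrite /good_gap; set l := last p ps.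
have [tv [g2 sl sq]|_ [gg sqh]] := ifPn (triv l q).
  rewrite /= addn0; split; first by case: i0 => [?|?]; [left | right; nlia].
    by move=> /i1; rewrite -/l sl sq; nlia.
  by move=> /i2; rewrite -/l sl sq; nlia.
rewrite /= addn1; split; first by left.
  move=> _; case: (posnP (nontriv p ps)) i0 i1 => [_|n0] i0 i1.
    by case: i0 => // i0; move: gg; nlia.
  by have := i1 isT; rewrite -/l; move: gg; nlia.
rewrite ltnS => n0; have := i1 n0; rewrite -/l; move: gg; nlia.
Qed.

(** The colour must change from [true] to [false] somewhere along the chain, and one such gap
    suffices. *)
Lemma color_bound (col : T -> bool) b p ps :
  all_gaps (fun p q => 2 <= g p q /\ (col p -> ~~ col q -> b <= g p q)) p ps ->
  col p -> ~~ col (last p ps) -> b + 2 * size ps <= gap_sum p ps + 2.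
Proof.
have low q qs : all_gaps (fun p q => 2 <= g p q /\ (col p -> ~~ col q -> b <= g p q)) q qs ->
    2 * size qs <= gap_sum q qs.
  by elim: qs q => //= a qs IH q [[h1 _] /IH]; lia.
elim: ps p => [|q ps IH] p /=; first by move=> _ ->.
move=> [[h1 h2] H] cp cl; have [cq|cq] := boolP (col q).
  by have := IH q H cq cl; lia.
by have := low _ _ H; have := h2 cp cq; lia.
Qed.

(** With at most one nontrivial gap, the chain is free of them either before [q] or after [q]. *)
Lemma nontriv_ends (X : T -> T -> Prop) p ps q :
  (forall a b, triv a b -> X a b) -> (forall a, X a a) ->
  (forall a b c, X a b -> X b c -> X a c) ->
  nontriv p ps <= 1 -> (exists l r, ps = rcons l q ++ r) -> X p q \/ X q (last p ps).
Proof.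
move=> sub Xr Xt n1 [l [r E]].
have H a bs : nontriv a bs = 0 -> X a (last a bs).
  elim: bs a => [|b bs IH] a //= /eqP; rewrite addn_eq0 eqb0 negbK => /andP[/sub ab /eqP/IH].
  exact: Xt.
have cat a b1 b2 : nontriv a (b1 ++ b2) = nontriv a b1 + nontriv (last a b1) b2.
  by elim: b1 a => [|b b1 IH] a //=; rewrite IH addnA.
move: n1; rewrite E cat last_cat last_rcons; case: (posnP (nontriv p (rcons l q))) => [n0 _|n0 n1].
  by left; have := H _ _ n0; rewrite last_rcons.
right; apply: H; move: n0 n1; lia.
Qed.
End ChainSums.

Section Pigeonhole.
Variables (G : sgraph) (D : seq G).
Hypothesis cD : is_cycle D.
Implicit Types (X : {set G}).

(** The vertices closer than [t] to [x'] in both directions fill an interval with fewer than [n]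
    positions. *)
Lemma pigeonhole X (x' : G) n : {subset X <= D} -> x' \in D -> 0 < n <= #|X :\ x'| ->
  exists x t, [/\ x \in X, x != x', lp [set z in D] x x' t & size D + n <= 2 * t + 1].
Proof.
move=> XD x'D /andP[n0 nX]; have uD := is_cycle_uniq cD.
pose t := uphalf (size D + n - 1).
have t1 : size D + n <= 2 * t + 1 by rewrite /t; lia.
have t2 : 2 * t <= size D + n by rewrite /t; lia.
have [[x [xX xx' H]]|no] := classic (exists x, [/\ x \in X, x != x' &
    t <= cdist D x' x \/ t <= cdist D x x']).
  exists x, t; split => //; apply: long_arc => //; [exact: XD | by case: H; [right | left]].
have := card_cdist (size D - t) t.-1 x'D; set A := [set z in D | _].
have sub : X :\ x' \subset A.
  apply/subsetP => x; rewrite !inE => /andP[xx' xX]; rewrite (XD _ xX) /=.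
  have := cdistC (XD _ xX) x'D xx'.
  have : ~ (t <= cdist D x' x) by move=> H; apply: no; exists x; split => //; left.
  have : ~ (t <= cdist D x x') by move=> H; apply: no; exists x; split => //; right.
  move=> /negP; rewrite -ltnNge => a1 /negP; rewrite -ltnNge => a2 a3.
  have := cdist_gt0 x'D (XD _ xX); rewrite eq_sym xx' => /(_ isT); move: a1 a2 a3; clear; nlia.
have := leq_trans nX (subset_leq_card sub); have := ltn0Sn 0.
have [tD|tD] := leqP t (size D); move: t1 t2 n0; clear; nlia.
Qed.

(** Fix a vertex of the smaller set and apply [pigeonhole] to the larger one. Removing that vertex
    may cost one element, and equal singletons are the only case without a distinct pair. *)
Lemma far_pair X X' : {subset X <= D} -> {subset X' <= D} -> X != set0 -> X' != set0 ->
  ~~ ((X == X') && (#|X| == 1)) ->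
  exists a a' t, [/\ a \in X, a' \in X', a != a', lp [set z in D] a a' t
    & size D + maxn #|X| #|X'| <= 2 * t + 2].
Proof.
wlog le : X X' / #|X'| <= #|X|.
  move=> H XD XD' nX nX' nt; have [le|le] := orP (leq_total #|X'| #|X|); first exact: (H X X' le XD XD' nX nX' nt).
  have [|a [a' [t [h1 h2 h3 h4 h5]]]] := H _ _ le XD' XD nX' nX _.
    by apply: contra nt => /andP[/eqP-> ->]; rewrite eqxx.
  by exists a', a, t; split => //; [rewrite eq_sym | apply: lp_sym | rewrite maxnC].
move=> XD XD' nX nX' nt; have [a' a'X'] := set0Pn _ nX'.
have c0 : 0 < #|X| by rewrite card_gt0.
have c0' : 0 < #|X'| by rewrite card_gt0.
have cD1 : 0 < (if #|X| == 1 then 1 else #|X| - 1) <= #|X :\ a'|.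
  have := cardsD1 a' X; case: eqP => [c1|c1]; last by case: (a' \in X) => /=; move: c1 c0; nlia.
  have [b Eb] : exists b, X = [set b] by apply/cards1P; rewrite c1.
  have [b' Eb'] : exists b, X' = [set b] by apply/cards1P; rewrite eqn_leq c0' -c1 le.
  have : a' \notin X.
    move: a'X' nt; rewrite c1 eqxx andbT Eb Eb' !inE => /eqP->; apply: contra => /eqP->.
    by rewrite eqxx.
  by move=> /negPf->; rewrite c1 add0n => <-.
have [x [t [xX xx l le2]]] := pigeonhole XD (XD' _ a'X') cD1.
exists x, a', t; split => //; rewrite (maxn_idPl le); move: le2; case: eqP => [->|_]; nlia.
Qed.
End Pigeonhole.

Section Chain.
Variables (G : sgraph) (C D : seq G).
Implicit Types (A B : {set G}) (x y z p u v w : G).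
Notation e := (@adj G).
Notation F := (off_cycle C).
Notation O := (off_both C D).
Notation SD := [set x in D].
Hypothesis HC : longest_in setT C.
Hypothesis HD : longest_in F D.
Let cD : is_cycle D. Proof. by case: HD. Qed.

Variables (P : {set G}) (tl : G -> seq G).
Hypothesis PD : {subset P <= D}.
Hypothesis tt : tails C D P tl.
Notation ts := (tset tl).
Notation en a := (last a (tl a)).

Variables (W : {set G}) (lu zz : G -> G) (Aw : G -> {set G}).
Hypothesis WC : {subset W <= C}.
Hypothesis links : forall w, w \in W ->
  [/\ lu w \in D, Aw w \subset O,
      forall t, t \in lu w |: Aw w -> lp (lu w |: Aw w) (lu w) t 0,
      zz w \in lu w |: Aw w & e w (zz w)].
Hypothesis links_disj : forall w w', w \in W -> w' \in W -> w != w' ->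
  [disjoint Aw w & Aw w'] /\ lu w != lu w'.

Definition tails_set : {set G} := \bigcup_(a in SD) ts a.

Lemma mem_tails_set z : reflect (exists2 a, a \in D & z \in ts a) (z \in tails_set).
Proof.
by apply: (iffP bigcupP) => -[a aD za]; exists a => //; move: aD; rewrite inE.
Qed.

(** The private part [B] lies outside all tails, so that paths with disjoint private parts can only
    meet on tails. *)
Definition reach (U : {set G}) z a := exists B : {set G},
  [/\ B \subset U, B \subset O, [disjoint B & tails_set],
      lp (B :|: ts a) z a 0 & lp (B :|: ts a) z (en a) 0].

Lemma reach_end a : a \in D -> reach set0 (en a) a.
Proof.
move=> aD; exists set0; rewrite !sub0set; split => //.
- by rewrite disjoints_subset sub0set.
- by rewrite set0U; apply/lp_sym/(lp_le _ (lp_tail tt aD)).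
- by rewrite set0U; apply: lp_refl; have [] := lp_in (lp_tail tt aD).
Qed.

(** Followed from [C] towards [D], a link first meets the tail of some base [a], which need not be
    its own foot; from there the tail of [a] can be used. *)
Lemma link_base w : w \in W -> exists a, [/\ a \in D, reach (Aw w) (zz w) a &
  exists2 t, t \in ts a & t \in lu w |: Aw w].
Proof.
move=> wW; have [uD AO lall zin wz] := links wW; have l := lall _ zin.
have uT : lu w \in tails_set by apply/mem_tails_set; exists (lu w) => //; rewrite inE mem_head.
have [t tT lt] := lp_hit (T := mem tails_set) (lp_sym l) uT.
have [a aD ta] := mem_tails_set _ tT.
have [zi ti] := lp_in lt.
have [B lB [BA dB tB]] : exists2 B : {set G}, lp (t |: B) (zz w) t 0 &
    [/\ B \subset Aw w, [disjoint B & tails_set] & t \in lu w |: Aw w].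
  exists (Aw w :\: tails_set); last first.
    split; first exact: subsetDl.
      by rewrite disjoint_sym disjoints_subset; apply/subsetP => v vT; rewrite !inE vT.
    by move: ti; rewrite in_setD => /andP[].
  apply: lp_sub lt; apply/subsetP => v; rewrite !inE.
  case: eqVneq => //= vt; rewrite andbT => /andP[vT] /orP[/eqP E|->]; last by rewrite vT.
  by rewrite E uT in vT.
exists a; split => //; last by exists t.
have BO := subset_trans BA AO.
have tsB : ts a \subset tails_set by apply/bigcup_sup; rewrite inE.
have dj v : v \in t |: B -> v \in ts a -> v = t.
  rewrite !inE => /orP[/eqP//|vB] va; case: (disjP dB vB); apply: (subsetP tsB).
  by rewrite inE.
have sB : t |: B :|: ts a \subset B :|: ts a.
  by rewrite !subUset sub1set in_setU ta orbT subsetUl subsetUr.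
exists B; split => //.
- have l1 := lp_le (leq0n _) (lp_sym (lp_tail_to tt aD ta)).
  exact: lp_sub sB (lp_cat lB l1 dj).
- have [S lS [sS _]] := lp_tail_end tt aD ta.
  have l1 := lp_sub sS (lp_le (leq0n _) lS).
  exact: lp_sub sB (lp_cat lB l1 dj).
Qed.

Lemma reach_ts_O U z a : a \in D -> reach U z a -> exists B : {set G},
  [/\ B \subset U, B :|: ts a \subset F, forall v, v \in B -> v \notin SD,
     (forall b v, b \in D -> v \in B -> v \notin ts b)
     & lp (B :|: ts a) z a 0 /\ lp (B :|: ts a) z (en a) 0].
Proof.
move=> aD [B [BU BO dB l1 l2]]; exists B; split => //.
- by rewrite subUset (O_subF BO) (tset_F HD tt aD).
- by move=> v vB; rewrite inE; apply: O_notD (subsetP BO _ vB).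
- move=> b v bD vB; apply/negP => vb; apply: (disjP dB vB).
  by apply/mem_tails_set; exists b.
Qed.

Lemma reach_gap U U' z z' p p' a a' n : p \in C -> p' \in C -> p != p' ->
  a \in D -> a' \in D -> a != a' -> e p z -> e p' z' ->
  reach U z a -> reach U' z' a' -> [disjoint U & U'] -> lp SD a a' n ->
  n + 2 <= cdist C p p'.
Proof.
move=> pC p'C pp' aD a'D aa' pz p'z' /(reach_ts_O aD)[B [BU BF BD Bt [l1 _]]].
move=> /(reach_ts_O a'D)[B' [BU' BF' BD' Bt' [l1' _]]] dU l.
have tsD b v : b \in D -> v \in ts b -> v \in SD -> v = b.
  move=> bD vb vD; apply: (tset_disj tt (u := v) (v := b) (z := v)) => //.
    by move: vD; rewrite inE.
  by rewrite inE mem_head.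
have l2 : lp (B :|: ts a :|: SD) z a' (0 + n).
  apply: lp_cat l1 l _ => v; rewrite in_setU => /orP[/BD/negP//|]; exact: tsD.
have l3 : lp (B :|: ts a :|: SD :|: (B' :|: ts a')) z z' (0 + n + 0).
  apply: lp_cat l2 (lp_sym l1') _ => v; rewrite !in_setU => /orP[/orP[vB|va]|vD] /orP[vB'|va'].
  - by case: (disjP dU (subsetP BU _ vB) (subsetP BU' _ vB')).
  - by have := Bt _ _ a'D vB; rewrite va'.
  - by have := Bt' _ _ aD vB'; rewrite va.
  - by have := tset_disj tt aD a'D va va' => /eqP; rewrite (negPf aa').
  - by have := BD' _ vB'; rewrite vD.
  - exact: tsD va' vD.
have l3F : B :|: ts a :|: SD :|: (B' :|: ts a') \subset F.
  by apply/subUsetP; split => //; apply/subUsetP; split => //; apply: (SD_F HD).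
by have := Cgap HC pC p'C pp' l3 l3F pz p'z'; rewrite add0n addn0.
Qed.

Lemma reach_gap2 U U' z z' p p' a : p \in C -> p' \in C -> p != p' -> a \in D ->
  e p z -> e p' z' -> reach U z a -> reach U' z' a -> 2 <= cdist C p p'.
Proof.
move=> pC p'C pp' aD pz p'z' /(reach_ts_O aD)[B [BU BF BD Bt [l1 _]]].
move=> /(reach_ts_O aD)[B' [BU' BF' BD' Bt' [l1' _]]].
have := lp_trans0 (lp_sub BF l1) (lp_sub BF' (lp_sym l1')) => l.
exact: (Cgap HC pC p'C pp' l (subxx _) pz p'z').
Qed.

Section Interval.
Variables (w w' : G) (aw aw' : G) (rho : nat).
Hypothesis wW : w \in W.
Hypothesis w'W : w' \in W.
Hypothesis ww' : w != w'.
Hypothesis awD : aw \in D.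
Hypothesis aw'D : aw' \in D.
Hypothesis raw : reach (Aw w) (zz w) aw.
Hypothesis raw' : reach (Aw w') (zz w') aw'.
Hypothesis hitw : exists2 t, t \in ts aw & t \in lu w |: Aw w.
Hypothesis hitw' : exists2 t, t \in ts aw' & t \in lu w' |: Aw w'.
Hypothesis lg : linkgap C D (lu w) (lu w') rho.
Hypothesis rho_le : rho < size D.

Definition side_path v v' a := exists A : {set G}, [/\ A \subset O, A \subset Aw v :|: ts a,
  [disjoint A & Aw v'] & lp (lu v |: A) (lu v) (en a) 0].

(* The tail of [a], followed from its end, continues along the first of the two links it meets. *)
Lemma side_or a : a \in D -> (exists2 t, t \in ts a & t \in lu w |: Aw w) \/
    (exists2 t, t \in ts a & t \in lu w' |: Aw w') -> side_path w w' a \/ side_path w' w a.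
Proof.
move=> aD hit.
pose U := lu w |: Aw w :|: (lu w' |: Aw w').
have [t0 t0a t0U] : exists2 t, t \in ts a & t \in U.
  by case: hit => -[t ta tU]; exists t; rewrite // in_setU tU ?orbT.
have [t [ta tU] tmax] := @ex_max G (fun t => t \in ts a /\ t \in U) (fun t => index t (a :: tl a))
  (size (a :: tl a)) (ex_intro _ t0 (conj t0a t0U)) (fun x _ => index_size _ _).
have [B lB [sB Bge]] := lp_tail_end tt aD ta.
have BU v : v \in B -> v \in U -> v = t.
  move=> vB vU; have va := subsetP sB _ vB.
  have := tmax _ (conj va vU); have := Bge _ vB; move: va ta; rewrite !inE => va ta le1 le2.
  rewrite -[v](nth_index a (va : v \in a :: tl a)) -[t in RHS](nth_index a (ta : t \in a :: tl a)).
  by congr nth; apply/eqP; rewrite eqn_leq le1 le2.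
have main v v' : v \in W -> v' \in W -> v != v' ->
    U = lu v |: Aw v :|: (lu v' |: Aw v') -> t \in lu v |: Aw v -> side_path v v' a.
  move=> vW v'W vv' EU tv; have [uD AO lall _ _] := links vW.
  have [u'D A'O _ _ _] := links v'W; have [dv nuv] := links_disj vW v'W vv'.
  have inU x : x \in lu v |: Aw v -> x \in U by move=> xv; rewrite EU in_setU xv.
  have inU' x : x \in Aw v' -> x \in U by move=> xv; rewrite EU !in_setU xv !orbT.
  have tO' : t \notin Aw v'.
    apply/negP => tA'; move: tv; rewrite in_setU1 => /orP[/eqP E|tA]; last exact: disjP dv tA tA'.
    by have := O_notD (subsetP A'O _ tA'); rewrite E uD.
  exists ((Aw v :|: B) :\ lu v); split.
  - apply/subsetP => x; rewrite !inE => /andP[xu /orP[/(subsetP AO)|xB]]; first by rewrite !inE.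
    have xa := subsetP sB _ xB; have [xD|xD] := boolP (x \in D); last first.
      by have := subsetP (tset_F HD tt aD) _ xa; rewrite inF => ->.
    have E : x = a by apply: (tset_disj tt xD aD _ xa); rewrite inE mem_head.
    have := Bge _ xB; rewrite E /= eqxx leqn0 => /eqP it0.
    have Et : t = a.
      by move: ta it0; rewrite inE in_cons /=; case: eqVneq => //= ne _.
    have := tv; rewrite Et -E in_setU1 (negPf xu) /= => /(subsetP AO)/O_notD.
    by rewrite xD.
  - apply/subsetP => x; rewrite !inE => /andP[_ /orP[->//|/(subsetP sB)]].
    by rewrite !inE => ->; rewrite orbT.
  - rewrite disjoint_sym disjoints_subset; apply/subsetP => x xA'; rewrite !inE.
    rewrite negb_and negb_or; apply/orP; right; apply/andP; split.
      by apply/negP => xA; apply: (disjP dv xA xA').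
    by apply/negP => xB; have E := BU _ xB (inU' _ xA'); rewrite -E xA' in tO'.
  - apply: lp_sub (lp_cat (lall _ tv) (lp_le (leq0n _) lB) _).
      by apply/subsetP => x; rewrite !inE; case: eqVneq.
    by move=> x /inU xU xB; apply: BU.
move: tU; rewrite in_setU => /orP[tU|tU]; first by left; apply: main.
by right; apply: main; rewrite 1?eq_sym // setUC.
Qed.

(** The links at [w] and [w'] count as attached to the one base that they reach, every other point
    to the bases of the adjacent tail ends. *)
Definition pset p := if p == w then [set aw] else if p == w' then [set aw']
  else [set a in P | e p (en a)].
Definition priv p := if p == w then Aw w else if p == w' then Aw w' else set0.

Lemma psetw : pset w = [set aw]. Proof. by rewrite /pset eqxx. Qed.
Lemma psetw' : pset w' = [set aw']. Proof. by rewrite /pset eqxx eq_sym (negPf ww'). Qed.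

Lemma psetD p : {subset pset p <= D}.
Proof.
move=> a; rewrite /pset; case: ifP => _; first by rewrite inE => /eqP->.
case: ifP => _; first by rewrite inE => /eqP->.
by rewrite inE => /andP[/PD].
Qed.

Lemma pset_reach p a : a \in pset p -> exists2 z, e p z & reach (priv p) z a.
Proof.
rewrite /pset /priv; case: eqP => [->|_].
  by rewrite inE => /eqP->; exists (zz w) => //; have [] := links wW.
case: eqP => [->|_].
  by rewrite inE => /eqP->; exists (zz w') => //; have [] := links w'W.
by rewrite inE => /andP[aP pe]; exists (en a) => //; apply: reach_end; apply: PD.
Qed.

Lemma priv_disj p q : p != q -> [disjoint priv p & priv q].
Proof.
have d0 A : [disjoint A & set0] by rewrite disjoint_sym disjoints_subset sub0set.
have d0' A : [disjoint set0 & A] by rewrite disjoints_subset sub0set.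
have [dA _] := links_disj wW w'W ww'.
move=> pq; rewrite /priv.
case: (boolP (p == w)) => [/eqP pw|_]; case: (boolP (q == w)) => [/eqP qw|_] //.
- by rewrite pw qw eqxx in pq.
- by case: ifP.
- by case: ifP => // _; rewrite disjoint_sym.
case: (boolP (p == w')) => [/eqP pw|_]; case: (boolP (q == w')) => [/eqP qw|_] //.
by rewrite pw qw eqxx in pq.
Qed.

Definition ptriv p q := (pset p == pset q) && (#|pset p| == 1).

Lemma points_gap p q : p \in C -> q \in C -> p != q -> pset p != set0 -> pset q != set0 ->
  good_gap (cdist C) (fun p => #|pset p|) ptriv (size D) p q.
Proof.
move=> pC qC pq X0 X0'; rewrite /good_gap /ptriv.
case: ifP => [/andP[/eqP E /eqP c1]|nt].
  split => //; last by rewrite -E.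
  have [a aX] := set0Pn _ X0; have aX' : a \in pset q by rewrite -E.
  have [z pz rz] := pset_reach aX; have [z' qz' rz'] := pset_reach aX'.
  exact: reach_gap2 pC qC pq (psetD aX) pz qz' rz rz'.
have [a [a' [t [aX a'X' aa' l ht]]]] := far_pair cD (@psetD p) (@psetD q) X0 X0' (negbT nt).
have [z pz rz] := pset_reach aX; have [z' qz' rz'] := pset_reach a'X'.
have := reach_gap pC qC pq (psetD aX) (psetD a'X') aa' pz qz' rz rz' (priv_disj pq) l.
move=> hg; split; first by move: hg ht; clear; nlia.
rewrite -(card_uniqP (is_cycle_uniq cD)); apply: subset_leq_card.
by apply/subsetP => b /psetD.
Qed.

(** The colour tells along which link the paths from a point are continued, [true] standing for that
    of [w]. Away from [w] and [w'] it depends on [pset] alone, so points of opposite colour use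
    different tails and their paths are disjoint. *)
Lemma colour_exists : exists col : G -> bool,
  forall p, pset p = [set aw] \/ pset p = [set aw'] ->
   (p = w -> col p) /\ (p = w' -> ~~ col p) /\
   (col p -> exists A z, [/\ e p z, A \subset O, A \subset Aw w :|: \bigcup_(a in pset p | p != w) ts a,
        [disjoint A & Aw w'] & lp (lu w |: A) (lu w) z 0]) /\
   (~~ col p -> exists A z, [/\ e p z, A \subset O, A \subset Aw w' :|: \bigcup_(a in pset p | p != w') ts a,
        [disjoint A & Aw w] & lp (lu w' |: A) (lu w') z 0]) /\
   (forall q, p != w -> q != w -> p != w' -> q != w' -> pset p = pset q -> col p = col q).
Proof.
have [b1 Hb1] : exists b : bool, if b then side_path w w' aw else side_path w' w aw.
  by have [|h|h] := @side_or aw awD; [left; case: hitw => t; exists t | exists true | exists false].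
have [b2 Hb2] : exists b : bool, if b then side_path w w' aw' else side_path w' w aw'.
  by have [|h|h] := @side_or aw' aw'D; [right; case: hitw' => t; exists t | exists true | exists false].
have [dA _] := links_disj wW w'W ww'.
exists (fun p => if p == w then true else if p == w' then false else if pset p == [set aw] then b1 else b2).
move=> p Hp; split; first by move=> ->; rewrite eqxx.
split; first by move=> ->; rewrite eqxx eq_sym (negPf ww').
have sub v a : a \in pset p -> p != v -> ts a \subset \bigcup_(a in pset p | p != v) ts a.
  by move=> aX pv; apply: bigcup_sup; rewrite aX pv.
have sideP v v' a : a \in pset p -> p != v -> pset p = [set a in P | e p (en a)] -> side_path v v' a ->
   exists A z, [/\ e p z, A \subset O, A \subset Aw v :|: \bigcup_(a in pset p | p != v) ts a,
        [disjoint A & Aw v'] & lp (lu v |: A) (lu v) z 0].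
  move=> aX pv E [A [AO sA dA' l]]; exists A, (en a); split => //.
    by move: aX; rewrite E inE => /andP[].
  by apply: subset_trans sA _; rewrite setUS // sub.
have linkP v v' : v \in W -> [disjoint Aw v & Aw v'] -> exists A z, [/\ e v z, A \subset O,
     A \subset Aw v :|: \bigcup_(a in pset v | v != v) ts a,
        [disjoint A & Aw v'] & lp (lu v |: A) (lu v) z 0].
  move=> vW dv; have [_ AO lall zin vz] := links vW; exists (Aw v), (zz v); split => //.
    exact: subsetUl.
  exact: lall.
have nor : p != w -> p != w' -> pset p = [set a in P | e p (en a)].
  by rewrite /pset => /negPf-> /negPf->.
have [Ep|pw] : p = w \/ p != w by case: eqVneq; [left | right].
  rewrite Ep; split; first by move=> _; exact: (linkP w w' wW dA).
  by split=> [|q]; rewrite ?eqxx.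
have [Ep|pw'] : p = w' \/ p != w' by case: eqVneq; [left | right].
  have nw : (w' == w) = false by rewrite eq_sym (negPf ww').
  rewrite Ep nw eqxx; split=> //; split=> // _.
  have dA' : [disjoint Aw w' & Aw w] by rewrite disjoint_sym.
  by have := linkP w' w w'W dA'; rewrite eqxx.
have Ecol : (if p == w then true else if p == w' then false else if pset p == [set aw] then b1 else b2)
   = if pset p == [set aw] then b1 else b2 by rewrite (negPf pw) (negPf pw').
have Ecase : pset p = [set aw] \/ pset p != [set aw] by case: eqVneq; [left | right].
rewrite Ecol; split; last split.
- move=> hb; case: Ecase => E.
    have {}hb : b1 by move: hb; rewrite E eqxx.
    by apply: (sideP w w' aw) => //; [rewrite E inE | exact: nor | move: Hb1; rewrite hb].
  case: Hp => Hp; first by rewrite Hp eqxx in E.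
  have {}hb : b2 by move: hb; rewrite (negPf E).
  by apply: (sideP w w' aw') => //; [rewrite Hp inE | exact: nor | move: Hb2; rewrite hb].
- move=> hb; case: Ecase => E.
    have {}hb : b1 = false by move: hb; rewrite E eqxx => /negPf.
    by apply: (sideP w' w aw) => //; [rewrite E inE | exact: nor | move: Hb1; rewrite hb].
  case: Hp => Hp; first by rewrite Hp eqxx in E.
  have {}hb : b2 = false by move: hb; rewrite (negPf E) => /negPf.
  by apply: (sideP w' w aw') => //; [rewrite Hp inE | exact: nor | move: Hb2; rewrite hb].
- by move=> q _ /negPf-> _ /negPf-> Eq; rewrite Eq.
Qed.

(** Two nontrivial gaps give [h + 2] in addition to the attachments. With at most one, each point is
    attached to [aw] alone or to [aw'] alone, and where the colour changes, [linkgap] applies to the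
    two outside paths and gives a gap [rho + 2]. *)
Lemma interval_bound zs : {subset zs <= C} ->
  path (fun p q => cdist C w p < cdist C w q) w (rcons zs w') ->
  {in zs, forall y, [set a in P | e y (en a)] != set0} ->
  2 + rho + \sum_(y <- zs) #|[set a in P | e y (en a)]| <= cdist C w w'.
Proof.
move=> zC srt nz.
have wC := WC wW; have w'C := WC w'W.
pose pts := w :: rcons zs w'.
have ptC p : p \in pts -> p \in C.
  by rewrite inE mem_rcons inE => /or3P[/eqP->|/eqP->|/zC].
have trans : transitive (fun p q => cdist C w p < cdist C w q) by move=> a b c; apply: ltn_trans.
have upts : uniq pts.
  by apply: (sorted_uniq trans) => // a; rewrite /= ltnn.
have zsw y : y \in zs -> y != w /\ y != w'.
  move=> yz; move: upts; rewrite /pts cons_uniq rcons_uniq mem_rcons inE negb_or -andbA.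
  move=> /and4P[_ wz w'z _]; split.
    by apply: contraNneq wz => <-.
  by apply: contraNneq w'z => <-.
have pset_zs y : y \in zs -> pset y = [set a in P | e y (en a)].
  by move=> /zsw[/negPf h1 /negPf h2]; rewrite /pset h1 h2.
have nzp p : p \in pts -> pset p != set0.
  rewrite inE mem_rcons inE => /or3P[/eqP->|/eqP->|yz].
  - by rewrite psetw; apply/set0Pn; exists aw; rewrite inE.
  - by rewrite psetw'; apply/set0Pn; exists aw'; rewrite inE.
  - by rewrite pset_zs //; apply: nz.
have gsum p ps : path (fun p q => cdist C w p < cdist C w q) p ps -> {subset p :: ps <= C} ->
    cdist C w p + gap_sum (cdist C) p ps = cdist C w (last p ps).
  elim: ps p => [|q ps IH] p /=; first by rewrite addn0.
  move=> /andP[pq /IH H] sC; rewrite addnA cdist_split ?H //; last exact: ltnW.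
  - by move=> x xs; apply: sC; rewrite inE xs orbT.
  - by apply: sC; rewrite mem_head.
  - by apply: sC; rewrite !inE eqxx orbT.
have all_path (R : G -> G -> Prop) p ps : path (fun p q => cdist C w p < cdist C w q) p ps ->
    (forall a b, a \in p :: ps -> b \in p :: ps -> cdist C w a < cdist C w b -> R a b) ->
    all_gaps R p ps.
  elim: ps p => [|q ps IH] p //= /andP[pq pp] H; split.
    by apply: H; rewrite ?inE ?eqxx ?orbT.
  by apply: IH => // a b ai bi; apply: H; rewrite inE ?ai ?bi orbT.
have Etot := gsum w (rcons zs w') srt ptC; rewrite cdistxx add0n last_rcons in Etot.
have Esum : \sum_(y <- zs) #|[set a in P | e y (en a)]| = \sum_(y <- zs) #|pset y|.
  by apply: eq_big_seq => y yz; rewrite pset_zs.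
have ltne a b : cdist C w a < cdist C w b -> a != b.
  by apply: contraTneq => ->; rewrite ltnn.
have gg : all_gaps (good_gap (cdist C) (fun p => #|pset p|) ptriv (size D)) w (rcons zs w').
  apply: all_path => // a b ai bi /ltne ab; apply: points_gap => //; [exact: ptC|exact: ptC|exact: nzp|exact: nzp].
rewrite Esum; have [_ _ H2] := chain_bound gg.
have [n1|n2] := leqP (nontriv ptriv w (rcons zs w')) 1; last first.
  move: (H2 n2) rho_le; rewrite last_rcons psetw' cards1 -cats1 big_cat big_seq1 /= psetw' cards1 cats1 Etot.
  clear; nlia.
have two y : y \in zs -> pset y = [set aw] \/ pset y = [set aw'].
  move=> yz; have := @nontriv_ends G ptriv (fun a b => pset a = pset b) w (rcons zs w') y.
  rewrite last_rcons psetw psetw'; case => //.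
  - by move=> a b /andP[/eqP].
  - by move=> a b c -> ->.
  - have [i j] := splitPr yz; exists i, (rcons j w'); by rewrite rcons_cat cat_rcons.
  - by move=> ->; left.
  - by move=> ->; right.
have two' p : p \in pts -> pset p = [set aw] \/ pset p = [set aw'].
  rewrite inE mem_rcons inE => /or3P[/eqP->|/eqP->|/two//]; rewrite ?psetw ?psetw'; [by left | by right].
have [col Hcol] := colour_exists.
have cw : col w by have [+ _] := Hcol w (or_introl psetw); apply.
have cw' : ~~ col w' by have [_ [+ _]] := Hcol w' (or_intror psetw'); apply.
have s1 p : p \in pts -> #|pset p| = 1 by move=> /two'[]->; rewrite cards1.
have := @color_bound G (cdist C) col (rho + 2) w (rcons zs w').
rewrite last_rcons Etot size_rcons => /(_ _ cw cw') H.
have -> : \sum_(y <- zs) #|pset y| = size zs.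
  rewrite -sum1_size; apply: eq_big_seq => y yz; apply: s1.
  by rewrite inE mem_rcons inE yz !orbT.
suff Hall : all_gaps (fun p q => 2 <= cdist C p q /\ (col p -> ~~ col q -> rho + 2 <= cdist C p q)) w (rcons zs w').
  have ar n d : rho + 2 + 2 * n.+1 <= d + 2 -> 2 + rho + n <= d by clear; nlia.
  exact: ar (H Hall).
apply: all_path => // p q pi qi pq; have npq := ltne _ _ pq.
split.
  have := points_gap (ptC _ pi) (ptC _ qi) npq (nzp _ pi) (nzp _ qi); rewrite /good_gap.
  rewrite (s1 _ pi) (s1 _ qi); case: ifP => [_ []//|_ []]; move: rho_le; clear; nlia.
move=> cp cq; have [_ [_ [Hp [_ Hsame]]]] := Hcol p (two' _ pi).
have [_ [_ [_ [Hq _]]]] := Hcol q (two' _ qi).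
have [A [z [pz AO sA dA l]]] := Hp cp; have [A' [z' [qz' A'O sA' dA' l']]] := Hq cq.
have dAA' : [disjoint A & A'].
  apply/pred0P => v /=; apply/negP => /andP[vA vA'].
  have := subsetP sA _ vA; rewrite in_setU => /orP[h|/bigcupP[a /andP[aX pw] va]].
    exact: disjP dA' vA' h.
  have := subsetP sA' _ vA'; rewrite in_setU => /orP[h|/bigcupP[a' /andP[a'X qw'] va']].
    exact: disjP dA vA h.
  have E := tset_disj tt (psetD aX) (psetD a'X) va va'.
  have Epq : pset p = pset q.
    by have := two' _ pi; have := two' _ qi => -[] Eq [] Ep; move: aX a'X; rewrite Ep Eq !inE -E => /eqP-> // /eqP->.
  have pw' : p != w' by apply: contraTneq cp => ->.
  have qw : q != w by apply: contraNneq cq => ->.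
  by have := Hsame q pw qw pw' qw' Epq; rewrite cp => E'; rewrite -E' in cq.
by have [] := lg AO A'O dAA' l l' (ptC _ pi) (ptC _ qi) npq pz qz'.
Qed.

End Interval.
End Chain.

(** * Disjoint links from Menger's theorem *)

Section InnerLinkage.
Variable G : sgraph.
Notation e := (@adj G).

(** Menger's theorem is applied to the relation without arcs that leave [B] or enter [A]: its paths
    meet [A] only at their start and [B] only at their end. *)
Lemma inner_linkage (U A B : {set G}) n :
  (forall X : {set G}, #|X| < n -> exists a b, [/\ a \in A, b \in B & lp (U :\: X) a b 0]) ->
  exists (S : {set G}) (f : G -> seq G), [/\ S \subset A /\ #|S| = n,
    forall a, a \in S -> [/\ path e a (f a), uniq (a :: f a), last a (f a) \in B & {subset a :: f a <= U}],
    forall a, a \in S -> {in f a, forall v, v \notin A} /\ {in belast a (f a), forall v, v \notin B}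
  & forall a a' v, a \in S -> a' \in S -> v \in a :: f a -> v \in a' :: f a' -> a = a'].
Proof.
move=> conn.
pose r : rel G := fun x y => [&& e x y, x \notin B, y \notin A & y \in U].
have irr : irreflexive r by move=> x; rewrite /r adj_irrefl.
have rP a q : a \in U -> path r a q -> [/\ path e a q, {subset a :: q <= U},
    {in q, forall v, v \notin A} & {in belast a q, forall v, v \notin B}].
  elim: q a => [|b q IH] a aU /=; first by split => // v; rewrite inE => /eqP->.
  move=> /andP[/and4P[ab aB bA bU] /(IH _ bU)[h1 h2 h3 h4]]; rewrite ab; split => // v.
  - by rewrite inE => /orP[/eqP->|/h2].
  - by rewrite inE => /orP[/eqP->|/h3].
  - by rewrite inE => /orP[/eqP->|/h4].
have [X sX|S [f [[SA Sf dis] cS]]] := @menger G r (A :&: U) B n irr.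
  rewrite leqNgt; apply/negP => lt; have [a [b [aA bB [p [pp up lpb sp] _]]]] := conn X lt.
  have [|p1 [p2 [Ep lp1 H1]]] := @first_in G B e a p pp; first by rewrite lpb.
  have [|q1 [q2 [Eq lq1 H2]]] := @last_in G A a p1; first by exists a; rewrite ?mem_head.
  have inp v : v \in last a q1 :: q2 -> v \in U /\ v \notin X.
    move=> vq; suff : v \in a :: p by move/sp; rewrite inE => /andP[].
    rewrite Ep Eq -!cat_cons !mem_cat; move: vq; rewrite in_cons => /orP[/eqP->|->]; rewrite ?orbT //.
    by rewrite mem_last.
  have [|||v vq vX] := sX (last a q1) q2; last 1 first.
  - by have [] := inp v vq; rewrite vX.
  - by rewrite inE lq1; have [] := inp _ (mem_head _ _).
  - have : path e (last a q1) q2 by move: pp; rewrite Ep Eq !cat_path => /andP[/andP[_ ->]].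
    have H1' : {in belast (last a q1) q2, forall v, v \notin B}.
      by move=> v vb; apply: H1; rewrite Eq belast_cat mem_cat vb orbT.
    have H3 v : v \in q2 -> v \in U by move=> vq; have [] := inp v; rewrite // inE vq orbT.
    suff gen d : path e d q2 -> {in belast d q2, forall v, v \notin B} -> path r d q2 by move=> /gen; apply.
    elim: q2 d {Eq inp H1'} H2 H3 => //= b' q2 IH d H2 H3 /andP[db pq] H1'.
    rewrite IH //; first last.
    + by move=> v vb; apply: H1'; rewrite inE vb orbT.
    + by move=> v vb; apply: H3; rewrite inE vb orbT.
    + by move=> v vb; apply: H2; rewrite inE vb orbT.
    by rewrite andbT /r db H1' ?mem_head // H2 ?mem_head // H3 ?mem_head.
  - by move: lp1; rewrite Eq last_cat.
have SU a : a \in S -> a \in U by move=> /(subsetP SA); rewrite inE => /andP[].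
exists S, f; split => //.
- by split => //; apply: subset_trans SA (subsetIl _ _).
- by move=> a aS; have [pa ua la] := Sf a aS; have [h1 h2 _ _] := rP _ _ (SU _ aS) pa.
- by move=> a aS; have [pa ua la] := Sf a aS; have [_ _ h3 h4] := rP _ _ (SU _ aS) pa.
Qed.

End InnerLinkage.

Section Links.
Variables (G : sgraph) (C D : seq G).
Implicit Types (A X : {set G}) (x y u v w : G).
Notation e := (@adj G).
Notation F := (off_cycle C).
Notation O := (off_both C D).
Notation SD := [set x in D].
Notation SC := [set x in C].
Hypothesis HC : longest_in setT C.
Hypothesis HD : longest_in F D.
Let cC : is_cycle C. Proof. by case: HC. Qed.
Let cD : is_cycle D. Proof. by case: HD. Qed.
Let uC : uniq C. Proof. exact: is_cycle_uniq. Qed.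
Let uD : uniq D. Proof. exact: is_cycle_uniq. Qed.

Lemma card_seq_set (s : seq G) : uniq s -> #|[set x in s]| = size s.
Proof. by move=> us; rewrite cardsE; apply/card_uniqP. Qed.

Lemma size_D_C : size D <= size C.
Proof. by case: HC => _ _; apply => //; move=> x; rewrite inE. Qed.

Definition connected_avoiding k := forall X x y, #|X| < k -> x \notin X -> y \notin X ->
  lp (~: X) x y 0.

Lemma not_covered A X : #|X| < #|A| -> exists2 x, x \in A & x \notin X.
Proof.
move=> lt; have : ~~ (A \subset X) by apply: contraTN lt => /subset_leq_card; rewrite leqNgt.
by case/subsetPn => x; exists x.
Qed.

(** For the link ending in [w], [lu w] is the foot on [D], [Aw w] the set of inner vertices, and
    [zz w] the last vertex before [C], which is the foot if the link is an edge. *)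
Lemma menger_links k : connected_avoiding k -> k <= size D ->
  exists (W : {set G}) (lu zz : G -> G) (Aw : G -> {set G}),
  [/\ {subset W <= C}, #|W| = k,
      forall w, w \in W ->
        [/\ lu w \in D, Aw w \subset O,
            forall t, t \in lu w |: Aw w -> lp (lu w |: Aw w) (lu w) t 0,
            zz w \in lu w |: Aw w & e w (zz w)]
    & forall w w', w \in W -> w' \in W -> w != w' -> [disjoint Aw w & Aw w'] /\ lu w != lu w'].
Proof.
move=> conn kD; have kC := leq_trans kD size_D_C.
have [X lt|S [f [[SD' cS] Sf fO dis]]] := @inner_linkage G setT SD SC k.
  have [a aD aX] : exists2 a, a \in SD & a \notin X by apply: not_covered; rewrite card_seq_set // (leq_trans lt).
  have [c cC' cX] : exists2 c, c \in SC & c \notin X by apply: not_covered; rewrite card_seq_set // (leq_trans lt).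
  by exists a, c; split => //; rewrite setTD; apply: conn.
have inD a : a \in S -> a \in D by move=> /(subsetP SD'); rewrite inE.
pose wE a := last a (f a).
have wEC a : a \in S -> wE a \in C by move=> /Sf[_ _ + _]; rewrite inE.
have inj : {in S &, injective wE}.
  move=> a b aS bS E; apply: (dis a b (wE a)) => //; first exact: mem_last.
  by rewrite E mem_last.
have fE a : a \in S -> exists q, f a = rcons q (wE a).
  move=> aS; have := wEC _ aS; rewrite /wE; case/lastP: (f a) => [|q b] //=.
    by move=> aC; have := D_notC HD (inD _ aS); rewrite aC.
  by move=> _; exists q; rewrite last_rcons.
pose lu w := odflt w [pick a in S | wE a == w].
have luE a : a \in S -> lu (wE a) = a.
  move=> aS; rewrite /lu; case: pickP => [b /andP[bS /eqP E]|/(_ a)]; first exact: inj.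
  by rewrite aS eqxx.
pose q w := behead (belast (lu w) (f (lu w))).
exists (wE @: S), lu, (fun w => last (lu w) (belast (lu w) (f (lu w)))), (fun w => [set v in q w]).
have qE a : a \in S -> f a = rcons (q (wE a)) (wE a).
  move=> aS; rewrite /q luE //; have [q0 E] := fE _ aS.
  by rewrite {2}E belast_rcons /= E.
have sub a v : a \in S -> v \in q (wE a) -> v \in a :: f a.
  by move=> aS vq; rewrite qE // inE mem_rcons inE vq !orbT.
split.
- by move=> w /imsetP[a aS ->]; apply: wEC.
- by rewrite card_in_imset.
- move=> w /imsetP[a aS ->]; rewrite luE //; have [pa ua la _] := Sf a aS.
  have aD := inD _ aS; have [h2 h1] := fO a aS.
  have Eb : belast a (f a) = a :: q (wE a) by rewrite {1}qE // belast_rcons.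
  have qO v : v \in q (wE a) -> v \in O.
    move=> vq; have vb : v \in belast a (f a) by rewrite Eb inE vq orbT.
    have vf : v \in f a by rewrite qE // mem_rcons inE vq orbT.
    by have := h1 v vb; have := h2 v vf; rewrite !inE => -> ->.
  have pq : path e a (q (wE a)) /\ e (last a (q (wE a))) (wE a).
    by have := pa; rewrite qE // rcons_path => /andP[].
  have uq : uniq (a :: q (wE a)).
    by move: ua; rewrite qE // -rcons_cons rcons_uniq => /andP[].
  rewrite Eb /=; split => //.
  + by apply/subsetP => v; rewrite inE => /qO.
  + move=> t; rewrite inE => tin.
    have tq : t \in a :: q (wE a) by move: tin; rewrite !inE.
    have := @lp_seg G a (a :: q (wE a)) 0 (index t (a :: q (wE a))) (proj1 pq) uq.
    rewrite index_mem => /(_ tq); rewrite nth_index //= => /(lp_le (leq0n _)); apply: lp_sub.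
    by apply/subsetP => x; rewrite !inE => /andP[].
  + by have := mem_last a (q (wE a)); rewrite !inE.
  + by apply: adjC; case: pq.
- move=> w w' /imsetP[a aS ->] /imsetP[b bS ->] ab; rewrite !luE //; split; last first.
    by apply: contraNneq ab => ->.
  apply/pred0P => v /=; rewrite !inE; apply/negP => /andP[va vb].
  by have E := dis a b v aS bS (sub _ _ aS va) (sub _ _ bS vb); rewrite E eqxx in ab.
Qed.

Hypothesis h1 : 1 < size D.

Definition succ u := nextin D SD u.

Lemma succP u : u \in D -> succ u \in D /\ cdist D u (succ u) = 1.
Proof.
move=> uDin; have S1 : 1 < #|SD| by rewrite card_seq_set.
have uS : u \in SD by rewrite inE.
have [sD su mn] := nextinP D S1 uS.
have sD' : succ u \in D by move: sD; rewrite inE.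
split => //; apply/eqP; rewrite eqn_leq; apply/andP; split; last by apply: cdist_gt0; rewrite // eq_sym.
pose x := nth u (lin D u) 1.
have xD : x \in D by rewrite -(mem_lin D u) mem_nth // size_lin.
have cx : cdist D u x = 1 by rewrite -index_lin // index_uniq ?lin_uniq // size_lin.
rewrite -cx; apply: mn; first by rewrite inE.
by apply: contra_eq_neq cx => ->; rewrite cdistxx.
Qed.

Lemma succ_inj : {in D &, injective succ}.
Proof.
move=> u v uDin vDin E; have [sD cu] := succP uDin; have [sD' cv] := succP vDin.
apply/eqP/negPn/negP => uv.
have ns : succ u != u by apply: contra_eq_neq cu => ->; rewrite cdistxx.
have ns' : succ v != v by apply: contra_eq_neq cv => ->; rewrite cdistxx.
have := cdistC uDin sD; rewrite eq_sym ns => /(_ isT) H1.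
have := cdistC vDin sD'; rewrite eq_sym ns' => /(_ isT) H2.
have E' : cdist D (succ u) u = cdist D (succ u) v by move: H1 H2; rewrite cu cv -E; nlia.
by have := cdist_inj sD uDin vDin E' => /eqP; rewrite (negPf uv).
Qed.

End Links.

(** * The bound when no tail is bad *)

Section GoodBound.
Variables (G : sgraph) (C D : seq G).
Implicit Types (A X : {set G}) (x y z p u v w : G).
Notation e := (@adj G).
Notation F := (off_cycle C).
Notation O := (off_both C D).
Notation SD := [set x in D].
Notation SC := [set x in C].
Hypothesis HC : longest_in setT C.
Hypothesis HD : longest_in F D.
Let cD : is_cycle D. Proof. by case: HD. Qed.
Let cC : is_cycle C. Proof. by case: HC. Qed.
Let uC : uniq C. Proof. exact: is_cycle_uniq. Qed.

Lemma degree_split x : #|[set y | e x y]| = #|nb SC x| + #|nb F x|.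
Proof.
rewrite -[in LHS](cardsID SC [set y | e x y]); congr (_ + _); apply: eq_card => y.
  by rewrite !inE andbC.
by rewrite !inE.
Qed.

Lemma nbF_split x : #|nb F x| <= #|nb SD x| + #|nb O x|.
Proof.
apply: leq_trans (leq_card_setU _ _); apply/subset_leq_card/subsetP => y.
by rewrite !inE => /andP[-> ->]; case: (y \in D).
Qed.

Variables (k mu : nat).
Hypothesis k2 : 1 < k.
Hypothesis kh : k <= size D.
Hypothesis muh : mu < size D.
Hypothesis deg : forall x, k + mu <= #|[set y | e x y]|.

Section WithLinks.
Variables (W : {set G}) (lu zz : G -> G) (Aw : G -> {set G}).
Hypothesis WC : {subset W <= C}.
Hypothesis Wk : #|W| = k.
Hypothesis links : forall w, w \in W ->
  [/\ lu w \in D, Aw w \subset O,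
      forall t, t \in lu w |: Aw w -> lp (lu w |: Aw w) (lu w) t 0,
      zz w \in lu w |: Aw w & e w (zz w)].
Hypothesis links_disj : forall w w', w \in W -> w' \in W -> w != w' ->
  [disjoint Aw w & Aw w'] /\ lu w != lu w'.
Let W1 : 1 < #|W|. Proof. by rewrite Wk. Qed.
Let h1 : 1 < size D. Proof. exact: leq_trans k2 kh. Qed.
Notation nx := (nextin C W).
(** Tails start one step after the foot: by [pred_lp_degree], the neighbours of [pa w] on [D] then
    turn into the length of a path from the foot [lu w]. *)
Definition pa w := succ D (lu w).

Lemma luD w : w \in W -> lu w \in D.
Proof. by case/links. Qed.

Lemma paD w : w \in W -> pa w \in D.
Proof. by move=> wW; have [] := succP HD h1 (luD wW). Qed.

Lemma pa_dist w : w \in W -> cdist D (lu w) (pa w) = 1.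
Proof. by move=> wW; have [] := succP HD h1 (luD wW). Qed.

Lemma pa_inj : {in W &, injective pa}.
Proof.
move=> w w' wW w'W /(succ_inj HD h1 (luD wW) (luD w'W)) E; apply/eqP/negPn/negP => ww'.
by have [_] := links_disj wW w'W ww'; rewrite E eqxx.
Qed.

Lemma nxP w : w \in W -> nx w \in W /\ nx w != w.
Proof. by move=> wW; have [] := nextinP C W1 wW. Qed.

Lemma lu_nx w : w \in W -> lu (nx w) != lu w.
Proof. by move=> wW; have [nW nw] := nxP wW; have [] := links_disj nW wW nw. Qed.

(** Only gaps up to [mu + 2] are wanted, so [rho] is maximal subject to the cap [mu]; then
    [rho w < mu] means that no better [linkgap] holds at all. *)
Lemma rho_exists : exists rho : G -> nat, forall w, w \in W ->
  [/\ rho w <= mu, linkgap C D (lu w) (lu (nx w)) (rho w) &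
      forall r, r <= mu -> linkgap C D (lu w) (lu (nx w)) r -> r <= rho w].
Proof.
apply: (@fin_all_exists _ (fun=> nat) (fun w r => w \in W ->
   [/\ r <= mu, linkgap C D (lu w) (lu (nx w)) r &
      forall r', r' <= mu -> linkgap C D (lu w) (lu (nx w)) r' -> r' <= r])) => w.
have [wW|wW] := boolP (w \in W); last by exists 0.
have [nW nw] := nxP wW.
have [||r [r1 r2] r3] := @ex_max nat (fun r => r <= mu /\ linkgap C D (lu w) (lu (nx w)) r) id mu.
- exists 0; split => //; apply: (linkgap_le (leq0n _)); apply: (lp_linkgap HC HD).
  by apply: half_arc; rewrite ?luD // eq_sym lu_nx.
- by move=> r [].
- by exists r => _; split => // r' h h'; apply: r3.
Qed.

Section WithRho.
Variable rho : G -> nat.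
Hypothesis rhoP : forall w, w \in W ->
  [/\ rho w <= mu, linkgap C D (lu w) (lu (nx w)) (rho w) &
      forall r, r <= mu -> linkgap C D (lu w) (lu (nx w)) r -> r <= rho w].

Definition Pset : {set G} := pa @: W.
(** As [pa] is injective, the maximum is over at most one vertex and transports [rho] from [W] to
    the bases. *)
Definition pval a := \max_(w in W | pa w == a) rho w.

Lemma pval_pa w : w \in W -> pval (pa w) = rho w.
Proof.
move=> wW; rewrite /pval (big_pred1 w) // => v.
apply/andP/eqP => [[vW /eqP]|->]; first exact: pa_inj.
by rewrite wW.
Qed.

Lemma PsetD : {subset Pset <= D}.
Proof. by move=> a /imsetP[w wW ->]; apply: paD. Qed.

Variable tl : G -> seq G.
Hypothesis bt : best_tails C D Pset pval tl.
Let tt : tails C D Pset tl. Proof. by case: bt. Qed.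
Notation en a := (last a (tl a)).
Hypothesis good : forall u, tl u != [::] -> 2 * #|nb F (en u)| <= size D.

Definition supply w := #|nb SC (en (pa w)) :\: W|.
(** The pairs in which a tailless base with a deficit loses a neighbour to the head of another
    tail. *)
Definition blocked v u := [&& tl (pa v) == [::], rho v < mu, tl (pa u) != [::] &
  e (pa v) (head (pa u) (tl (pa u)))].

(** Of the [k + mu] neighbours of the end, at most [k] lie in [W]. *)
Lemma supply_lb w : w \in W -> mu <= supply w + #|nb F (en (pa w))|.
Proof.
move=> wW; have := deg (en (pa w)); rewrite degree_split.
have := cardsID W (nb SC (en (pa w))); rewrite -/(supply w).
have : #|nb SC (en (pa w)) :&: W| <= k by rewrite -Wk; apply/subset_leq_card/subsetIr.
set n1 := #|_|; set n2 := #|nb SC _|; set n3 := #|nb F _|; set n4 := supply w.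
by move=> ? ? ?; lia.
Qed.

(** [pred_lp_degree] gives a path of that length between the two feet, and [rho] is maximal. *)
Lemma rho_deg w : w \in W -> rho w < mu -> #|nb SD (pa w)| <= rho w.
Proof.
move=> wW lt; have [nW nw] := nxP wW; have [r1 r2 r3] := rhoP wW.
have l := pred_lp_degree cD (paD wW) (luD wW) (pa_dist wW) (luD nW) (lu_nx wW).
have E : nb SD (pa w) = [set z in D | e (pa w) z].
  by apply/setP => z; rewrite !inE.
rewrite E; set d := #|_| in l *.
have lg := lp_linkgap HC HD l.
have [le|/ltnW le] := leqP d mu; first exact: r3.
have lgm := linkgap_le le lg.
by have := r3 _ (leqnn _) lgm; rewrite leqNgt lt.
Qed.

(** Off [C], a tailless base has at most [rho] neighbours on [D], and all others are heads of tails,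
    hence counted by [blocked]. *)
Lemma unmatched_supply w : w \in W -> tl (pa w) = [::] ->
  mu - rho w <= supply w + \sum_(u in W) blocked w u.
Proof.
move=> wW tw; have [lt|ge] := ltnP (rho w) mu; last by move: ge; rewrite -subn_eq0 => /eqP->.
have := supply_lb wW; rewrite tw /=; have := rho_deg wW lt; have := nbF_split (pa w).
suff : #|nb O (pa w)| <= \sum_(u in W) blocked w u by nlia.
have -> : \sum_(u in W) blocked w u = #|[set u in W | blocked w u]|.
  by rewrite -sum1dep_card big_mkcondr; apply: eq_bigr => u _; case: (blocked w u).
apply: leq_trans (leq_imset_card (fun u => head (pa u) (tl (pa u))) _).
apply/subset_leq_card/subsetP => z; rewrite inE => /andP[zO wz].
have pP : pa w \in Pset by apply: imset_f.
have [a /imsetP[u uW ->] [r Er]] := best_start bt pP tw zO wz.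
apply/imsetP; exists u; last by rewrite Er.
by rewrite inE uW /blocked tw lt Er /= wz.
Qed.

(* The D-vertices adjacent to the head of the tail all lie in one common neighbourhood. *)
Lemma matched_supply u : u \in W -> tl (pa u) != [::] ->
  mu - rho u + \sum_(v in W) blocked v u <= supply u.
Proof.
move=> uW tu; set y := head (pa u) (tl (pa u)).
have [h1' h2' h3'] := tt; have [pu uu uO] := h2' (pa u).
have [r Er] : exists r, tl (pa u) = y :: r by rewrite /y; case: (tl (pa u)) tu => // a r _; exists r.
have yO : y \in O by apply: uO; rewrite Er mem_head.
have uy : e (pa u) y by move: pu; rewrite Er => /andP[].
pose N := [set v in W | blocked v u].
have Esum : \sum_(v in W) blocked v u = #|N|.
  by rewrite -sum1dep_card big_mkcondr; apply: eq_bigr => v _; case: (blocked v u).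
have NW v : v \in N -> v \in W by rewrite inE => /andP[].
have blk v : v \in N -> [/\ tl (pa v) = [::], rho v < mu & e (pa v) y].
  by rewrite inE => /andP[_ /and4P[/eqP ? ? _ ?]].
have [ru1 ru2 ru3] := rhoP uW.
have sl := supply_lb uW; have gd := good tu.
have common (Q : {set G}) : {subset Q <= W} -> Q != set0 -> (forall v, v \in Q -> e (pa v) y) ->
   exists2 v, v \in Q & rho v < mu -> (size D)./2 + (#|Q| - 1) <= rho v.
  move=> QW Q0 Qy; have := @common_neighbor_linkgap G C D HC HD (pa @: Q) y.
  have c : #|pa @: Q| = #|Q|.
    by apply: card_in_imset => v w /QW vW /QW wW; apply: pa_inj.
  case=> //.
  - by move=> a /imsetP[v /QW vW ->]; apply: paD.
  - by rewrite -card_gt0 c card_gt0.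
  - by move=> a /imsetP[v vQ ->]; apply: Qy.
  move=> a /imsetP[v vQ ->] H; exists v => // lt; have vW := QW _ vQ.
  have [nW nw] := nxP vW; have [r1 r2 r3] := rhoP vW.
  have lg : linkgap C D (lu v) (lu (nx v)) ((size D)./2 + (#|Q| - 1)).
    apply: (H _ _ _ (luD vW) (pa_dist vW) (luD nW) (lu_nx vW)); rewrite c.
    by rewrite mulnDr leq_add2r mul2n -[leqRHS]odd_double_half leq_addl.
  have [le|/ltnW le] := leqP ((size D)./2 + (#|Q| - 1)) mu; first exact: r3.
  by have := r3 _ (leqnn _) (linkgap_le le lg); rewrite leqNgt lt.
have dh : #|nb F (en (pa u))| <= (size D)./2 by move: gd; clear; nlia.
rewrite Esum; have uN : u \notin N by apply/negP => /blk[E]; rewrite E in tu.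
(* Without a deficit at [u], the blocked bases alone are considered: one of them has a [rho] below
   [mu] and at least [(size D)./2 + #|N| - 1]. So [#|N|] is at most [mu - (size D)./2], a lower
   bound for the supply. *)
have [lt|ge] := ltnP (rho u) mu; last first.
  have -> : mu - rho u = 0 by apply/eqP; rewrite subn_eq0.
  have [->|N0] := eqVneq N set0; first by rewrite cards0.
  have [v vN] := common N NW N0 (fun v vN => let: And3 _ _ h := blk v vN in h).
  have [_ lt _] := blk v vN; move=> /(_ lt) H; have : 0 < #|N| by rewrite card_gt0.
  by move: H lt sl dh; clear; nlia.
(* With a deficit, [u] joins them. The value criterion gives [rho v <= rho u], so [rho u] is at
   least [(size D)./2 + #|N|]. *)
have [v vK Hv] : exists2 v, v \in u |: N & rho v < mu -> (size D)./2 + (#|u |: N| - 1) <= rho v.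
  apply: common; first by move=> v; rewrite in_setU1 => /orP[/eqP->//|/NW].
    by apply/set0Pn; exists u; rewrite in_setU1 eqxx.
  by move=> v; rewrite in_setU1 => /orP[/eqP->//|/blk[]].
have vu : rho v <= rho u.
  move: vK; rewrite in_setU1 => /orP[/eqP->//|vN]; have [tv _ vy] := blk v vN.
  rewrite -(pval_pa (NW _ vN)) -(pval_pa uW).
  by apply: (best_swap bt (imset_f _ uW) (imset_f _ (NW _ vN)) tv Er vy).
have := Hv (leq_ltn_trans vu lt); rewrite cardsU1 uN add1n subn1 /= => H.
by move: H vu lt sl dh; clear; nlia.
Qed.

(** Summed over [W], what tailless bases lose through [blocked] is what the tails pay, so the two
    double sums cancel. *)
Lemma total_supply : \sum_(w in W) (mu - rho w) <= \sum_(w in W) supply w.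
Proof.
have : \sum_(w in W) (mu - rho w + \sum_(v in W) blocked v w) <=
       \sum_(w in W) (supply w + \sum_(u in W) blocked w u).
  apply: leq_sum => w wW; have [tw|tw] := eqVneq (tl (pa w)) [::].
    rewrite big1 ?addn0 ?unmatched_supply // => v _; rewrite /blocked tw eqxx /=.
    by rewrite !andbF.
  rewrite [X in _ <= _ + X]big1 ?addn0 ?matched_supply // => u _.
  by rewrite /blocked (negPf tw).
rewrite !big_split /= [X in _ + X <= _]exchange_big /= leq_add2r; exact.
Qed.

Definition att y := [set a in Pset | e y (en a)].

Lemma gap_w w : w \in W ->
  2 + rho w + \sum_(y in SC | 0 < cdist C w y < cdist C w (nx w)) #|att y| <= cdist C w (nx w).
Proof.
move=> wW; have [nW nw] := nxP wW; have [r1 r2 r3] := rhoP wW.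
have [aw [awD raw hitw]] := link_base tt links wW.
have [aw' [aw'D raw' hitw']] := link_base tt links nW.
pose zs := [seq y <- lin C w | (0 < cdist C w y < cdist C w (nx w)) && (att y != set0)].
have wC := WC wW.
have ww : w != nx w by rewrite eq_sym.
have zC : {subset zs <= C} by move=> y; rewrite mem_filter mem_lin => /andP[].
have lt_trans : transitive (fun p q => cdist C w p < cdist C w q) by move=> p q r; apply: ltn_trans.
have ul : uniq (lin C w) by apply: lin_uniq.
have -> : \sum_(y in SC | 0 < cdist C w y < cdist C w (nx w)) #|att y| = \sum_(y <- zs) #|att y|.
  rewrite (big_uniq _ (filter_uniq _ ul)) /= big_mkcond [RHS]big_mkcond /=.
  apply: eq_bigr => y _; rewrite mem_filter mem_lin inE.
  have [E|E] := eqVneq (att y) set0; first by rewrite E cards0 andbF /= !if_same.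
  by rewrite andbT andbC.
apply: (interval_bound HC HD PsetD tt WC links links_disj wW nW ww awD aw'D raw raw' hitw hitw' r2
  (leq_ltn_trans r1 muh) zC).
  have sl : sorted (fun p q => cdist C w p < cdist C w q) (lin C w).
    apply: (@sub_in_sorted _ (mem C) (fun p q => index p (lin C w) < index q (lin C w))).
    - by move=> p q pC qC; rewrite !index_lin.
    - by apply/allP => y; rewrite mem_lin.
    - apply/(sortedP w) => i; set l := lin C w => li; rewrite !index_uniq //; exact: ltnW.
  rewrite rcons_path (path_sortedE lt_trans) (sorted_filter lt_trans _ sl) andbT.
  apply/andP; split; first by apply/allP => y; rewrite mem_filter cdistxx => /andP[/andP[/andP[]]].
  have : last w zs \in w :: zs by apply: mem_last.
  rewrite inE => /orP[/eqP->|]; last by rewrite mem_filter => /andP[/andP[/andP[]]].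
  by rewrite cdistxx cdist_gt0 // ?WC.
by move=> y; rewrite mem_filter => /andP[/andP[]].
Qed.

(** Each gap yields [2 + rho] plus the attachments inside it. All attachments outside [W] add up to
    the supplies, and [total_supply] raises the average of [rho] to [mu]. *)
Lemma good_bound : k * (mu + 2) <= size C.
Proof.
apply: leq_trans (nextin_sum uC WC W1).
apply: (@leq_trans (\sum_(w in W) (2 + rho w + \sum_(y in SC | 0 < cdist C w y < cdist C w (nx w)) #|att y|))); last first.
  by apply: leq_sum => w wW; apply: gap_w.
rewrite big_split /=.
have owner : \sum_(y in SC | y \notin W) #|att y| <=
    \sum_(w in W) \sum_(y in SC | 0 < cdist C w y < cdist C w (nx w)) #|att y|.
  under [leqRHS]eq_bigr do rewrite big_mkcondr.
  rewrite exchange_big big_mkcondr /=; apply: leq_sum => y yC; case: ifP => // yW.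
  have yC' : y \in C by move: yC; rewrite inE.
  have [w wW H] := nextin_owner WC W1 yC' yW.
  by rewrite (bigD1 w) //= H leq_addr.
have swap : \sum_(y in SC | y \notin W) #|att y| = \sum_(w in W) supply w.
  transitivity (\sum_(a in Pset) #|nb SC (en a) :\: W|); last first.
    by rewrite /Pset big_imset //; apply: pa_inj.
  have cs (A : {set G}) (Q : pred G) : #|[set a in A | Q a]| = \sum_(a in A) Q a.
    by rewrite -sum1dep_card big_mkcondr; apply: eq_bigr => a _; case: (Q a).
  transitivity (\sum_(y in SC :\: W) \sum_(a in Pset) e y (en a)).
    apply: eq_big => [y|y _]; last exact: cs.
    by rewrite in_setD andbC.
  rewrite exchange_big /=; apply: eq_bigr => a _.
  have -> : nb SC (en a) :\: W = [set y in SC :\: W | e y (en a)].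
    by apply/setP => y; rewrite !inE adj_sym andbA.
  by rewrite cs.
have := total_supply; rewrite -swap => H1.
have H2 : \sum_(w in W) mu <= \sum_(w in W) rho w + \sum_(w in W) (mu - rho w).
  by rewrite -big_split /=; apply: leq_sum => w _; lia.
rewrite big_split /= !sum_nat_const Wk in H2 *.
move: owner H1 H2; set s1 := \sum_(y in SC | _) _; set s2 := \sum_(w in W) \sum_(y in SC | _) _; set s3 := \sum_(w in W) _.
set s4 := \sum_(w in W) _.
nlia.
Qed.

End WithRho.
End WithLinks.
End GoodBound.

(** * Bad tails and their rotations *)

Section BadTail.
Variables (G : sgraph) (C D : seq G).
Implicit Types (x y z u v : G).
Notation e := (@adj G).
Notation F := (off_cycle C).
Notation O := (off_both C D).
Hypothesis HC : longest_in setT C.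
Hypothesis HD : longest_in F D.

(** The clause on reorderings keeps the dichotomy available for every rotation of the tail, without
    the system of tails from which it came. *)
Definition bad_tail u (p : seq G) :=
  [/\ u \in D, path e u p, uniq p & {subset p <= O}] /\
  [/\ p != [::], size D < 2 * #|nb F (last u p)| &
      forall q, perm_eq q p -> path e u q ->
        2 * #|nb F (last u q)| <= size D \/ nb F (last u q) \subset [set z in u :: p]].

Section Best.
Variables (P : {set G}) (val : G -> nat).
Hypothesis PD : {subset P <= D}.
Variable tl : G -> seq G.
Hypothesis bt : best_tails C D P val tl.
Let tt : tails C D P tl. Proof. by case: bt. Qed.

Lemma tail_rearranged u q : tl u != [::] -> perm_eq q (tl u) -> path e u q ->
  2 * #|nb F (last u q)| <= size D \/ nb F (last u q) \subset [set z in u :: tl u].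
Proof.
move=> tu pe pq; have [h1 h2 h3] := tt; have [pu uu uO] := h2 u.
have uP : u \in P by apply: contraR tu => /h1->.
have mq x : (x \in q) = (x \in tl u) by apply: perm_mem.
have t' : tails C D P (upd tl u q).
  apply: tails_upd => //; first by rewrite (perm_uniq pe).
    by move=> x; rewrite mq => /uO.
  move=> v z vu; rewrite mq => zu; apply/negP => zv.
  by have := h3 _ _ _ zv zu => /eqP; rewrite (negPf vu).
have uq : upd tl u q u = q by rewrite /upd eqxx.
have := @tail_dichotomy _ _ _ HD _ _ t' u (PD uP); rewrite uq.
have -> : tset (upd tl u q) u = [set z in u :: tl u].
  by apply/setP => z; rewrite !inE uq mq.
apply; first by rewrite -size_eq0 (perm_size pe) size_eq0.
move=> z; rewrite inE => /andP[zF lz].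
have [zD|[v zv]] := best_end bt uP pe pq zF lz; first by exists z; rewrite // inE mem_head.
exists v; first by apply/PD; apply: contraTT zv => /h1->.
have [E|vu] := eqVneq v u; last by rewrite inE in_cons upd_neq // zv orbT.
rewrite inE in_cons E uq.
by move: zv; rewrite E mq => ->; rewrite orbT.
Qed.

Lemma bad_tail_of u : tl u != [::] -> size D < 2 * #|nb F (last u (tl u))| -> bad_tail u (tl u).
Proof.
move=> tu lt; have [h1 h2 h3] := tt; have [pu uu uO] := h2 u.
have uP : u \in P by apply: contraR tu => /h1->.
split; split => //; first exact: PD.
by move=> q pe pq; apply: tail_rearranged.
Qed.

End Best.

Theorem bound_or_bad_tail k mu : 1 < k -> k <= size D -> mu < size D ->
  (forall x, k + mu <= #|[set y | e x y]|) -> connected_avoiding G k ->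
  k * (mu + 2) <= size C \/ exists u p, bad_tail u p.
Proof.
move=> k2 kh muh deg conn.
have [W [lu [zz [Aw [WC Wk links links_disj]]]]] := menger_links HC HD conn kh.
have [rho rhoP] := rho_exists HC HD mu k2 Wk links links_disj.
have PD := PsetD HD k2 kh links.
have [tl bt] := best_tails_exist C D (Pset D W lu) (pval D W lu rho).
have [[u [tu lt]]|no] := classic (exists u, tl u != [::] /\ size D < 2 * #|nb F (last u (tl u))|).
  by right; exists u, (tl u); apply: (bad_tail_of PD bt).
left; apply: (good_bound HC HD k2 kh muh deg WC Wk links links_disj rhoP bt).
by move=> u tu; rewrite leqNgt; apply/negP => lt; apply: no; exists u.
Qed.

End BadTail.

(** * Attachments of a cluster of ends *)

Section ClusterGap.
Variables (G : sgraph) (C : seq G).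
Implicit Types (A B S X : {set G}) (x y w : G).
Notation e := (@adj G).
Notation F := (off_cycle C).
Notation SC := [set x in C].
Hypothesis HC : longest_in setT C.

Lemma max_index S (a : G -> nat) : {in S &, injective a} -> S != set0 ->
  exists2 s, s \in S & #|S| <= (a s).+1.
Proof.
move=> inj /set0Pn[s0 s0S].
have [|s sS mx] := @ex_max G (fun s => s \in S) a (\sum_(s in S) a s) (ex_intro _ s0 s0S) _.
  by move=> s sS; rewrite (bigD1 s) //= leq_addr.
exists s => //; rewrite cardE -(size_map a) -(size_iota 0 (a s).+1).
apply: uniq_leq_size.
  by rewrite map_inj_in_uniq ?enum_uniq // => x y; rewrite !mem_enum; apply: inj.
by move=> n /mapP[x]; rewrite mem_enum => /mx le ->; rewrite mem_iota.
Qed.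

Variables (S B : {set G}) (a : G -> nat).
Hypothesis BF : B \subset F.
Hypothesis inj : {in S &, injective a}.
Hypothesis SB : S \subset B.
Hypothesis lpS : forall s s', s \in S -> s' \in S -> s != s' -> lp B s s' (maxn (a s) (a s')).

Definition natt w := #|[set s in S | e w s]|.

(** The [natt w] attachments have distinct labels, so one label is at least [natt w - 1]. If its
    vertex is the chosen attachment of [w'] itself, any other attachment of [w] works, because path
    lengths are the maximum of two labels. *)
Lemma cluster_gap1 w w' : w \in C -> w' \in C -> w != w' -> 0 < natt w -> 0 < natt w' ->
  (natt w).+1 <= cdist C w w' /\ (natt w).+1 <= cdist C w' w.
Proof.
move=> wC w'C ww' n0 n0'; have /set0Pn[s' ] : [set s in S | e w' s] != set0 by rewrite -card_gt0.
rewrite inE => /andP[s'S ws'].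
have [||sm] := @max_index [set s in S | e w s] a; last 1 first.
- rewrite inE => /andP[smS wsm] le.
  have [s [sS ws [n l ln]]] : exists s, [/\ s \in S, e w s & exists2 n, lp B s s' n & natt w <= n.+1].
    have [E|ne] := eqVneq sm s'; last first.
      exists sm; split => //; exists (maxn (a sm) (a s')); first exact: lpS.
      by apply: leq_trans le _; rewrite ltnS leq_maxl.
    have [n1|n2] := leqP (natt w) 1.
      exists sm; split => //; exists 0 => //; rewrite E; apply: lp_refl; exact: subsetP SB _ s'S.
    have [s2] : exists s2, s2 \in [set s in S | e w s] :\ sm.
      by apply/card_gt0P; move: n2; rewrite /natt (cardsD1 sm) inE smS wsm.
    rewrite !inE => /and3P[ne s2S ws2]; exists s2; split => //.
    exists (maxn (a s2) (a s')); first by apply: lpS; rewrite // -E.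
    by apply: leq_trans le _; rewrite ltnS E leq_maxr.
  have := Cgap2 HC wC w'C ww' l BF ws ws'; move: ln; clear; nlia.
- by move=> x y; rewrite !inE => /andP[xS _] /andP[yS _]; apply: inj.
- by rewrite -card_gt0.
Qed.

Lemma cluster_gap w w' : w \in C -> w' \in C -> w != w' -> 0 < natt w -> 0 < natt w' ->
  (maxn (natt w) (natt w')).+1 <= cdist C w w'.
Proof.
move=> wC w'C ww' n0 n0'; have [h1 h2] := cluster_gap1 wC w'C ww' n0 n0'.
rewrite eq_sym in ww'; have [h3 h4] := cluster_gap1 w'C wC ww' n0' n0.
move: h1 h4; clear; nlia.
Qed.

(** The 1 in the weight counts attached vertices, at least [delta - d] already for a single end; the
    other term counts the edges from all [d] ends to [C]. *)
Lemma cluster_total delta d : #|S| = d -> 0 < d -> (forall s, s \in S -> delta - d <= #|nb SC s|) ->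
  (1 + d) * (delta - d) <= \sum_(w in SC) (0 < natt w) * (1 + natt w).
Proof.
move=> cS d0 deg.
have -> : \sum_(w in SC) (0 < natt w) * (1 + natt w) = \sum_(w in SC) (0 < natt w) + \sum_(w in SC) natt w.
  by rewrite -big_split /=; apply: eq_bigr => w _; case: posnP => [->|]; rewrite ?mul1n.
rewrite mulnDl mul1n; apply: leq_add.
  have [s sS] : exists s, s \in S by apply/card_gt0P; rewrite cS.
  apply: leq_trans (deg s sS) _; rewrite -sum1_card big_mkcond [leqRHS]big_mkcond.
  apply: leq_sum => w _; rewrite !inE; case: (w \in C) => //=; case sw: (e s w) => //=.
  by rewrite lt0b; apply/card_gt0P; exists s; rewrite inE sS adj_sym.
have -> : \sum_(w in SC) natt w = \sum_(s in S) #|nb SC s|.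
  have cs (A : {set G}) (Q : pred G) : #|[set a in A | Q a]| = \sum_(a in A) Q a.
    by rewrite -sum1dep_card big_mkcondr; apply: eq_bigr => x _; case: (Q x).
  under eq_bigr do rewrite /natt cs.
  rewrite exchange_big /=; apply: eq_bigr => s _; rewrite cs.
  by apply: eq_bigr => w _; rewrite adj_sym.
by rewrite -[X in X * _]cS -sum_nat_const; apply: leq_sum.
Qed.

End ClusterGap.

(** * Posa rotations of a bad tail *)

Section Posa.
Variables (G : sgraph) (C D : seq G).
Implicit Types (S X : {set G}) (x y z u v : G).
Notation e := (@adj G).
Notation F := (off_cycle C).
Notation O := (off_both C D).
Hypothesis HD : longest_in F D.

(* [S] is the set of ends produced by the rotations of [q], the successors on [q] of the neighbours of
   its last vertex, and [a] is the distance on [q] to that vertex. *)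
Definition cluster u (q : seq G) d S (a : G -> nat) :=
  [/\ u \in D, path e u q, uniq q & {subset q <= O}] /\
  [/\ nb F (last u q) \subset [set z in u :: q], #|nb F (last u q)| = d,
      size D < 2 * d, d < size D & d <= size q] /\
  [/\ #|S| = d, {in S &, injective a},
      forall s, s \in S -> [/\ s \in q, #|nb F s| <= d & lp [set z in u :: q] u s (size q)]
    & forall s s', s \in S -> s' \in S -> s != s' -> lp [set z in q] s s' (maxn (a s) (a s'))].

(** [t] is the junction of stem and cycle; in [bad_tail_cluster] it is the position of the first
    neighbour of the last vertex. The last clause says that rotations keep the stem. *)
Definition lollipop u (q : seq G) d S t :=
  let s := u :: q in let L := size q in
  [/\ t < L, d <= L - t, is_cycle (drop t s),
      forall j, t < j <= L -> lp (seg s t L) (nth u s t) (nth u s j) d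
    & forall z, z \in S -> t < index z s /\
        forall j, j <= t -> lp (seg s j L) (nth u s j) z (L - j)].

(** Among all reorderings of the tail, [q] is one whose end has the most neighbours off [C], and
    these lie on [u :: q]. Each rotation ends in the successor of one of them, which by the choice
    of [q] has at most as many. *)
Lemma bad_tail_cluster u p : bad_tail C D u p ->
  exists q d S a, [/\ perm_eq q p, #|nb F (last u p)| <= d, cluster u q d S a & exists t, lollipop u q d S t].
Proof.
move=> [[uD pp up pO] [p0 hd clo]].
have [|q [qp pq] qmax] := @ex_max (seq G) (fun q => perm_eq q p /\ path e u q)
   (fun q => #|nb F (last u q)|) #|G| _ (fun q _ => max_card _).
  by exists p.
have mq x : (x \in q) = (x \in p) by apply: perm_mem.
have uq : uniq q by rewrite (perm_uniq qp).
have qO : {subset q <= O} by move=> x; rewrite mq => /pO.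
have un : u \notin q by apply/negP => /qO/O_notD; rewrite uD.
pose s := u :: q; pose L := size q; pose en := last u q; set d := #|nb F en| in qmax *.
have us : uniq s by rewrite /= un.
have hd' : size D < 2 * d.
  by apply: leq_trans hd _; rewrite leq_mul2l /= /d; apply: qmax.
have sub : nb F en \subset [set z in s].
  have [|//] := clo q qp pq; first by rewrite leqNgt hd'.
  move=> /subset_trans; apply; apply/subsetP => z; rewrite !inE.
  by rewrite -mq.
have sq : sorted e s by [].
have eL : nth u s L = en by rewrite nth_last.
have szs : size s = L.+1 by [].
have nidx x : x \in nb F en -> index x s < L /\ nth u s (index x s) = x.
  move=> xN; have xs : x \in s by have := subsetP sub _ xN; rewrite inE.
  split; last exact: nth_index.
  have : index x s < L.+1 by rewrite -szs index_mem.
  rewrite ltnS leq_eqVlt => /orP[/eqP E|//]; move: xN; rewrite inE => /andP[_].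
  by rewrite -[x in e _ x](nth_index u xs) E eL adj_irrefl.
pose f x := nth u s (index x s).+1.
have fidx x : x \in nb F en -> index (f x) s = (index x s).+1.
  by move=> /nidx[h _]; rewrite index_uniq // szs ltnS.
have finj : {in nb F en &, injective f}.
  move=> x y xN yN E; have [_ <-] := nidx x xN; have [_ <-] := nidx y yN.
  by congr nth; have := fidx x xN; rewrite E fidx // => -[].
pose S := f @: nb F en.
have cS : #|S| = d by rewrite card_in_imset.
pose a z := L - index z s.
have SP z : z \in S -> exists i, [/\ 0 < i <= L, nth u s i = z, index z s = i & e en (nth u s i.-1)].
  case/imsetP => x xN ->; have [h1 h2] := nidx x xN; exists (index x s).+1.
  rewrite fidx //= h1; split => //; rewrite h2; by move: xN; rewrite inE => /andP[].
have segsub i j : seg s i j \subset [set z in s] by apply/subsetP => z; rewrite !inE => /andP[].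
have segdj i j i' j' v : j < i' -> v \in seg s i j -> v \in seg s i' j' -> False.
  by move=> lt; rewrite !inE => /and3P[_ _ h1] /and3P[_ h2 _]; move: lt h1 h2; clear; nlia.
(* Rotation: from position [j] forward to the predecessor of [z], over its edge to the last vertex,
   and back to [z]; no vertex is lost. *)
have hamj j z : z \in S -> j < index z s -> lp (seg s j L) (nth u s j) z (L - j).
  move=> /SP[i [/andP[i0 iL] Ez Iz ez]]; rewrite Iz => ji.
  have l1 := @lp_seg G u s j i.-1 sq us; have l2 := @lp_seg G u s i L sq us.
  rewrite eL Ez szs iL ltnSn in l2; have {}l2 := lp_sym (l2 isT).
  have il : j <= i.-1 < size s by rewrite szs; move: iL ji; clear; lia.
  have {}l1 := l1 il.
  have il' : i.-1 < i by move: i0; clear; lia.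
  have l := lp_join l1 l2 (adjC ez) (fun v => @segdj _ _ _ _ v il').
  apply: lp_le (lp_sub _ l); first by move: i0 iL ji; clear; lia.
  apply/subsetP => v; rewrite in_setU => /orP[]; rewrite /seg !in_set => /andP[-> /andP[h1 h2]] /=.
    by rewrite h1 (leq_trans h2 (leq_trans (leq_pred i) iL)).
  by rewrite h2 (leq_trans (ltnW ji) h1).
have ham z : z \in S -> lp [set z in s] u z L.
  move=> zS; have := hamj 0 z zS; rewrite subn0 => l; apply: lp_sub (segsub 0 L) (l _).
  by have [i [/andP[i0 _] _ -> _]] := SP z zS.
have dS z : z \in S -> #|nb F z| <= d.
  move=> zS; have [r [pr ur lr sr] le] := ham z zS.
  have sub' : {subset u :: r <= s} by move=> v /sr; rewrite inE.
  (* A path inside the vertices of [u :: q] with at least as many edges visits all of them, so it is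
     a reordering. *)
  have sz : size s <= size (u :: r) by rewrite szs ltnS.
  have [_ E] := uniq_min_size ur sub' sz.
  rewrite -lr; apply: qmax; split => //; apply: perm_trans qp.
  have := uniq_perm ur us E; rewrite perm_cons //.
(* From the earlier end forward to the predecessor of the later one, over to the last vertex, and
   back. Nothing after the earlier end is omitted, so the length is its label, the larger of the
   two. *)
have lpS z z' : z \in S -> z' \in S -> z != z' -> lp [set z in q] z z' (maxn (a z) (a z')).
  wlog le : z z' / index z s <= index z' s.
    move=> H zS z'S zz'; have [le|/ltnW le] := leqP (index z s) (index z' s); first exact: H.
    by rewrite maxnC; apply: lp_sym; apply: H; rewrite // eq_sym.
  move=> /SP[i [/andP[i0 iL] Ez Iz ez]] /SP[j [/andP[j0 jL] Ez' Iz' ez']] zz'.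
  have ij : i < j.
    rewrite -Iz -Iz' ltn_neqAle le andbT; apply: contra_neq zz' => E.
    by rewrite -Ez -Ez' -Iz -Iz' E.
  have l1 := @lp_seg G u s j L sq us; rewrite eL Ez' szs jL ltnSn in l1.
  have l2 := @lp_seg G u s i j.-1 sq us; rewrite Ez szs in l2.
  have hj : i <= j.-1 < L.+1 by move: ij jL; clear; lia.
  have j1 : j.-1 < j by move: j0; clear; lia.
  have := lp_join (l1 isT) (lp_sym (l2 hj)) ez' (fun v h h' => @segdj _ _ _ _ v j1 h' h).
  move=> /lp_sym l; apply: lp_le (lp_sub _ l).
    by rewrite /a Iz Iz'; move: ij j0 jL; clear; lia.
  have sq' i' j' : 0 < i' -> seg s i' j' \subset [set z in q].
    move=> i'0; apply/subsetP => v; rewrite !inE => /andP[/orP[/eqP->|//]].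
    by rewrite /= eqxx => /andP[h _]; move: i'0; rewrite ltnNge h.
  by rewrite subUset !sq'.
have [x0 x0N] : exists x, x \in nb F en by apply/card_gt0P; move: hd'; rewrite -/d; clear; case: d.
(* The first neighbour of the last vertex; all [d] neighbours lie between it and that vertex, which
   gives [d <= L - i]. *)
have [x xN xmin] := @ex_min G (fun x => x \in nb F en) (fun x => index x s) (ex_intro _ x0 x0N).
have [xL Ex] := nidx x xN; set i := index x s in xL Ex xmin.
have dL : d <= L - i.
  rewrite /d cardE -(size_map (fun z => index z s)) -(size_iota i (L - i)).
  apply: uniq_leq_size.
    rewrite map_inj_in_uniq ?enum_uniq // => y z; rewrite !mem_enum => yN zN E.
    by have [_ <-] := nidx y yN; have [_ <-] := nidx z zN; rewrite E.
  move=> n /mapP[z]; rewrite mem_enum => zN ->; rewrite mem_iota (xmin _ zN) /=.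
  have [h _] := nidx z zN; by rewrite subnKC // ltnW.
have cyc : L - i < size D /\ is_cycle (drop i s).
  have Ed : drop i s = x :: drop i.+1 s by rewrite (drop_nth u) ?Ex // szs ltnW.
  have cy : is_cycle (drop i s).
    apply: is_cycleI; rewrite ?drop_uniq //; last by rewrite size_drop szs subn_gt0 ltnS ltnW.
    have pd : sorted e (drop i s) by apply: drop_sorted.
    rewrite Ed /= in pd *; rewrite rcons_path pd /=.
    have -> : last x (drop i.+1 s) = en.
      by rewrite -[last x _]/(last u (x :: drop i.+1 s)) -Ed -eL -nth_last size_drop nth_drop szs; congr nth; move: xL; clear; lia.
    by move: xN; rewrite inE => /andP[].
  split => //; case: HD => _ _ mx.
  have -> : (L - i).+1 = size (drop i s) by rewrite size_drop szs subSn // ltnW.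
  apply: mx => // v /mem_drop; rewrite inE => /orP[/eqP->|/qO vO]; first exact: D_F HD _ uD.
  exact: subsetP (O_F _ _) _ vO.
have [cyc1 cyc2] := cyc.
exists q, d, S, a; split; [by [] | exact: qmax | | exists i; split => //]; last 2 first.
- move=> j /andP[ij jL].
  (* [l] is the last neighbour before position [j]: go forward to [l], over to the last vertex, and
     back to [j]. No neighbour lies strictly between [l] and [j], so the path has at least [d]
     edges. *)
  have [l [lN lj] lmax] := @ex_max G (fun l => l \in nb F en /\ index l s < j) (fun l => index l s) L
    (ex_intro _ x (conj xN ij)) (fun l Hl => ltnW (proj1 (nidx l (proj1 Hl)))).
  have [lL El] := nidx l lN.
  have il : i <= index l s by apply: xmin.
  have l1 := @lp_seg G u s i (index l s) sq us; have l2 := @lp_seg G u s j L sq us.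
  rewrite eL szs jL ltnSn in l2; rewrite szs il ltnS (ltnW lL) El in l1.
  have el : e l en by apply: adjC; move: lN; rewrite inE => /andP[].
  have lj' := lp_join (l1 isT) (lp_sym (l2 isT)) el (fun v => @segdj _ _ _ _ v lj).
  apply: lp_le (lp_sub _ lj'); last first.
    apply/subsetP => v; rewrite in_setU => /orP[]; rewrite /seg !in_set => /andP[-> /andP[h1 h2]] /=.
      by rewrite h1 (leq_trans h2 (ltnW lL)).
    by rewrite h2 (leq_trans (ltnW ij) h1).
  have dd : d <= #|[set z in nb F en | index z s <= index l s]| + #|[set z in nb F en | j <= index z s]|.
    apply: leq_trans (leq_card_setU _ _); apply/subset_leq_card/subsetP => z zN.
    by have [jz|zj] := leqP j (index z s); apply/setUP; [right | left]; rewrite in_set zN //=; apply: lmax.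
  have cnt (X : {set G}) i1 n : {subset X <= nb F en} -> (forall z, z \in X -> i1 <= index z s < i1 + n) -> #|X| <= n.
    move=> XN Xi; rewrite cardE -(size_map (fun z => index z s)) -(size_iota i1 n).
    apply: uniq_leq_size.
      rewrite map_inj_in_uniq ?enum_uniq // => y z; rewrite !mem_enum => yX zX E.
      by have [_ <-] := nidx y (XN _ yX); have [_ <-] := nidx z (XN _ zX); rewrite E.
    by move=> n' /mapP[z]; rewrite mem_enum => zX ->; rewrite mem_iota; apply: Xi.
  have c1 : #|[set z in nb F en | index z s <= index l s]| <= (index l s - i).+1.
    apply: (cnt _ i) => z; rewrite in_set => /andP[zN // zl]; rewrite xmin //=.
    by rewrite addnS ltnS subnKC.
  have c2 : #|[set z in nb F en | j <= index z s]| <= L - j.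
    apply: (cnt _ j) => z; rewrite in_set => /andP[zN // zl]; rewrite zl /= subnKC //.
    by have [] := nidx z zN.
  move: dd c1 c2; clear; set n1 := #|_|; set n2 := #|_|; set n3 := index l s; lia.
- move=> z zS; have iz : i < index z s.
    by have [j [_ _ _ _]] := SP z zS; case/imsetP: zS => y yN ->; rewrite fidx // ltnS xmin.
  by split => // j ji; apply: hamj => //; apply: leq_ltn_trans iz.
split; first by split.
split; first by split => //; [move: dL cyc1; clear; lia | move: dL; clear; lia].
split => //.
  move=> y z /SP[i1 [/andP[_ h1] <- I1 _]] /SP[i2 [/andP[_ h2] <- I2 _]]; rewrite /a.
  move: I1 I2; set y' := nth u s i1; set z' := nth u s i2 => -> -> E.
  by rewrite /y' /z'; congr nth; move: h1 h2 E; clear; lia.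
move=> z zS; split; [|exact: dS|exact: ham].
have [j [/andP[j0 jL] <- _ _]] := SP z zS; case: j j0 jL => // j _ jL.
by rewrite /= mem_nth.
Qed.

End Posa.

(** * Two disjoint clusters *)

Section TwoClusters.
Variables (G : sgraph) (C D : seq G).
Implicit Types (S : {set G}) (x y z u v w : G).
Notation e := (@adj G).
Notation F := (off_cycle C).
Notation O := (off_both C D).
Notation SD := [set x in D].
Notation SC := [set x in C].
Hypothesis HC : longest_in setT C.
Hypothesis HD : longest_in F D.
Let cD : is_cycle D. Proof. by case: HD. Qed.
Let cC : is_cycle C. Proof. by case: HC. Qed.
Let uC : uniq C. Proof. exact: is_cycle_uniq. Qed.
Variable delta : nat.
Hypothesis deg : forall x, delta <= #|[set y | e x y]|.

Definition cweight S w := (0 < natt S w) * (1 + natt S w).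

Lemma cweight_gt0 S w : (0 < cweight S w) = (0 < natt S w).
Proof. by rewrite /cweight; case: (natt S w). Qed.

Lemma cluster_deg u q d S a s : cluster C D u q d S a -> s \in S -> delta - d <= #|nb SC s|.
Proof.
move=> [_ [_ [_ _ H _]]] /H[_ sd _]; have := deg s; rewrite (degree_split C s).
by move: sd; clear; nlia.
Qed.

Lemma cluster_natt u q d S a w : cluster C D u q d S a -> natt S w <= d.
Proof.
by move=> [_ [_ [<- _ _ _]]]; apply/subset_leq_card/subsetP => s; rewrite inE => /andP[].
Qed.

Lemma tail_set_O (q : seq G) : {subset q <= O} -> [set z in q] \subset O.
Proof. by move=> qO; apply/subsetP => z; rewrite inE => /qO. Qed.

Lemma tail_set_F u (q : seq G) : u \in D -> {subset q <= O} -> [set z in u :: q] \subset F.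
Proof.
move=> uDin qO; apply/subsetP => z; rewrite inE in_cons => /orP[/eqP->|/qO]; first exact: D_F HD _ uDin.
exact: (subsetP (O_F _ _)).
Qed.

Lemma cluster_same u q d S a w w' : cluster C D u q d S a -> w \in C -> w' \in C -> w != w' ->
  0 < natt S w -> 0 < natt S w' -> (maxn (natt S w) (natt S w')).+1 <= cdist C w w'.
Proof.
move=> [[_ _ _ qO] [_ [_ inj HS lpS]]] wC w'C ww'.
apply: (@cluster_gap _ _ HC S [set z in q] a) => //.
- exact: subset_trans (tail_set_O qO) (O_F _ _).
- by apply/subsetP => s /HS[sq _ _]; rewrite inE.
Qed.

(** Each end is joined to the base of its tail by a path with [size q >= d] edges, and the two bases
    by an arc of [D]. *)
Lemma cluster_cross u q d S a u' q' d' S' a' w w' :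
  cluster C D u q d S a -> cluster C D u' q' d' S' a' -> u != u' ->
  (forall v, v \in q -> v \in q' -> False) ->
  w \in C -> w' \in C -> w != w' -> 0 < natt S w -> 0 < natt S' w' -> d + d' + 2 <= cdist C w w'.
Proof.
move=> [[uDin _ _ qO] [[_ _ _ _ dq] [_ _ HS _]]] [[u'D _ _ q'O] [[_ _ _ _ dq'] [_ _ HS' _]]] uu' dis.
move=> wC w'C ww' /card_gt0P[s]; rewrite inE => /andP[sS ws] /card_gt0P[s']; rewrite inE => /andP[s'S ws'].
have [_ _ l1] := HS s sS; have [_ _ l1'] := HS' s' s'S.
have l2 := half_arc cD uDin u'D uu'.
have inD v (q0 : seq G) : {subset q0 <= O} -> v \in q0 -> v \in D -> False.
  by move=> q0O /q0O/O_notD vD vD'; rewrite vD' in vD.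
have l3 : lp ([set z in u :: q] :|: SD) s u' (size q + 0).
  apply: lp_cat (lp_sym l1) (lp_le (leq0n _) l2) _ => v; rewrite !inE.
  by move=> /orP[/eqP//|vq] vD; case: (inD v q qO vq vD).
have l4 : lp ([set z in u :: q] :|: SD :|: [set z in u' :: q']) s s' (size q + 0 + size q').
  apply: lp_cat l3 l1' _ => v; rewrite !inE => /orP[/orP[/eqP->|vq]|vD] /orP[/eqP//|vq'].
  - by case: (inD u q' q'O vq' uDin).
  - by case: (dis v vq vq').
  - by case: (inD v q' q'O vq' vD).
have := Cgap HC wC w'C ww' l4 _ ws ws'.
rewrite !subUset (tail_set_F uDin qO) (tail_set_F u'D q'O) (SD_F HD) => /(_ isT).
have ar n1 n2 n3 : d <= n1 -> d' <= n2 -> n1 + 0 + n2 + 2 <= n3 -> d + d' + 2 <= n3 by clear; lia.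
exact: ar.
Qed.

(** A gap within one cluster exceeds the larger number of attachments by one, and a gap between the
    clusters is at least [d + d' + 2]; in each case twice the gap covers the weights of both
    ends. *)
Lemma two_clusters u q d S a u' q' d' S' a' :
  cluster C D u q d S a -> cluster C D u' q' d' S' a' -> u != u' ->
  (forall v, v \in q -> v \in q' -> False) -> d + 2 <= delta ->
  (1 + d) * (delta - d) + (1 + d') * (delta - d') <= size C.
Proof.
move=> cl cl' uu' dis ddel.
pose om w := cweight S w + cweight S' w.
pose W := [set w in C | 0 < om w].
have d0 : 0 < d by case: cl => _ [[_ _ h _ _] _]; move: h; clear; lia.
have d0' : 0 < d' by case: cl' => _ [[_ _ h _ _] _]; move: h; clear; lia.
have WC : {subset W <= C} by move=> w; rewrite inE => /andP[].
have tot : \sum_(w in W) om w = \sum_(w in SC) cweight S w + \sum_(w in SC) cweight S' w.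
  rewrite -big_split /= big_mkcond [RHS]big_mkcond; apply: eq_bigr => w _.
  by rewrite !inE; case: (w \in C) => //=; case: posnP.
have cS : #|S| = d by case: cl => _ [_ []].
have cS' : #|S'| = d' by case: cl' => _ [_ []].
have t1 := cluster_total cS d0 (fun s sS => cluster_deg cl sS).
have t2 := cluster_total cS' d0' (fun s sS => cluster_deg cl' sS).
have W1 : 1 < #|W|.
  have [s sS] : exists s, s \in S by apply/card_gt0P; rewrite cS.
  have : 1 < #|nb SC s| by apply: leq_trans (cluster_deg cl sS); move: ddel; clear; lia.
  move=> /leq_trans; apply; apply/subset_leq_card/subsetP => w; rewrite !inE => /andP[-> sw] /=.
  rewrite addn_gt0 cweight_gt0; apply/orP; left.
  by apply/card_gt0P; exists s; rewrite inE sS adj_sym.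
have := @weight_bound _ C uC W WC W1 om 2; rewrite -big_distrl /= tot.
move=> H; suff {H}/H : forall w, w \in W -> om w + om (nextin C W w) <= 2 * cdist C w (nextin C W w).
  move=> hh; apply: leq_trans (leq_add t1 t2) _.
  by rewrite -(leq_pmul2r (isT : 0 < 2)) [leqRHS]mulnC.
move=> w wW; have [nW nw _] := nextinP C W1 wW; move: (nextin C W w) nW nw => w' w'W w'w.
have wC := WC _ wW; have w'C := WC _ w'W; rewrite eq_sym in w'w.
move: wW w'W; rewrite !inE wC w'C /= !addn_gt0 !cweight_gt0 /om /cweight.
have b1 := cluster_natt w cl; have b2 := cluster_natt w cl'.
have b3 := cluster_natt w' cl; have b4 := cluster_natt w' cl'.
have g1 := cluster_same cl wC w'C w'w; have g2 := cluster_same cl' wC w'C w'w.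
have g3 := cluster_cross cl cl' uu' dis wC w'C w'w.
have dis' v : v \in q' -> v \in q -> False by move=> h h'; apply: dis h' h.
have u'u : u' != u by rewrite eq_sym.
have g4 := cluster_cross cl' cl u'u dis' wC w'C w'w.
case: (posnP (natt S w)) g1 g3 => [->|n1] g1 g3; case: (posnP (natt S' w)) g2 g4 => [->|n2] g2 g4 //= _;
 case: (posnP (natt S w')) g1 g4 => [->|n3] g1 g4; case: (posnP (natt S' w')) g2 g3 => [->|n4] g2 g3 //= _.
all: rewrite ?mul0n ?mul1n ?addn0 ?add0n.
all: try (have {}g1 := g1 isT isT); try (have {}g2 := g2 isT isT); try (have {}g3 := g3 isT isT); try (have {}g4 := g4 isT isT).
all: nlia.
Qed.

End TwoClusters.

(** * The case 2 |D| <= delta *)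

Section ShortInside.
Variables (G : sgraph) (C D : seq G).
Implicit Types (A S X : {set G}) (x y z u v w : G).
Notation e := (@adj G).
Notation F := (off_cycle C).
Notation O := (off_both C D).
Notation SD := [set x in D].
Notation SC := [set x in C].
Hypothesis HC : longest_in setT C.
Hypothesis HD : longest_in F D.
Let cD : is_cycle D. Proof. by case: HD. Qed.
Let cC : is_cycle C. Proof. by case: HC. Qed.
Let uC : uniq C. Proof. exact: is_cycle_uniq. Qed.
Let uD : uniq D. Proof. exact: is_cycle_uniq. Qed.
Variable delta : nat.
Hypothesis deg : forall x, delta <= #|[set y | e x y]|.
Hypothesis short : 2 * size D <= delta.
Notation h := (size D).

Let h0 : 0 < h. Proof. by move: cD; case: (D). Qed.

(** Elements of [K] are at least 2 apart on [D], as any two are joined through [y]. *)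
Lemma common_neighbor_card (K : {set G}) y : {subset K <= D} -> y \in O ->
  (forall a, a \in K -> e a y) -> 1 < #|K| -> 2 * #|K| <= h.
Proof.
move=> KD yO Ky K1; have := @weight_bound _ D uD K KD K1 (fun=> 1) 1.
rewrite big_const_seq -big_const_seq -big_distrl sum_nat_const muln1 mul1n mulnC; apply.
move=> w wK; have [nK nw _] := nextinP D K1 wK; rewrite mul1n.
have l : lp [set y] y y 0 by apply: lp_refl; rewrite inE.
apply: (Dgap HD (KD _ wK) (KD _ nK) _ l) => //; [by rewrite eq_sym | by rewrite sub1set|exact: Ky|exact: Ky].
Qed.

Variable tl : G -> seq G.
Hypothesis bt : best_tails C D SD (fun=> 0) tl.
Let tt : tails C D SD tl. Proof. by case: bt. Qed.
Notation en a := (last a (tl a)).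
Notation ts := (tset tl).
Let SDD : {subset SD <= D}. Proof. by move=> x; rewrite inE. Qed.

Definition xatt y := [set a in SD | e y (en a)].
Definition xsup u := #|nb SC (en u)|.
Definition xblocked v u := [&& tl v == [::], tl u != [::] & e v (head u (tl u))].
Definition long u := (tl u != [::]) && (h < 2 * #|nb F (en u)|).

Lemma xatt_D y : {subset xatt y <= D}.
Proof. by move=> a; rewrite inE => /andP[]; rewrite inE. Qed.

Lemma xatt_card y : #|xatt y| <= h.
Proof.
by rewrite -(card_seq_set uD); apply/subset_leq_card/subsetP => a /xatt_D; rewrite inE.
Qed.

(** Two points attached to all [h] bases are [h + 1] apart; the factor [(h + 1) / h] between gaps
    and attachments is the one at which this is tight. *)
Lemma xatt_gap y y' : y \in C -> y' \in C -> y != y' -> xatt y != set0 -> xatt y' != set0 ->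
  (h + 1) * #|xatt y| + (h + 1) * #|xatt y'| <= 2 * h * cdist C y y'.
Proof.
move=> yC y'C yy' n0 n0'.
have d0 : [disjoint (set0 : {set G}) & set0] by rewrite disjoints_subset sub0set.
have [/andP[/eqP E /eqP c1]|nt] := boolP ((xatt y == xatt y') && (#|xatt y| == 1)).
  have [a aX] := set0Pn _ n0; have aD := xatt_D aX.
  have ya : e y (en a) by move: aX; rewrite inE => /andP[].
  have ya' : e y' (en a) by move: aX; rewrite E inE => /andP[].
  have := reach_gap2 HC HD tt yC y'C yy' aD ya ya' (reach_end tt aD) (reach_end tt aD).
  by rewrite -E c1; move: h0; clear; nia.
have [a [a' [t [aX a'X' aa' l ht]]]] := far_pair cD (@xatt_D y) (@xatt_D y') n0 n0' nt.
have aD := xatt_D aX; have a'D := xatt_D a'X'.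
have ya : e y (en a) by move: aX; rewrite inE => /andP[].
have ya' : e y' (en a') by move: a'X'; rewrite inE => /andP[].
have := reach_gap HC HD tt yC y'C yy' aD a'D aa' ya ya' (reach_end tt aD) (reach_end tt a'D) d0 l.
have m1 := xatt_card y; have m2 := xatt_card y'; move: h0 ht m1 m2; clear.
set s := #|_|; set s' := #|_|; set hh := h; move: (cdist C y y') => d h0 ht m1 m2 td.
have hm : hh + maxn s s' + 2 <= 2 * d by lia.
have : maxn s s' <= hh by lia.
have : s + s' <= 2 * maxn s s' by lia.
move: hm; move: (maxn s s') => M hm h1 h2.
have : (hh + 1) * (2 * M) <= hh * (2 * d) by nia.
by nia.
Qed.

(** The path contains the whole tail of [u], and its more than [h / 2] edges yield the excess; this
    needs a base of [y'] other than [u]. *)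
Lemma xatt_long_gap u y y' : u \in D -> h < 2 * size (tl u) -> y \in C -> y' \in C -> y != y' ->
  u \in xatt y -> xatt y' != set0 -> xatt y' != [set u] ->
  (h + 1) * #|xatt y| + (h + 1) * #|xatt y'| + h * (h + 1) <= 2 * h * cdist C y y'.
Proof.
move=> uDin Lh yC y'C yy' uX n0 n1.
have cn : 0 < #|xatt y' :\ u|.
  rewrite card_gt0; apply: contra_neq n1 => /eqP; rewrite setD_eq0 subset1 => /orP[/eqP//|/eqP E].
  by rewrite E eqxx in n0.
have [a' [t [a'X a'u l ht]]] := pigeonhole cD (@xatt_D y') uDin (introT andP (conj cn (leqnn _))).
have a'D := xatt_D a'X.
have yu : e y (en u) by move: uX; rewrite inE => /andP[].
have ya' : e y' (en a') by move: a'X; rewrite inE => /andP[].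
have tsD b v : b \in D -> v \in ts b -> v \in SD -> v = b.
  move=> bD vb; rewrite inE => vD; apply: (tset_disj tt vD bD _ vb).
  by rewrite inE mem_head.
have l2 : lp (ts u :|: SD) (en u) a' (size (tl u) + t).
  by apply: lp_cat (lp_sym (lp_tail tt uDin)) (lp_sym l) _ => v; apply: tsD.
have l3 : lp (ts u :|: SD :|: ts a') (en u) (en a') (size (tl u) + t + size (tl a')).
  apply: lp_cat l2 (lp_tail tt a'D) _ => v; rewrite in_setU => /orP[vu|vD] va'; last exact: tsD va' vD.
  by have := tset_disj tt uDin a'D vu va' => E; rewrite E eqxx in a'u.
have := Cgap HC yC y'C yy' l3 _ yu ya'.
rewrite !subUset (tset_F HD tt uDin) (tset_F HD tt a'D) (SD_F HD) => /(_ isT).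
have := cardsD1 u (xatt y'); have m1 := xatt_card y; have m2 := xatt_card y'.
move: Lh ht m1 m2; clear; move: #|xatt y| #|xatt y'| #|_ :\ u| (cdist C y y') (size (tl u)) (size (tl a')) (h).
move=> s s' n d L L' hh Lh ht m1 m2 E gp.
have b1 : s' <= n + 1 by move: E; case: (_ \in _) => /=; lia.
have b2 : 2 * L + hh + s' + 2 <= 2 * d by lia.
have b3 : 2 * hh + s' + 3 <= 2 * d by lia.
have b4 : hh * (2 * hh + s' + 3) <= hh * (2 * d) by rewrite leq_mul2l b3 orbT.
have b5 : (hh + 1) * s <= (hh + 1) * hh by rewrite leq_mul2l m1 orbT.
by nia.
Qed.

Lemma xsup_lb u : delta <= xsup u + #|nb F (en u)|.
Proof. by have := deg (en u); rewrite (degree_split C). Qed.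

Lemma xun_supply v : v \in D -> tl v = [::] ->
  delta <= xsup v + (h - 1) + \sum_(u in SD) xblocked v u.
Proof.
move=> vD tv; have := xsup_lb v; rewrite tv /=; have := nbF_split C D v.
have : #|nb SD v| <= h - 1.
  rewrite -(card_seq_set uD) (cardsD1 v SD) inE vD add1n subn1 /=.
  apply/subset_leq_card/subsetP => x; rewrite !inE => /andP[-> /adj_neq]; rewrite andbT eq_sym.
  by [].
suff : #|nb O v| <= \sum_(u in SD) xblocked v u by rewrite /xsup tv /=; nlia.
have -> : \sum_(u in SD) xblocked v u = #|[set u in SD | xblocked v u]|.
  by rewrite -sum1dep_card big_mkcondr; apply: eq_bigr => u _; case: (xblocked v u).
apply: leq_trans (leq_imset_card (fun u => head u (tl u)) _).
apply/subset_leq_card/subsetP => z; rewrite inE => /andP[zO vz].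
have vS : v \in SD by rewrite inE.
have [u uS [r Er]] := best_start bt vS tv zO vz.
apply/imsetP; exists u; last by rewrite Er.
by rewrite inE uS /xblocked tv Er /= vz.
Qed.

(** The 2 comes from [u], a further neighbour of the head besides the blocked bases. *)
Lemma xblocked_bound u : u \in D -> tl u != [::] ->
  0 < \sum_(v in SD) xblocked v u -> 2 * (\sum_(v in SD) xblocked v u) + 2 <= h.
Proof.
move=> uDin tu.
have -> : \sum_(v in SD) xblocked v u = #|[set v in SD | xblocked v u]|.
  by rewrite -sum1dep_card big_mkcondr; apply: eq_bigr => v _; case: (xblocked v u).
set N := [set v in SD | _]; move=> N0; set y := head u (tl u).
have [h1 h2 h3] := tt; have [pu uu uO] := h2 u.
have [r Er] : exists r, tl u = y :: r by rewrite /y; case: (tl u) tu => // a r _; exists r.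
have yO : y \in O by apply: uO; rewrite Er mem_head.
have uN : u \notin N by rewrite inE /xblocked (negPf tu) !andbF.
have := @common_neighbor_card (u |: N) y; rewrite cardsU1 uN.
move=> H; suff : 2 * (1 + #|N|) <= h by clear; nlia.
apply: H => //.
- by move=> a; rewrite !inE => /orP[/eqP->//|/andP[]].
- move=> a; rewrite in_setU1 inE => /orP[/eqP->|/andP[_ /and3P[]//]].
  by move: pu; rewrite Er => /andP[].
Qed.

(** The end of such a tail has at most [h / 2] neighbours off [C], and fewer than [h / 2] bases are
    blocked, so both numbers together stay below [h]. *)
Lemma xmatched_supply u : u \in D -> tl u != [::] -> ~~ long u ->
  delta + \sum_(v in SD) xblocked v u <= xsup u + (h - 1).
Proof.
move=> uDin tu; rewrite /long tu /= -leqNgt => gd.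
have d1 : 0 < #|nb F (en u)|.
  have [_ h2 _] := tt; have [pu uu uO] := h2 u.
  case/lastP: (tl u) tu pu uO => // r x _; rewrite rcons_path last_rcons => /andP[_ lx] rO.
  apply/card_gt0P; exists (last u r); rewrite inE adj_sym lx andbT.
  have := mem_last u r; rewrite inE => /orP[/eqP->|lr]; first exact: D_F HD _ uDin.
  by apply: (subsetP (O_F _ _)); apply: rO; rewrite mem_rcons inE lr orbT.
have := xblocked_bound uDin tu; have := xsup_lb u; move: d1 gd; clear.
set n := \sum_(v in SD) _; set d := #|_|; set s := xsup u; move=> d1 gd E H.
have [n0|n0] := posnP n; first by lia.
by have := H n0; lia.
Qed.

Lemma long_cluster u : u \in D -> long u -> exists q d S a,
  [/\ perm_eq q (tl u), #|nb F (en u)| <= d & cluster C D u q d S a].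
Proof.
move=> uDin /andP[tu lt].
have [q [d [S [a [h1 h2 h3 _]]]]] := bad_tail_cluster HD (bad_tail_of HD SDD bt tu lt).
by exists q, d, S, a.
Qed.

Lemma xlong_supply u : u \in D -> long u -> delta <= xsup u + (h - 1).
Proof.
move=> uDin /(long_cluster uDin)[q [d [S [a [_ le [_ [[_ _ _ dh _] _]]]]]]].
have := xsup_lb u; move: le dh; clear; nlia.
Qed.

(** On average a base has supply [delta - h + 1], up to what a long tail owes to the bases blocked
    by its head. A single long tail pays this debt by the excess of one gap; two of them give two
    clusters, which suffice alone. *)
Lemma sparse_bound : (h + 1) * (delta - h + 1) <= size C.
Proof.
have [[u [u' [uDin u'D uu' lu lu']]]|one] := classic (exists u u', [/\ u \in D, u' \in D, u != u', long u & long u']).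
  have [q [d [S [a [pq _ cl]]]]] := long_cluster uDin lu.
  have [q' [d' [S' [a' [pq' _ cl']]]]] := long_cluster u'D lu'.
  have [_ _ h3] := tt.
  have [hd dh] : h < 2 * d /\ d < h by case: cl => _ [[]].
  have [hd' dh'] : h < 2 * d' /\ d' < h by case: cl' => _ [[]].
  have dis v : v \in q -> v \in q' -> False.
    rewrite (perm_mem pq) (perm_mem pq') => vq vq'.
    by have := h3 _ _ _ vq vq' => E; rewrite E eqxx in uu'.
  have := two_clusters HC HD deg cl cl' uu' dis; move: short hd dh hd' dh'; clear.
  move: (size D) (size C) => hh c sh hd dh hd' dh' H; apply: leq_trans (H _); last by lia.
  (* [d] and [d'] lie strictly between [h / 2] and [h]: the first factors add up to more than
     [h + 1], and the second ones are at least [delta - h + 1]. *)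
  have b1 : (1 + d) * (delta - hh + 1) <= (1 + d) * (delta - d) by rewrite leq_mul2l; lia.
  have b2 : (1 + d') * (delta - hh + 1) <= (1 + d') * (delta - d') by rewrite leq_mul2l; lia.
  apply: leq_trans (leq_add b1 b2); rewrite -mulnDl leq_mul2r; lia.
pose Y := [set y in C | xatt y != set0].
have YC : {subset Y <= C} by move=> y; rewrite inE => /andP[].
have tot : \sum_(y in Y) #|xatt y| = \sum_(u in SD) xsup u.
  have cs (A : {set G}) (Q : pred G) : #|[set a in A | Q a]| = \sum_(a in A) Q a.
    by rewrite -sum1dep_card big_mkcondr; apply: eq_bigr => x _; case: (Q x).
  transitivity (\sum_(y in SC) #|xatt y|).
    rewrite big_mkcond [RHS]big_mkcond; apply: eq_bigr => y _; rewrite !inE.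
    by case: (y \in C) => //=; case: eqVneq => //= ->; rewrite cards0.
  under eq_bigr do rewrite /xatt cs.
  rewrite exchange_big /=; apply: eq_bigr => u _; rewrite /xsup cs.
  by apply: eq_bigr => y _; rewrite adj_sym.
pose nu := \sum_(u in SD | long u) \sum_(v in SD) xblocked v u.
have sup : h * delta <= \sum_(u in SD) xsup u + nu + h * (h - 1).
  have : \sum_(u in SD) (delta + \sum_(v in SD) xblocked v u) <=
     \sum_(u in SD) (xsup u + (h - 1) + \sum_(v in SD) xblocked u v + long u * \sum_(v in SD) xblocked v u).
    apply: leq_sum => u; rewrite inE => uDin; have [tu|tu] := eqVneq (tl u) [::].
      rewrite [X in delta + X]big1 ?addn0; last by move=> v _; rewrite /xblocked tu eqxx !andbF.
      by apply: leq_trans (xun_supply uDin tu) _; rewrite leq_addr.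
    have [lu|lu] := boolP (long u); last first.
      by apply: leq_trans (xmatched_supply uDin tu lu) _; rewrite -addnA leq_addr.
    rewrite mul1n leq_add2r; apply: leq_trans (xlong_supply uDin lu) _; exact: leq_addr.
  rewrite !big_split /= !sum_nat_const card_seq_set // -[X in _ <= _ + X]/(\sum_(u in SD) long u * \sum_(v in SD) xblocked v u).
  have -> : \sum_(u in SD) long u * \sum_(v in SD) xblocked v u = nu.
    rewrite /nu [RHS]big_mkcondr; apply: eq_bigr => u _; by case: (long u); rewrite ?mul1n ?mul0n.
  rewrite [X in _ + X <= _]exchange_big /=.
  set s1 := \sum_(u in SD) xsup u; set s2 := \sum_(u in SD) \sum_(v in SD) _; clear; nlia.
have base y y' : y \in Y -> y' \in Y -> y != y' ->
    (h + 1) * #|xatt y| + (h + 1) * #|xatt y'| <= 2 * h * cdist C y y'.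
  by rewrite !inE => /andP[yC n0] /andP[y'C n0'] yy'; apply: xatt_gap.
have nu1 : nu = 0 \/ exists2 u, u \in D & [/\ long u, 2 * nu + 2 <= h & nu = \sum_(v in SD) xblocked v u].
  have [[u [uDin lu]]|no] := classic (exists u, u \in D /\ long u); last first.
    left; apply: big1 => u /andP[]; rewrite inE => uDin lu; case: no; by exists u.
  have E : nu = \sum_(v in SD) xblocked v u.
    rewrite /nu (big_pred1 u) // => v; apply/andP/eqP => [[]|->]; last by rewrite inE.
    rewrite inE => vD lv; apply/eqP/negPn/negP => vu; apply: one; by exists v, u.
  have [n0|n0] := posnP nu; [by left | right; exists u => //; split => //].
  by rewrite E; apply: xblocked_bound => //; [by case/andP: lu | rewrite -E].
have Y1 : 1 < #|Y|.
  rewrite ltnNge; apply/negP => Y1.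
  have : \sum_(y in Y) #|xatt y| <= 1 * h.
    apply: leq_trans (leq_mul Y1 (leqnn h)); rewrite -sum_nat_const; apply: leq_sum => y _; exact: xatt_card.
  have : 2 * nu <= h by case: nu1 => [->|[u _ [_ + _]]]; clear; nlia.
  rewrite tot; move: sup short h0; clear; move: nu (size D) (\sum_(u in SD) xsup u) => n hh s; clear.
  by move=> a b c d f; nia.
have fin E : \sum_(y in Y) (h + 1) * #|xatt y| * 2 + E <= 2 * h * size C -> 2 * (h + 1) * nu <= E ->
    (h + 1) * (delta - h + 1) <= size C.
  rewrite -big_distrl -big_distrr /= tot; move: sup short h0; clear.
  move: nu (size D) (size C) (\sum_(u in SD) xsup u) => n hh c s; clear => sup sh h0 H1 H2.
  set X := delta - hh + 1.
  have EX : delta = hh - 1 + X by rewrite /X; lia.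
  have s1 : hh * X <= s + n by move: sup; rewrite EX mulnDr addnC leq_add2r.
  have s2 : 2 * (hh + 1) * (hh * X) <= 2 * (hh + 1) * (s + n) by rewrite leq_mul2l s1 orbT.
  have s3 : 2 * hh * ((hh + 1) * X) <= 2 * hh * c.
    by move: s2 H2 H1; clear; move: X => Z; lia.
  by move: s3; rewrite leq_pmul2l // muln_gt0.
case: nu1 => [n0|[u uDin [lu n2 En]]].
  apply: (fin 0); last by rewrite n0 muln0.
  rewrite addn0; apply: (weight_bound uC YC Y1) => w wY; have [nY nw _] := nextinP C Y1 wY.
  by apply: base; rewrite // eq_sym.
have uc : exists2 w, w \in Y & u \in xatt w.
  have : 0 < xsup u by have := xlong_supply uDin lu; move: short h0; clear; nlia.
  case/card_gt0P => w; rewrite !inE => /andP[wC uw].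
  have uw' : u \in xatt w by rewrite !inE uDin adj_sym.
  by exists w => //; rewrite inE wC; apply/set0Pn; exists u.
(* The excess needs a point attached to [u] whose successor is not attached to [u] alone. *)
have [w [wY uw nw]] : exists w, [/\ w \in Y, u \in xatt w & xatt (nextin C Y w) != [set u]].
  have [[w wY uw]|all1] := classic (exists2 w, w \in Y & (xatt w == [set u])); last first.
    case: uc => w wY uw; exists w; split => //; apply/negP => E; apply: all1.
    by have [nY _ _] := nextinP C Y1 wY; exists (nextin C Y w).
  have [[w' w'Y uw']|all2] := classic (exists2 w, w \in Y & (xatt w != [set u])).
    have [w1 [w1Y E nE]] := nextin_change YC Y1 (P := fun w => xatt w == [set u]) (ex_intro2 _ _ w wY uw)
       (ex_intro2 _ _ w' w'Y uw').
    by exists w1; split => //; rewrite (eqP E) inE.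
  exfalso.
  have h1 : 1 < h.
    have [q [d [S [a [_ _ [_ [[_ _ hd dh _] _]]]]]]] := long_cluster uDin lu.
    by move: hd dh; clear; lia.
  (* If all points are attached to [u] alone, another base [x] has no attachment on [C], against the
     lower bounds on its supply. *)
  have [x xD xu] : exists2 x, x \in D & x != u.
    have [sD cu] := succP HD h1 uDin; exists (succ D u) => //.
    by apply: contra_eq_neq cu => ->; rewrite cdistxx.
  have tx : \sum_(y in Y) #|xatt y| = #|Y|.
    rewrite -sum1_card; apply: eq_bigr => y yY; apply/eqP/cards1P; exists u.
    by apply/eqP/negPn/negP => H; apply: all2; exists y.
  have : xsup u <= #|Y|.
    apply/subset_leq_card/subsetP => y; rewrite !inE => /andP[yC uy]; rewrite yC.
    by apply/set0Pn; exists u; rewrite !inE uDin adj_sym.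
  have YU : #|Y| <= xsup u.
    apply/subset_leq_card/subsetP => y yY; rewrite !inE (YC _ yY) /=.
    have : u \in xatt y.
      have -> : xatt y = [set u] by apply/eqP/negPn/negP => H; apply: all2; exists y.
      by rewrite inE.
    by rewrite !inE adj_sym => /andP[].
  move=> UY; move: tx; rewrite tot (bigD1 u) ?inE //= (bigD1 x) ?inE ?xD //= => tx.
  have x0 : xsup x = 0 by move: tx YU UY; clear; nlia.
  have : \sum_(v in SD) xblocked x v <= h - 1 \/ True by right.
  have nbx : \sum_(v in SD) xblocked x v <= h.
    rewrite -(card_seq_set uD) -sum1_card; apply: leq_sum => v _; by case: (xblocked x v).
  have nbl : \sum_(v in SD) xblocked v x <= h.
    rewrite -(card_seq_set uD) -sum1_card; apply: leq_sum => v _; by case: (xblocked v x).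
  have [tx0|tx0] := eqVneq (tl x) [::].
    have := xun_supply xD tx0; rewrite x0; move: short nbx h0; clear; nlia.
  have [lx|lx] := boolP (long x); first by case: one; exists x, u.
  have := xmatched_supply xD tx0 lx; rewrite x0; move: short h0; clear; nlia.
apply: (fin (h * (h + 1))).
  have wC := YC _ wY; have [nY nw' _] := nextinP C Y1 wY.
  apply: (weight_bound_excess uC YC Y1 wY) => [w1 w1Y|].
    by have [n1Y nw1 _] := nextinP C Y1 w1Y; apply: base; rewrite // eq_sym.
  have [q [d [S [a [pq le [_ [[_ _ hd dh dq] _]]]]]]] := long_cluster uDin lu.
  have Lh : h < 2 * size (tl u).
    by rewrite -(perm_size pq); move: hd dq; clear; move: (size q) => L; lia.
  have n0 : xatt (nextin C Y w) != set0 by move: nY; rewrite inE => /andP[].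
  rewrite eq_sym in nw'.
  exact: (xatt_long_gap uDin Lh wC (YC _ nY) nw' uw n0 nw).
by move: n2; clear; move: (size D) nu => hh n; nia.
Qed.

End ShortInside.

(** * Sides of a cut vertex off the cycle *)

Section Sides.
Variables (G : sgraph) (C : seq G).
Implicit Types (A S X T : {set G}) (x y z u v w c : G) (R : seq G).
Notation e := (@adj G).
Notation F := (off_cycle C).
Notation SC := [set x in C].
Hypothesis HC : longest_in setT C.
Let cC : is_cycle C. Proof. by case: HC. Qed.
Let uC : uniq C. Proof. exact: is_cycle_uniq. Qed.

(** The vertices of the path are distinct, so it is at [z] only at its end, and [z] is the only
    place where it could leave [T]. *)
Lemma lp_stay A T x z : lp A x z 0 -> x \in T ->
  (forall u v, u \in T -> u != z -> u \in A -> e u v -> v \in A -> v \in T) -> lp (A :&: T) x z 0.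
Proof.
move=> [p [pp up lpz sp] _] xT H; exists p => //; split => // v vp; rewrite inE sp //=.
have sp' : {subset p <= A} by move=> a ap; apply: sp; rewrite inE ap orbT.
have xA : x \in A by apply: sp; rewrite mem_head.
elim: p x pp up lpz xT xA vp sp' {sp} => [|b p IH] x /=; first by move=> _ _ _ xT _; rewrite inE => /eqP->.
move=> /andP[xb pp] /andP[xn up] lz xT xA; rewrite inE => /orP[/eqP->//|vp] sp.
have bA : b \in A by apply: sp; rewrite mem_head.
have bT : b \in T.
  by apply: (H x b xT _ xA xb bA); apply: contraNneq xn => ->; rewrite -lz; apply: mem_last.
by apply: IH pp up lz bT bA vp _ => a ap; apply: sp; rewrite inE ap orbT.
Qed.

Definition closed_in A c := forall x y, x \in A -> y \in F -> e x y -> y \in c |: A.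

(* [c] separates [A] from the rest of [G - C], and [R] is the cycle whose order is to be exploited. *)
Definition side A c R :=
  [/\ A \subset F, c \in F & c \notin A] /\
  [/\ closed_in A c, forall x, x \in A -> lp (c |: A) x c 0, is_cycle R & {subset R <= c |: A}].

Lemma side_F A c R : side A c R -> c |: A \subset F.
Proof. by move=> [[AF cF _] _]; rewrite subUset sub1set cF AF. Qed.

(** [Q] joins the cycle to the cut vertex and avoids all links, so that a link can be continued over
    half of [R] and [Q] to [c]. *)
Definition side_linkage A c R (W : {set G}) (lu zz : G -> G) (Lw : G -> {set G}) xQ (Q : {set G}) :=
  [/\ {subset W <= C},
      forall w, w \in W -> [/\ lu w \in R, Lw w \subset c |: A, lp (Lw w) (lu w) (zz w) 0, e w (zz w)
          & forall v, v \in Lw w -> v \in R -> v = lu w],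
      forall w w', w \in W -> w' \in W -> w != w' -> [disjoint Lw w & Lw w'],
      [/\ xQ \in R, Q \subset c |: A, lp Q xQ c 0 & forall v, v \in Q -> v \in R -> v = xQ]
    & forall w, w \in W -> [disjoint Lw w & Q]].

(** Menger's theorem with target [c |: SC] gives [k] paths, at most one of which ends in [c]; one
    path is given up in exchange for [Q]. *)
Lemma side_links A c R k : connected_avoiding G k -> side A c R -> k <= size R -> k <= size C -> 0 < k ->
  exists (W : {set G}) lu zz Lw xQ Q, side_linkage A c R W lu zz Lw xQ Q /\ #|W| = k.-1.
Proof.
move=> conn [[AF cF cA] [clo toc cR RA]] kR kC k0.
have uR := is_cycle_uniq cR.
have cnC : c \notin C by move: cF; rewrite inF.
have ACd v : v \in c |: A -> v \notin C.
  by rewrite in_setU1 => /orP[/eqP->//|/(subsetP AF)]; rewrite inF.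
have [X lt|S [f [[SR cS] Sf fO dis]]] := @inner_linkage G (c |: A :|: SC) [set x in R] (c |: SC) k.
  have [a aR aX] : exists2 a, a \in [set x in R] & a \notin X by apply: not_covered; rewrite card_seq_set // (leq_trans lt).
  have [b bC bX] : exists2 b, b \in SC & b \notin X by apply: not_covered; rewrite card_seq_set // (leq_trans lt).
  have bB : b \in c |: SC by rewrite in_setU1 bC orbT.
  (* A path of [G] from the cycle to [C] cannot leave the side before it meets [c] or [C]. *)
  have [z zB lz] := lp_hit (T := mem (c |: SC)) (conn X a b lt aX bX) bB.
  exists a, z; split => //; apply: lp_sub (lp_stay lz (T := c |: A :|: SC) _ _).
  - by apply/subsetP => v; rewrite !inE => /andP[/andP[_ ->] ->].
  - by rewrite in_setU RA //; move: aR; rewrite inE.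
  - move=> u v uT uz; rewrite in_setD => /andP[nu _] uv _.
    have uA : u \in A.
      move: nu uT; rewrite !inE uz andbT /= negb_or => /andP[uc uC']; rewrite (negPf uc) (negPf uC') /=.
      by rewrite orbF.
    have [vC|vC] := boolP (v \in C); first by rewrite !inE vC orbT.
    by rewrite in_setU (clo u v) // inF.
have inR a : a \in S -> a \in R by move=> /(subsetP SR); rewrite inE.
pose Lk a := [set v in belast a (f a)].
have lastE a : a \in S -> last a (f a) \in C \/ last a (f a) = c.
  by move=> /Sf[_ _ + _]; rewrite !inE => /orP[/eqP->|->]; [right | left].
have LkA a : a \in S -> Lk a \subset c |: A.
  move=> aS; apply/subsetP => v; rewrite inE => vb; have [_ nb] := fO a aS.
  have [_ _ _ sU] := Sf a aS; have /setUP[//|vC] := sU v (mem_belast vb).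
  by have := nb v vb; rewrite in_setU1 vC orbT.
have LkR a v : a \in S -> v \in Lk a -> v \in R -> v = a.
  move=> aS; rewrite inE => /mem_belast; rewrite inE => /orP[/eqP//|vf] vR.
  by have [nf _] := fO a aS; have := nf v vf; rewrite inE vR.
have LkD a b : a \in S -> b \in S -> a != b -> [disjoint Lk a & Lk b].
  move=> aS bS ab; apply/pred0P => v /=; rewrite !inE; apply/negP => /andP[/mem_belast va /mem_belast vb].
  by have E := dis a b v aS bS va vb; rewrite E eqxx in ab.
have fE a : a \in S -> last a (f a) \in C -> exists q, [/\ f a = rcons q (last a (f a)), belast a (f a) = a :: q,
    path e a q, e (last a q) (last a (f a)) & uniq (a :: q)].
  move=> aS lC; have [pa ua _ _] := Sf a aS.
  case/lastP: (f a) lC pa ua => [|q b] /=; first by move=> aC; have := ACd a (RA _ (inR _ aS)); rewrite aC.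
  rewrite last_rcons belast_rcons rcons_path => _ /andP[pq lq] uq.
  exists q; split => //; move: (uq : uniq (a :: rcons q b)).
  by rewrite -rcons_cons rcons_uniq => /andP[].
have Lkt a t : a \in S -> last a (f a) \in C -> t \in Lk a -> lp (Lk a) a t 0.
  move=> aS lC; have [q [_ Eb pq _ uq]] := fE a aS lC.
  rewrite /Lk Eb => tq; have tq' : t \in a :: q by move: tq; rewrite inE.
  have := @lp_seg G a (a :: q) 0 (index t (a :: q)) pq uq.
  rewrite index_mem => /(_ tq'); rewrite nth_index //= => /(lp_le (leq0n _)); apply: lp_sub.
  by apply/subsetP => x; rewrite !inE => /andP[].
have [a1 [xQ [Q [a1S a1C HQ HQd]]]] : exists (a1 xQ : G) (Q : {set G}), [/\ a1 \in S,
    forall a, a \in S -> a != a1 -> last a (f a) \in C,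
    [/\ xQ \in R, Q \subset c |: A, lp Q xQ c 0 & forall v, v \in Q -> v \in R -> v = xQ]
    & forall a, a \in S -> a != a1 -> [disjoint Lk a & Q]].
  (* If some path ends in [c], it serves as [Q]. Otherwise walk from [c] into the side until a link
     or [R] is met: a link that is met becomes part of [Q], and if none is, an arbitrary link is
     given up. *)
  have [[a0 [a0S la0]]|noc] := classic (exists a, a \in S /\ last a (f a) = c).
    exists a0, a0, [set v in a0 :: f a0]; split => //.
    - move=> a aS aa; case: (lastE a aS) => // lac; case/eqP: aa.
      by apply: (dis a a0 c) => //; [rewrite -lac | rewrite -la0]; apply: mem_last.
    - have [pa ua _ sU] := Sf a0 a0S; split; first exact: inR.
      + apply/subsetP => v; rewrite inE => vf; have /setUP[//|vC] := sU v vf.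
        move: vf; rewrite lastI mem_rcons inE la0 => /orP[/eqP->|vb]; first by rewrite in_setU1 eqxx.
        by have [_ nb] := fO a0 a0S; have := nb v vb; rewrite in_setU1 vC orbT.
      + by exists (f a0) => //; split => // v vf; rewrite inE.
      + move=> v; rewrite !inE => /orP[/eqP//|vf] vR; have [nf _] := fO a0 a0S.
        by have := nf v vf; rewrite inE vR.
    - move=> a aS aa; apply/pred0P => v /=; rewrite !inE; apply/negP => /andP[/mem_belast va vb].
      by have E := dis a a0 v aS a0S va vb; rewrite E eqxx in aa.
  have allC a : a \in S -> last a (f a) \in C.
    by move=> aS; case: (lastE a aS) => // E; case: noc; exists a.
  have cL a : a \in S -> c \notin Lk a.
    move=> aS; apply/negP; rewrite inE => cb; have [_ nb] := fO a aS.
    by have := nb c cb; rewrite in_setU1 eqxx.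
  have [r0 r0R] : exists r, r \in R by case: (R) cR => // r R' _; exists r; rewrite mem_head.
  have l0 : lp (c |: A) c r0 0.
    have := RA _ r0R; rewrite in_setU1 => /orP[/eqP->|r0A]; last exact/lp_sym/toc.
    by apply: lp_refl; rewrite in_setU1 eqxx.
  pose T : {set G} := [set x in R] :|: \bigcup_(a in S) Lk a.
  have r0T : r0 \in T by rewrite in_setU inE r0R.
  have [z zT lz] := lp_hit (T := mem T) l0 r0T.
  set P0 := _ :\: _ in lz.
  have P0T v : v \in P0 -> v \in T -> v = z.
    by rewrite in_setD inE => /andP[+ _] vT; rewrite [v \in mem T]vT /= negbK => /eqP.
  have P0A : P0 \subset c |: A by apply: subsetDl.
  have LkT a : a \in S -> Lk a \subset T by move=> aS; apply: subsetU; rewrite bigcup_sup ?orbT.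
  have [[a1 [a1S za1]]|noa] := classic (exists a, a \in S /\ z \in Lk a).
    exists a1, a1, (Lk a1 :|: P0); split => //.
    - by move=> a aS _; apply: allC.
    - split; first exact: inR.
      + by rewrite subUset P0A LkA.
      + apply: lp_cat (Lkt a1 z a1S (allC _ a1S) za1) (lp_sym lz) _ => v v1 v2.
        by apply: P0T => //; apply: (subsetP (LkT _ a1S)).
      + move=> v; rewrite in_setU => /orP[/(LkR a1 v a1S)//|vP] vR.
        have vz : v = z by apply: P0T => //; rewrite in_setU inE vR.
        by rewrite vz in vR *; apply: LkR vR.
    - move=> a aS aa; apply/pred0P => v /=; apply/negP => /andP[va]; rewrite in_setU => /orP[vb|vP].
        exact: disjP (LkD _ _ aS a1S aa) va vb.
      have vz : v = z by apply: P0T => //; apply: (subsetP (LkT _ aS)).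
      by rewrite vz in va; exact: disjP (LkD _ _ aS a1S aa) va za1.
  have zR : z \in R.
    move: zT; rewrite inE => /orP[|/bigcupP[a aS za]]; first by rewrite inE.
    by case: noa; exists a.
  have [a1 a1S] : exists a, a \in S by apply/card_gt0P; rewrite cS.
  exists a1, z, P0; split => //.
  - by move=> a aS _; apply: allC.
  - split => //; first exact: lp_sym.
    by move=> v vP vR; apply: P0T => //; rewrite in_setU inE vR.
  - move=> a aS _; apply/pred0P => v /=; apply/negP => /andP[va vP].
    have vz : v = z by apply: P0T => //; apply: (subsetP (LkT _ aS)).
    by apply: noa; exists a; rewrite -vz.
pose S1 := S :\ a1.
have S1P a : a \in S1 -> a \in S /\ last a (f a) \in C.
  by rewrite in_setD1 => /andP[aa aS]; split => //; apply: a1C.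
pose wE a := last a (f a).
have inj : {in S1 &, injective wE}.
  move=> a b /S1P[aS _] /S1P[bS _] E; apply: (dis a b (wE a)) => //; first exact: mem_last.
  by rewrite E mem_last.
pose lu w := odflt w [pick a in S1 | wE a == w].
have luE a : a \in S1 -> lu (wE a) = a.
  move=> aS; rewrite /lu; case: pickP => [b /andP[bS /eqP E]|/(_ a)]; first exact: inj.
  by rewrite aS eqxx.
exists (wE @: S1), lu, (fun w => last (lu w) (behead (belast (lu w) (f (lu w))))), (fun w => Lk (lu w)), xQ, Q.
split; last first.
  by rewrite card_in_imset // /S1; have := cardsD1 a1 S; rewrite a1S cS => ->.
split => //.
- by move=> w /imsetP[a /S1P[_ aC] ->].
- move=> w /imsetP[a aS1 ->]; rewrite luE //; have [aS aC] := S1P a aS1.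
  have [q [Ef Eb pq lq uq]] := fE a aS aC; rewrite Eb /=; split.
  + exact: inR.
  + exact: LkA.
  + by apply: Lkt => //; rewrite inE Eb mem_last.
  + exact: adjC.
  + by move=> v; apply: LkR.
- move=> w w' /imsetP[a aS ->] /imsetP[b bS ->] ab; rewrite !luE //.
  have [aS' _] := S1P a aS; have [bS' _] := S1P b bS.
  by apply: LkD => //; apply: contraNneq ab => ->.
- move=> w /imsetP[a aS ->]; rewrite luE //; have [aS' _] := S1P a aS.
  by apply: HQd => //; move: aS; rewrite in_setD1 => /andP[].
Qed.

Definition far A c w n := exists2 z, e w z & lp (c |: A) z c n.

Lemma side_linkage_far A c R W lu zz Lw xQ Q w : is_cycle R -> {subset R <= c |: A} ->
  side_linkage A c R W lu zz Lw xQ Q -> w \in W -> far A c w (uphalf (size R)).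
Proof.
move=> cR RA [_ HW _ [xR QA lQ QR] LQ] wW; have [uR LA l wz LR] := HW w wW.
have dLQ := LQ w wW; exists (zz w) => //.
have nu : lu w != xQ.
  apply/negP => /eqP E; have [uL _] := lp_in l; have [xQQ _] := lp_in lQ.
  by apply: (disjP dLQ uL); rewrite E.
have la := half_arc cR uR xR nu.
have l2 : lp (Lw w :|: [set z in R]) (zz w) xQ (0 + uphalf (size R)).
  by apply: lp_cat (lp_sym l) la _ => v vL; rewrite inE; apply: LR.
have := lp_cat l2 lQ; rewrite add0n addn0 => l3; apply: lp_sub (l3 _); last first.
  move=> v; rewrite in_setU inE => /orP[vL|vR] vQ; last exact: QR.
  by case: (disjP dLQ vL vQ).
rewrite !subUset LA QA /= andbT; apply/subsetP => v; rewrite inE; exact: RA.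
Qed.

Lemma side_linkage_gap A c R W lu zz Lw xQ Q w w' : side A c R ->
  side_linkage A c R W lu zz Lw xQ Q -> w \in W -> w' \in W -> w != w' ->
  uphalf (size R) + 2 <= cdist C w w'.
Proof.
move=> sd [WC HW dis _ _] wW w'W ww'; have [_ [_ _ cR RA]] := sd.
have [uR LA l wz LR] := HW w wW; have [uR' LA' l' wz' LR'] := HW w' w'W.
have dW := dis w w' wW w'W ww'.
have nu : lu w != lu w'.
  apply/negP => /eqP E; have [uL _] := lp_in l; have [uL' _] := lp_in l'.
  by apply: (disjP dW uL); rewrite E.
have la := half_arc cR uR uR' nu.
have l2 : lp (Lw w :|: [set z in R]) (zz w) (lu w') (0 + uphalf (size R)).
  by apply: lp_cat (lp_sym l) la _ => v vL; rewrite inE; apply: LR.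
have l3 : lp (Lw w :|: [set z in R] :|: Lw w') (zz w) (zz w') (0 + uphalf (size R) + 0).
  apply: lp_cat l2 l' _ => v; rewrite in_setU inE => /orP[vL|vR] vL'; last exact: LR'.
  by case: (disjP dW vL vL').
have := Cgap HC (WC _ wW) (WC _ w'W) ww' l3 _ wz wz'; rewrite add0n addn0; apply.
have AF := side_F sd; rewrite !subUset (subset_trans LA AF) (subset_trans LA' AF) /= andbT.
by apply/subsetP => v; rewrite inE => /RA/(subsetP AF).
Qed.

(** The cut vertices may coincide, as they do at first; once the sides shrink, they are joined
    outside both sides, so that paths to them still compose. *)
Definition apart A1 c1 A2 c2 :=
  [/\ [disjoint A1 & A2], c1 \notin A2, c2 \notin A1 & lp (F :\: (A1 :|: A2)) c1 c2 0].

Lemma apart_sym A1 c1 A2 c2 : apart A1 c1 A2 c2 -> apart A2 c2 A1 c1.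
Proof. by move=> [d h1 h2 l]; split => //; [rewrite disjoint_sym | rewrite setUC; apply: lp_sym]. Qed.

Lemma far_gap A1 c1 R1 A2 c2 R2 w w' n1 n2 : side A1 c1 R1 -> side A2 c2 R2 -> apart A1 c1 A2 c2 ->
  w \in C -> w' \in C -> w != w' -> far A1 c1 w n1 -> far A2 c2 w' n2 -> n1 + n2 + 2 <= cdist C w w'.
Proof.
move=> sd1 sd2 [dA c1n c2n lJ] wC w'C ww' [z wz l1] [z' wz' l2].
have A1F := side_F sd1; have A2F := side_F sd2.
have l3 : lp (c1 |: A1 :|: F :\: (A1 :|: A2)) z c2 (n1 + 0).
  apply: lp_cat l1 lJ _ => v; rewrite in_setU1 => /orP[/eqP//|vA]; by rewrite in_setD in_setU vA.
have l4 : lp (c1 |: A1 :|: F :\: (A1 :|: A2) :|: (c2 |: A2)) z z' (n1 + 0 + n2).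
  apply: lp_cat l3 (lp_sym l2) _ => v; rewrite in_setU => /orP[].
    rewrite in_setU1 => /orP[/eqP->|vA]; rewrite in_setU1 => /orP[/eqP//|vA2].
      by rewrite vA2 in c1n.
    by case: (disjP dA vA vA2).
  by rewrite in_setD in_setU in_setU1 negb_or => /andP[/andP[_ /negPf->] _]; rewrite orbF => /eqP.
have := Cgap HC wC w'C ww' l4 _ wz wz'; rewrite addn0; apply.
by rewrite !subUset in A1F A2F *; rewrite A1F A2F subsetDl.
Qed.

Lemma far_gap2 A1 c1 R1 A2 c2 R2 w w' n1 n2 : side A1 c1 R1 -> side A2 c2 R2 -> apart A1 c1 A2 c2 ->
  w \in C -> w' \in C -> w != w' -> far A1 c1 w n1 -> far A2 c2 w' n2 ->
  n1 + n2 + 2 <= cdist C w w' /\ n1 + n2 + 2 <= cdist C w' w.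
Proof.
move=> sd1 sd2 ap wC w'C ww' f1 f2; split; first exact: far_gap sd1 sd2 ap wC w'C ww' f1 f2.
rewrite eq_sym in ww'; rewrite (addnC n1); exact: far_gap sd2 sd1 (apart_sym ap) w'C wC ww' f2 f1.
Qed.

End Sides.

(** * The cut vertex behind a bad tail *)

Section DenseSide.
Variables (G : sgraph) (C D : seq G).
Implicit Types (S X T : {set G}) (x y z u v c : G).
Notation e := (@adj G).
Notation F := (off_cycle C).
Notation O := (off_both C D).
Notation SD := [set x in D].
Hypothesis HD : longest_in F D.
Let cD : is_cycle D. Proof. by case: HD. Qed.

Lemma path_lp x p : path e x p -> uniq (x :: p) -> lp [set z in x :: p] x (last x p) (size p).
Proof. by move=> pp up; exists p => //; split => // v vp; rewrite inE. Qed.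

Section Contract.
Variables (u : G) (q : seq G) (d : nat) (S : {set G}) (a : G -> nat) (t : nat).
Hypothesis cl : cluster C D u q d S a.
Hypothesis ll : lollipop u q d S t.
Notation s := (u :: q).
Notation L := (size q).
Notation pt := (nth u s t).
Notation z0 := (last u q).
(** The cycle of the lollipop without its junction [pt]. *)
Definition rim := [set z in s | t < index z s].

Let uDin : u \in D. Proof. by case: cl => [[]]. Qed.
Let pq : path e u q. Proof. by case: cl => [[]]. Qed.
Let qO : {subset q <= O}. Proof. by case: cl => [[]]. Qed.
Let us : uniq s.
Proof.
rewrite /=; case: cl => [[_ _ -> _] _]; rewrite andbT; apply/negP => /qO/O_notD.
by rewrite uDin.
Qed.
Let sF : {subset s <= F}.
Proof. by move=> x; rewrite inE => /orP[/eqP->|/qO/(subsetP (O_F _ _))//]; apply: (D_F HD). Qed.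
Let tL : t < L. Proof. by case: ll. Qed.
Let szs : size s = L.+1. Proof. by []. Qed.
Let i0 : index z0 s = L.
Proof. by rewrite -[z0](nth_last u s) index_uniq // szs. Qed.
Let ipt : index pt s = t.
Proof. by rewrite index_uniq // szs ltnS ltnW. Qed.

Lemma rimP z : z \in rim -> z \in s /\ t < index z s <= L.
Proof. by rewrite inE => /andP[zs ->]; split => //; rewrite -ltnS -szs index_mem. Qed.

Lemma rim_O z : z \in rim -> z \in O.
Proof.
move=> /rimP[]; rewrite inE => /orP[/eqP->|/qO//]; rewrite /= eqxx ltn0 //.
Qed.

Lemma z0_rim : z0 \in rim.
Proof. by rewrite inE mem_last i0. Qed.

Lemma pt_s : pt \in s. Proof. by rewrite mem_nth // szs ltnS ltnW. Qed.

Lemma pt_rim : pt \notin rim.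
Proof. by rewrite inE ipt ltnn andbF. Qed.

(* The cycle of the lollipop is contracted to its last vertex [z0], and arcs leaving [D] are deleted: by
   [no_two_links] and Menger's theorem one vertex then separates [pt] and [z0] from [D]. *)
Definition contracted : rel G := fun x y =>
  [&& if x == z0 then [exists z in rim, e z y] else (x \notin rim) && e x y,
      x \notin D, y \in F & y \notin rim].

Lemma contracted_irr : irreflexive contracted.
Proof.
move=> x; rewrite /contracted; case: eqP => [->|_]; first by rewrite z0_rim /= !andbF.
by rewrite adj_irrefl andbF.
Qed.

Lemma contracted_path x p : x \notin rim -> x \in F -> path contracted x p ->
  [/\ path e x p, {subset x :: p <= F}, {in x :: p, forall v, v \notin rim}
    & {in belast x p, forall v, v \notin D}].
Proof.
elim: p x => [|b p IH] x xr xF /=; first by split => // v; rewrite inE => /eqP->.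
have xz : x != z0 by apply: contraNneq xr => ->; apply: z0_rim.
rewrite /contracted (negPf xz) xr /= => /andP[/and4P[xb xD bF br] /(IH b br bF)[h1 h2 h3 h4]].
rewrite xb; split => // v; rewrite inE => /orP[/eqP->//|].
- exact: h2.
- exact: h3.
- exact: h4.
Qed.

(** Disjoint links to [D] from [pt] and from the rim extend a path with [d] edges to an ear of [D].
    Both arcs between its ends then have more than [d] edges, against [size D < 2 * d]. *)
Lemma no_two_links : ~ exists S' f, linkage contracted [set pt; z0] SD S' f /\ #|S'| = 2.
Proof.
move=> [S' [f [[sub Hf dis] c2]]].
have ptz : pt != z0 by apply: contraNneq pt_rim => ->; apply: z0_rim.
have ES : S' = [set pt; z0] by apply/eqP; rewrite eqEcard sub c2 cards2 ptz.
have ptS : pt \in S' by rewrite ES !inE eqxx.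
have zS : z0 \in S' by rewrite ES !inE eqxx orbT.
have [p1 u1 l1] := Hf _ ptS; have [p2 u2 l2] := Hf _ zS.
rewrite inE in l1; rewrite inE in l2.
have [e1 F1 r1 D1] := contracted_path pt_rim (sF pt_s) p1.
case E2 : (f z0) p2 u2 l2 => [|y p] p2 u2 l2.
  by have := O_notD (rim_O z0_rim); rewrite l2.
move: p2 => /= /andP[]; rewrite {1}/contracted eqxx => /and4P[/existsP[z /andP[zr zy]] _ yF yr] p2.
have [e2 F2 r2 D2] := contracted_path yr yF p2.
set x1 := last pt (f pt) in l1; set x2 := last y p in l2.
have x12 : x1 != x2.
  apply/negP => /eqP E; have Ez : pt = z0.
    apply: (dis pt z0 x1) => //; first exact: mem_last.
    by rewrite E2 E inE mem_last orbT.
  by rewrite Ez eqxx in ptz.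
have [zs /andP[iz izL]] := rimP zr.
have [_ _ _ lol _] := ll.
have lz := lol (index z s); rewrite iz izL nth_index // in lz; have {}lz := lz isT.
have segr v : v \in seg s t L -> v = pt \/ v \in rim.
  rewrite inE => /and3P[vs]; rewrite leq_eqVlt => /orP[/eqP E _|lt _]; last by right; rewrite inE vs.
  by left; rewrite E nth_index.
have la : lp ([set v in pt :: f pt] :|: seg s t L) x1 z (0 + d).
  apply: lp_cat (lp_sym (lp_le (leq0n _) (path_lp e1 u1))) lz _ => v; rewrite inE => vf /segr[//|vr].
  by have := r1 v vf; rewrite vr.
have u2' : uniq (y :: p) by case/andP: u2.
have lb := path_lp e2 u2'.
have dj v : v \in [set v in pt :: f pt] :|: seg s t L -> v \in [set v in y :: p] -> False.
  rewrite in_setU inE => /orP[vf|/segr[->|vr]]; rewrite inE => vy.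
  - have E : pt = z0 by apply: (dis pt z0 v) => //; rewrite E2 inE vy orbT.
    by rewrite E eqxx in ptz.
  - have E : pt = z0 by apply: (dis pt z0 pt) => //; [rewrite mem_head | rewrite E2 inE vy orbT].
    by rewrite E eqxx in ptz.
  - by have := r2 v vy; rewrite vr.
have lc := lp_join la (lp_le (leq0n _) lb) zy dj.
have inO' v (x : G) (p' : seq G) : {subset x :: p' <= F} -> {in belast x p', forall v, v \notin D} ->
    v \in x :: p' -> v \in O \/ v = last x p'.
  move=> sF' sD' vp; move: (vp); rewrite lastI mem_rcons inE => /orP[/eqP->|vb]; first by right.
  by left; rewrite inO sD' // andbT -inF; apply: sF'.
have sub' : [set v in pt :: f pt] :|: seg s t L :|: [set v in y :: p] \subset x1 |: (x2 |: O).
  apply/subsetP => v; rewrite in_setU => /orP[|]; last first.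
    by rewrite inE => /(inO' v _ _ F2 D2)[vO|->]; rewrite !in_setU1 ?vO ?eqxx ?orbT.
  rewrite in_setU inE => /orP[/(inO' v _ _ F1 D1)[vO|->]|/segr[->|vr]].
  - by rewrite !in_setU1 vO !orbT.
  - by rewrite in_setU1 eqxx.
  - by have [vO|E] := inO' pt _ _ F1 D1 (mem_head _ _); rewrite !in_setU1 ?vO ?orbT // E eqxx.
  - by rewrite !in_setU1 rim_O ?orbT.
have g1 := ear_lp HD l1 l2 x12 (subxx _) (lp_sub sub' lc).
have sub2 : x1 |: (x2 |: O) \subset x2 |: (x1 |: O) by rewrite setUCA.
have x21 : x2 != x1 by rewrite eq_sym.
have g2 := ear_lp HD l2 l1 x21 (subxx _) (lp_sub sub2 (lp_sub sub' (lp_sym lc))).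
have := cdistC l1 l2 x12; case: cl => _ [[_ _ hd _ _] _]; move: g1 g2 hd; clear; nlia.
Qed.

(** The stem itself runs from [pt] to [D], so the separating vertex lies on it. *)
Lemma separating_vertex : exists j, [/\ j <= t & separates contracted [set pt; z0] SD [set nth u s j]].
Proof.
have [X [sX cX]] : exists X, separates contracted [set pt; z0] SD X /\ #|X| < 2.
  apply: NNPP => no; apply: no_two_links; apply: menger; first exact: contracted_irr.
  by move=> X sX; rewrite leqNgt; apply/negP => cX; apply: no; exists X.
pose p := rev (take t s).
have lt' : t < size s by rewrite szs ltnS ltnW.
have Et : take t.+1 s = rcons (take t s) pt by rewrite (take_nth u).
have pp : path e pt p.
  have : sorted e (rev (take t.+1 s)).
    rewrite rev_sorted (eq_sorted (e' := e)); first exact: take_sorted.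
    by move=> x y; rewrite adj_sym.
  by rewrite Et rev_rcons.
have idx v : v \in pt :: p -> v \in s /\ index v s <= t.
  have -> : pt :: p = rev (take t.+1 s) by rewrite Et rev_rcons.
  rewrite mem_rev => /(nthP u)[i]; rewrite size_takel // => it <-; rewrite nth_take //.
  have iss : i < size s by apply: leq_trans it _.
  by rewrite mem_nth // index_uniq.
have lp' : last pt p = u.
  rewrite /p; case: (t) => [|t'] //=; by rewrite rev_cons last_rcons.
have rp : path contracted pt p.
  have ub : u \notin belast pt p.
    have : uniq (pt :: p).
      have -> : pt :: p = rev (take t.+1 s) by rewrite Et rev_rcons.
      by rewrite rev_uniq take_uniq.
    by rewrite lastI lp' rcons_uniq => /andP[].
  have nr v : v \in pt :: p -> v \notin rim.
    by move=> /idx[vs vt]; rewrite inE vs /= -leqNgt.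
  have sF' v : v \in pt :: p -> v \in F by move=> /idx[/sF].
  elim: (p) (pt) pp ub nr {lp' idx} (fun v (h : v \in pt :: p) => proj1 (idx v h)) sF' => //= b p' IH x /andP[xb pb].
  rewrite inE negb_or => /andP[ux ub] nr ins sF'.
  have xz : x != z0 by apply: contraNneq (nr x (mem_head _ _)) => ->; apply: z0_rim.
  rewrite IH //; first last.
  - by move=> v vp; apply: sF'; rewrite inE vp orbT.
  - by move=> v vp; apply: ins; rewrite inE vp orbT.
  - by move=> v vp; apply: nr; rewrite inE vp orbT.
  have bi : b \in [:: x, b & p'] by rewrite !inE eqxx orbT.
  rewrite andbT /contracted (negPf xz) xb; apply/and4P; split; first by rewrite nr ?mem_head.
  - by have := ins x (mem_head _ _); rewrite in_cons eq_sym (negPf ux) /= => /qO/O_notD.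
  - exact: sF'.
  - exact: nr.
have [||v vp vX] := sX pt p _ rp; [by rewrite !inE eqxx | by rewrite lp' inE | ].
have [vs vt] := idx v vp; exists (index v s); split => //; rewrite nth_index //.
suff <- : X = [set v] by [].
by apply/esym/eqP; rewrite eqEcard sub1set vX cards1.
Qed.

Lemma dense_side : exists A1 A2 c, [/\ side C A1 c D, side C A2 c (drop t s), apart C A1 c A2 c
  & forall z, z \in S -> lp (c |: A2) z c d].
Proof.
have [j [jt sep]] := separating_vertex; set c := nth u s j in sep.
have jL : j < L by apply: leq_ltn_trans tL.
have cs : c \in s by rewrite mem_nth // szs ltnS ltnW.
have cF := sF cs.
have ic : index c s = j by rewrite index_uniq // szs ltnS ltnW.
have crim : c \notin rim by rewrite inE ic ltnNge jt andbF.
pose T := F :\ c.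
pose A2 := [set v in T | [exists z in rim, connect (fun a b => e a b && (b \in T)) z v]].
have rimT z : z \in rim -> z \in T.
  move=> zr; have [zs _] := rimP zr; rewrite in_setD1 sF // andbT.
  by apply: contraNneq crim => <-.
have A2P v : v \in A2 -> exists2 z, z \in rim & lp T z v 0.
  by rewrite inE => /andP[_ /existsP[z /andP[zr cz]]]; exists z => //; apply: connect_lp => //; apply: rimT.
have A2I v z : z \in rim -> lp T z v 0 -> v \in A2.
  move=> zr l; have [_ vT] := lp_in l; rewrite inE vT; apply/existsP; exists z; rewrite zr.
  exact: lp_connect l.
have rimA z : z \in rim -> z \in A2 by move=> zr; apply: (A2I z z) => //; apply/lp_refl/rimT.
have A2T : A2 \subset T by apply/subsetP => v; rewrite inE => /andP[].
have A2F : A2 \subset F by apply: subset_trans A2T (subD1set _ _).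
have cA2 : c \notin A2 by apply/negP => /(subsetP A2T); rewrite !inE eqxx.
have step x y : x \in A2 -> y \in F -> e x y -> y \in c |: A2.
  move=> xA yF xy; have [->|yc] := eqVneq y c; first by rewrite in_setU1 eqxx.
  have yT : y \in T by rewrite in_setD1 yc.
  have [z zr l] := A2P x xA; rewrite in_setU1 (A2I y z) ?orbT //.
  apply: lp_trans0 l (lp_le (leq0n 1) (lp_edge _ yT xy)); exact: subsetP A2T _ xA.
(* After its last vertex on the rim, a path from the rim to [D] without [c] becomes a path of the
   contracted relation from [z0], and such a path must pass through [c]. *)
have DA2 v : v \in D -> v \notin A2.
  move=> vD; apply/negP => /A2P[z zr [p [pp up lpv sp] _]].
  have [|p1 [p2 [Ep lp1 H1]]] := @last_in G rim z p; first by exists z; rewrite ?mem_head.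
  have pp2 : path e (last z p1) p2 by move: pp; rewrite Ep cat_path => /andP[].
  have [|q1 [q2 [Eq lq1 H2]]] := @first_in G SD e (last z p1) p2 pp2.
    by rewrite -last_cat -Ep lpv inE.
  have inp x : x \in q1 -> x \in T.
    by move=> xq; apply: sp; rewrite Ep Eq inE !mem_cat xq !orbT.
  have H1' x : x \in q1 -> x \notin rim by move=> xq; apply: H1; rewrite Eq mem_cat xq.
  case: q1 Eq lq1 H2 inp H1' => [|b q1] Eq /= lq1 H2 inp H1'.
    by have := O_notD (rim_O lp1); move: lq1; rewrite inE => ->.
  have pq1 : e (last z p1) b /\ path e b q1.
    by move: pp2; rewrite Eq /= cat_path => /and3P[].
  have cz : z0 \notin D by apply: O_notD (rim_O z0_rim).
  have bF : b \in F by have := inp b; rewrite mem_head => /(_ isT); rewrite in_setD1 => /andP[].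
  have rq : path contracted z0 (b :: q1).
    rewrite /= {1}/contracted eqxx cz bF H1' ?mem_head // !andbT; apply/andP; split.
      by apply/existsP; exists (last z p1); rewrite lp1; case: pq1.
    have H3 : {in belast b q1, forall x, x \notin SD} by move=> x xb; apply: H2; rewrite inE xb orbT.
    have nz x : x \notin rim -> x != z0 by move=> xr; apply: contraNneq xr => ->; apply: z0_rim.
    case: pq1 => _; move: inp H1' H3; clear -sF nz; elim: q1 b => //= b' q1 IH b inp H1' H3 /andP[bb pb].
    rewrite IH //; first last.
    - by move=> x xb; apply: H3; rewrite inE xb orbT.
    - by move=> x xb; apply: H1'; rewrite inE xb orbT.
    - by move=> x xb; apply: inp; rewrite inE xb orbT.
    have br : b \notin rim by apply: H1'; rewrite mem_head.
    have bz := nz b br.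
    rewrite andbT /contracted (negPf bz) br bb /=.
    have := H3 b (mem_head _ _); rewrite inE => ->.
    rewrite H1' ?inE ?eqxx ?orbT // andbT.
    by have := inp b'; rewrite !inE eqxx orbT => /(_ isT)/andP[].
  have [||x xq] := sep z0 (b :: q1) _ rq; [by rewrite !inE eqxx orbT | by [] | ].
  rewrite inE => /eqP E; move: xq; rewrite E in_cons => /orP[/eqP cz0|cq].
    by rewrite cz0 z0_rim in crim.
  by have := inp c cq; rewrite in_setD1 eqxx.
have segT i1 i2 : j < i1 -> seg s i1 i2 \subset T.
  move=> ji; apply/subsetP => v; rewrite inE => /and3P[vs h _]; rewrite in_setD1 sF // andbT.
  by apply: contraTneq h => ->; rewrite ic -ltnNge.
have sq : sorted e s by [].
have highA i : j < i <= L -> nth u s i \in A2.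
  move=> /andP[ji iL]; apply: (A2I _ z0 z0_rim).
  have := @lp_seg G u s i L sq us; rewrite iL szs ltnSn nth_last => /(_ isT) l.
  exact: lp_sub (segT i L ji) (lp_le (leq0n _) (lp_sym l)).
have segA : seg s j L \subset c |: A2.
  apply/subsetP => v; rewrite inE => /and3P[vs]; rewrite leq_eqVlt => /orP[/eqP E _|lt vL].
    by rewrite in_setU1 /c E nth_index // eqxx.
  by rewrite in_setU1 -[v](nth_index u vs) highA ?orbT // lt.
have conn2 x : x \in A2 -> lp (c |: A2) x c 0.
  move=> xA; have [z zr l] := A2P x xA; have [zs /andP[tz zL]] := rimP zr.
  have l1 : lp (c |: A2) z c 0.
    have := @lp_seg G u s j (index z s) sq us; rewrite szs ltnS zL (leq_trans jt (ltnW tz)) nth_index // => /(_ isT) l1.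
    apply: lp_sub (lp_le (leq0n _) (lp_sym l1)); apply: subset_trans segA.
    by apply/subsetP => v; rewrite !inE => /and3P[-> -> h]; rewrite (leq_trans h zL).
  have l2 : lp A2 x z 0.
    have := lp_stay (lp_sym l) (T := A2) xA; move=> H; apply: lp_sub (H _); first exact: subsetIr.
    move=> x' y' x'A _ _ xy; rewrite in_setD1 => /andP[yc yF].
    by have := step _ _ x'A yF xy; rewrite in_setU1 (negPf yc).
  exact: lp_trans0 (lp_sub (subsetUr _ _) l2) l1.
have [_ dL cR _ Hz] := ll.
have dropA : {subset drop t s <= c |: A2}.
  move=> v /(nthP u)[i]; rewrite size_drop szs => iL <-; rewrite nth_drop.
  apply: (subsetP segA); rewrite inE mem_nth ?szs; last by move: iL; clear; lia.
  rewrite index_uniq ?szs //; last by move: iL; clear; lia.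
  by move: iL jt; clear; lia.
pose T1 := F :\: A2.
(* Only what [c] reaches outside [A2] is taken, because all vertices of a side must be connected to
   its cut vertex. *)
pose A1 := [set v in T1 | (v != c) && connect (fun a b => e a b && (b \in T1)) c v].
have cT1 : c \in T1 by rewrite in_setD cA2.
have A1I v : v != c -> lp T1 c v 0 -> v \in A1.
  by move=> vc l; have [_ vT] := lp_in l; rewrite inE vT vc /=; apply: lp_connect l.
have A1P v : v \in A1 -> [/\ v \in T1, v != c & lp T1 c v 0].
  by rewrite inE => /and3P[h1 h2 h3]; split => //; apply: connect_lp.
have step1 x y : x \in T1 -> x != c -> y \in F -> e x y -> y \in T1.
  move=> xT xc yF xy; rewrite in_setD yF andbT; apply/negP => yA.
  have xF : x \in F by move: xT; rewrite in_setD => /andP[].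
  have := step _ _ yA xF (adjC xy); rewrite in_setU1 (negPf xc) /=.
  by move: xT; rewrite in_setD => /andP[/negPf->].
have clo1 : closed_in C A1 c.
  move=> x y /A1P[xT xc l] yF xy; have [->|yc] := eqVneq y c; first by rewrite in_setU1 eqxx.
  have yT := step1 _ _ xT xc yF xy; rewrite in_setU1 A1I ?orbT //.
  exact: lp_trans0 l (lp_le (leq0n 1) (lp_edge xT yT xy)).
have A1F : A1 \subset F by apply/subsetP => v /A1P[]; rewrite in_setD => /andP[].
have conn1 x : x \in A1 -> lp (c |: A1) x c 0.
  move=> xA; have [xT xc l] := A1P x xA.
  have := lp_stay (lp_sym l) (T := c |: A1); rewrite in_setU1 xA orbT => /(_ isT) H.
  apply: lp_sub (H _); first exact: subsetIr.
  move=> x' y'; rewrite in_setU1 => /orP[/eqP->|x'A] xc' _ xy yT; first by rewrite eqxx in xc'.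
  by apply: clo1 x'A _ xy; move: yT; rewrite in_setD => /andP[].
have lowT : seg s 0 j \subset T1.
  apply/subsetP => v; rewrite inE => /and3P[vs _ vj]; rewrite in_setD sF // andbT.
  have [->//|vc] := eqVneq v c; apply/negP => /A2P[z zr l].
  have vj' : index v s < j.
    by rewrite ltn_neqAle vj andbT; apply: contra_neq vc => E; rewrite /c -E nth_index.
  have := @lp_seg G u s 0 (index v s) sq us; rewrite index_mem vs nth_index //= => /(_ isT) l1.
  have : u \in A2; last by apply/negP/DA2.
  apply: (A2I u z zr); apply: lp_trans0 l (lp_sub _ (lp_sym l1)).
  apply/subsetP => y; rewrite inE => /and3P[ys _ yv]; rewrite in_setD1 sF // andbT.
  by apply: contraTneq (leq_ltn_trans yv vj') => ->; rewrite ic ltnn.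
have lcu : lp T1 c u 0.
  have := @lp_seg G u s 0 j sq us; rewrite szs ltnS (ltnW jL) /= => /(_ isT) l1.
  exact: lp_sub lowT (lp_le (leq0n _) (lp_sym l1)).
have DA1 : {subset D <= c |: A1}.
  move=> v vD; have [->|vc] := eqVneq v c; first by rewrite in_setU1 eqxx.
  rewrite in_setU1 A1I ?orbT //.
  have [<-//|uv] := eqVneq u v; apply: lp_trans0 lcu (lp_sub _ (arc_lp cD uDin vD uv)).
  by apply/subsetP => x; rewrite inE => xD; rewrite in_setD DA2 //= (D_F HD).
exists A1, A2, c; split.
- by split; split => //; rewrite inE eqxx andbF.
- by split; split.
- split => //.
  + by apply/pred0P => v /=; apply/negP => /andP[/A1P[]]; rewrite in_setD => /andP[/negP].
  + by rewrite inE eqxx andbF.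
  + by apply: lp_refl; rewrite in_setD in_setU cF negb_or cA2 inE eqxx andbF.
- move=> z zS; have [tz Hj] := Hz z zS; have l := Hj j jt.
  by apply: lp_sub segA (lp_le _ (lp_sym l)); move: dL jt; clear; lia.
Qed.

End Contract.
End DenseSide.

(** * A small cluster together with k - 1 links of D *)

Lemma small_cluster_numeric (k mu h d : nat) : 1 < k -> k <= h -> mu < h -> h < 2 * d ->
  d <= maxn (k - 2) mu ->
  k * (mu + 2) <= k.-1 * (1 + uphalf h) + (1 + d) * (k + mu - d).
Proof.
move=> k1 kh mh hd; have : h <= 2 * uphalf h by rewrite uphalf_half; lia.
have nd : uphalf h <= d by rewrite uphalf_half; lia.
move: (uphalf h) nd => n nd hn dM.
have [dm|md] := leqP d mu.
  (* Truncated differences are replaced by sums with new variables, which makes the inequality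
     polynomial over the naturals. *)
  pose i := mu - d; have [-> ni] : mu = d + i /\ i < n by rewrite /i; lia.
  have [j ->] : exists j, n = i + 1 + j by exists (n - i - 1); lia.
  have -> : k + (d + i) - d = k + i by lia.
  have [r Er] : exists r, k = r + 2 by exists (k - 2); lia.
  rewrite Er; have -> : (r + 2).-1 = r + 1 by lia.
  by nia.
have dk : d <= k - 2 by move: dM; rewrite /maxn; case: ifP; lia.
have [j Ek] : exists j, k = d + 2 + j by exists (k - 2 - d); lia.
have jn : j + 2 <= n by lia.
have [r ->] : exists r, n = j + 2 + r by exists (n - j - 2); lia.
have [p Ed] : exists p, d = mu + 1 + p by exists (d - mu - 1); lia.
have -> : k + mu - d = 2 + j + mu by lia.
have -> : k.-1 = d + 1 + j by lia.
by rewrite Ek Ed; nia.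
Qed.

Section SmallCluster.
Variables (G : sgraph) (C D : seq G).
Implicit Types (S : {set G}) (x y u w c : G).
Notation e := (@adj G).
Notation F := (off_cycle C).
Notation SC := [set x in C].
Hypothesis HC : longest_in setT C.
Hypothesis HD : longest_in F D.
Let cC : is_cycle C. Proof. by case: HC. Qed.
Let uC : uniq C. Proof. exact: is_cycle_uniq. Qed.
Let cD : is_cycle D. Proof. by case: HD. Qed.
Variables k mu : nat.
Hypothesis k1 : 1 < k.
Hypothesis kh : k <= size D.
Hypothesis mh : mu < size D.
Hypothesis deg : forall x, k + mu <= #|[set y | e x y]|.
Hypothesis conn : connected_avoiding G k.

(** A link end of [D] weighs [1 + n], an attachment of the cluster weighs [cweight]. Points of
    different kinds are at least [n + d + 2] apart, since paths through the two sides are joined at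
    the cut vertex. *)
Lemma small_cluster u q d S a t : cluster C D u q d S a -> lollipop u q d S t ->
  d <= maxn (k - 2) mu -> k * (mu + 2) <= size C.
Proof.
move=> cl ll dM; have [A1 [A2 [c [sd1 sd2 ap lz]]]] := dense_side HD cl ll.
have hC := size_D_C HC HD.
have [|W1 [lu [zz [Lw [xQ [Q [lk cW]]]]]]] := side_links HC conn sd1 kh (leq_trans kh hC); first by move: k1; clear; lia.
have [_ [_ _ _ DA]] := sd1.
have WC1 : {subset W1 <= C} by case: lk.
pose n := uphalf (size D).
pose om w := (w \in W1) * (1 + n) + cweight S w.
pose W := [set w in C | 0 < om w].
have WC : {subset W <= C} by move=> w; rewrite inE => /andP[].
have [hd dh] : size D < 2 * d /\ d < size D by case: cl => _ [[]].
have cS : #|S| = d by case: cl => _ [_ []].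
have d0 : 0 < d by move: hd; clear; lia.
have tot : \sum_(w in W) om w = k.-1 * (1 + n) + \sum_(w in SC) cweight S w.
  have -> : k.-1 * (1 + n) = \sum_(w in SC) (w \in W1) * (1 + n).
    rewrite -big_distrl /= -cW -sum1_card; congr (_ * _).
    rewrite big_mkcond [RHS]big_mkcond; apply: eq_bigr => w _; rewrite inE.
    by case: ifP => [/WC1->//|]; case: (w \in C).
  rewrite -big_split /= big_mkcond [RHS]big_mkcond; apply: eq_bigr => w _.
  by rewrite !inE; case: (w \in C) => //=; case: posnP.
have tS := cluster_total cS d0 (fun s sS => cluster_deg deg cl sS).
have W_1 : 1 < #|W|.
  have [s sS] : exists s, s \in S by apply/card_gt0P; rewrite cS.
  have : 1 < #|nb SC s|.
    apply: leq_trans (cluster_deg deg cl sS); move: dM k1 kh mh dh; clear; rewrite /maxn; case: ifP; lia.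
  move=> /leq_trans; apply; apply/subset_leq_card/subsetP => w; rewrite !inE => /andP[-> sw] /=.
  rewrite addn_gt0 cweight_gt0; apply/orP; right.
  by apply/card_gt0P; exists s; rewrite inE sS adj_sym.
have far2 w : 0 < natt S w -> far A2 c w d.
  by move=> /card_gt0P[s]; rewrite inE => /andP[sS ws]; exists s => //; apply: lz.
have far1 w : w \in W1 -> far A1 c w n by apply: side_linkage_far cD DA lk.
have := @weight_bound _ C uC W WC W_1 om 2; rewrite -big_distrl /= tot.
move=> H; suff {H}/H : forall w, w \in W -> om w + om (nextin C W w) <= 2 * cdist C w (nextin C W w).
  have := small_cluster_numeric k1 kh mh hd dM; move: tS; rewrite -/n /cweight.
  by clear; nlia.
move=> w wW; have [nW nw _] := nextinP C W_1 wW; move: (nextin C W w) nW nw => w' w'W w'w.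
have wC := WC _ wW; have w'C := WC _ w'W; rewrite eq_sym in w'w.
move: wW w'W; rewrite !inE wC w'C /= !addn_gt0 !cweight_gt0 /om /cweight.
have b1 := cluster_natt w cl; have b2 := cluster_natt w' cl.
have g1 := cluster_same HC cl wC w'C w'w.
have g2 : w \in W1 -> w' \in W1 -> n + 2 <= cdist C w w'.
  by move=> h1 h2; exact: (side_linkage_gap HC sd1 lk h1 h2 w'w).
have g3 : w \in W1 -> 0 < natt S w' -> n + d + 2 <= cdist C w w'.
  move=> h1 h2; exact: proj1 (far_gap2 HC sd1 sd2 ap wC w'C w'w (far1 w h1) (far2 w' h2)).
have g4 : 0 < natt S w -> w' \in W1 -> n + d + 2 <= cdist C w w'.
  move=> h2 h1; rewrite eq_sym in w'w.
  exact: proj2 (far_gap2 HC sd1 sd2 ap w'C wC w'w (far1 w' h1) (far2 w h2)).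
case: (posnP (natt S w)) g1 g4 => [->|n1] g1 g4; case: (posnP (natt S w')) g1 g3 => [->|n2] g1 g3 //=;
case: (w \in W1) g2 g3 => g2 g3 //=; case: (w' \in W1) g2 g4 => g2 g4 //= _ _;
rewrite ?mul0n ?mul1n ?addn0 ?add0n.
all: try (have {}g1 := g1 isT isT); try (have {}g2 := g2 isT isT); try (have {}g3 := g3 isT isT); try (have {}g4 := g4 isT isT).
all: nlia.
Qed.

End SmallCluster.

(** * End blocks and long paths from their cut vertices *)

Section EndBlock.
Variable G : sgraph.
Implicit Types (I X : {set G}) (x y z c : G).
Notation e := (@adj G).

(** [c'] cuts [I] off from the rest of [c |: X]; a minimal [I] plays the part of an end block
    without its cut vertex. *)
Definition end_closed X c I c' := [/\ I != set0, I \subset X, c' \in c |: X, c' \notin I &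
  forall x y, x \in I -> y \in c |: X -> e x y -> y \in c' |: I].

(** A component of [I] is again cut off by [c']. If [c'] had no neighbour in [I], a vertex of [I]
    could take its place as the cut vertex and leave a smaller set. *)
Lemma minimal_end_connected X c I c' : end_closed X c I c' -> c \notin X ->
  (forall x, x \in X -> 0 < #|nb (c |: X) x|) ->
  (forall I2 c2, end_closed X c I2 c2 -> #|I| <= #|I2|) ->
  {in I &, forall x y, lp I x y 0} /\ exists2 y, y \in I & e c' y.
Proof.
move=> [I0 IX cX cI clo] nc deg mn; split=> [x y xI yI|].
  pose Z := [set v in I | connect (fun a b => e a b && (b \in I)) x v].
  have ZI : Z \subset I by apply/subsetP => v; rewrite inE => /andP[].
  have lpZ v : v \in Z -> lp I x v 0 by rewrite inE => /andP[_ cv]; apply: connect_lp.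
  suff : Z = I by move=> E; apply: lpZ; rewrite E.
  apply/eqP; rewrite eqEcard ZI; apply: (mn _ c'); split; first 1 last.
  - exact: subset_trans ZI IX.
  - exact: cX.
  - by apply: contra cI => /(subsetP ZI).
  - move=> u v uZ vX uv; have := clo u v (subsetP ZI _ uZ) vX uv.
    rewrite !in_setU1 => /orP[->//|vI]; apply/orP; right; rewrite inE vI.
    apply: lp_connect; apply: lp_trans0 (lpZ u uZ) (lp_le (leq0n 1) (lp_edge _ vI uv)).
    exact: subsetP ZI _ uZ.
  - by apply/set0Pn; exists x; rewrite inE xI connect0.
apply: NNPP => no; have [x xI] := set0Pn _ I0.
have [y] := card_gt0P (deg x (subsetP IX _ xI)); rewrite inE => /andP[yX xy].
have := clo x y xI yX xy; rewrite in_setU1 => /orP[/eqP E|yI].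
  by apply: no; exists x => //; rewrite -E adj_sym.
have : #|I| <= #|I :\ x|; last by rewrite (cardsD1 x I) xI ltnn.
apply: (mn _ x); split.
- by apply/set0Pn; exists y; rewrite in_setD1 yI eq_sym (adj_neq xy).
- exact: subset_trans (subD1set _ _) IX.
- by rewrite in_setU1 (subsetP IX) ?orbT.
- by rewrite in_setD1 eqxx.
- move=> u v; rewrite in_setD1 => /andP[ux uI] vX uv; rewrite setD1K //.
  have := clo u v uI vX uv; rewrite in_setU1 => /orP[/eqP E|//].
  by case: no; exists u => //; rewrite -E adj_sym.
Qed.

(** Induction on [r]: inside a minimal [I], the target [z] replaces [c'] as the cut vertex, which
    lowers degrees by at most one. The smaller end block found in [I :\ z] is adjacent to [c'] by
    minimality of [I]; the path enters it from [c'], runs to its cut vertex [c2] and goes on to [z]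
    outside it. *)
Lemma end_block r X c : 0 < r -> X != set0 -> c \notin X -> (forall x, x \in X -> r <= #|nb (c |: X) x|) ->
  exists I c', end_closed X c I c' /\ forall z, z \in I -> lp (c' |: I) c' z r.
Proof.
elim: r X c => // r IH X c _ X0 cX deg.
have [|I [c' clo] mn0] := @ex_min {set G} (fun I => exists c', end_closed X c I c') (fun I => #|I|).
  by exists X, c; split; rewrite ?in_setU1 ?eqxx.
have mn I2 c2 : end_closed X c I2 c2 -> #|I| <= #|I2| by move=> h; apply: mn0; exists c2.
have deg1 x : x \in X -> 0 < #|nb (c |: X) x| by move=> /deg; apply: leq_trans.
have [con [y0 y0I cy0]] := minimal_end_connected clo cX deg1 mn.
exists I, c'; split => // z zI; have [I0 IX c'X cI clo'] := clo.
have c'z x : x \in I -> x != c' by move=> xI; apply: contraNneq cI => <-.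
case: r IH deg => [|r] IH deg.
  have [<-|y0z] := eqVneq y0 z.
    apply: lp_edge cy0; first by rewrite in_setU1 eqxx.
    by rewrite in_setU1 y0I orbT.
  exact: lp_cons cI cy0 (con _ _ y0I zI).
have [||||I2 [c2 [[I20 I2X c2X c2I clo2] long]]] := IH (I :\ z) z => //.
- have := deg z (subsetP IX _ zI) => h.
  have : 1 < #|nb (c |: X) z| by apply: leq_trans h.
  rewrite (cardsD1 c') => h2; have /card_gt0P[y] : 0 < #|nb (c |: X) z :\ c'|.
    by move: h2; case: (c' \in _); clear; lia.
  rewrite !inE => /and3P[yc yX zy]; apply/set0Pn; exists y; rewrite in_setD1 eq_sym (adj_neq zy) /=.
  by have := clo' z y zI; rewrite !in_setU1 (negPf yc); apply.
- by rewrite in_setD1 eqxx.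
- move=> x; rewrite in_setD1 => /andP[xz xI]; rewrite setD1K //.
  have := deg x (subsetP IX _ xI); rewrite (cardsD1 c') => h.
  apply: leq_trans (_ : #|nb (c |: X) x :\ c'| <= _); first by move: h; case: (c' \in _); clear; lia.
  apply/subset_leq_card/subsetP => y; rewrite !inE => /and3P[yc yX xy]; rewrite xy andbT.
  by have := clo' x y xI; rewrite !in_setU1 (negPf yc); apply.
rewrite setD1K // in c2X clo2.
have I2I : I2 \subset I by apply: subset_trans I2X (subD1set _ _).
have zI2 : z \notin I2 by apply/negP => /(subsetP I2X); rewrite in_setD1 eqxx.
have [y yI2 cy] : exists2 y, y \in I2 & e c' y.
  apply: NNPP => no.
  have : #|I| <= #|I2|.
    apply: (mn _ c2); split => //; first exact: subset_trans I2I IX.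
      by rewrite in_setU1 (subsetP IX) ?orbT.
    move=> u v uI vX uv; have := clo' u v (subsetP I2I _ uI) vX uv.
    rewrite in_setU1 => /orP[/eqP E|vI]; last exact: clo2 uI vI uv.
    by case: no; exists u => //; rewrite -E adj_sym.
  by apply/negP; rewrite -ltnNge; apply: proper_card; apply/properP; split => //; exists z.
have l1 : lp (I :&: ~: I2) z c2 0.
  apply: lp_stay (con _ _ zI c2X) _ _; first by rewrite inE.
  move=> u v; rewrite !in_setC => uI2 uc uI uv vI; apply/negP => vI2.
  by have := clo2 v u vI2 uI (adjC uv); rewrite in_setU1 (negPf uc) (negPf uI2).
have l2 : lp (c2 |: I2 :|: I :&: ~: I2) y z (r.+1 + 0).
  apply: lp_cat (lp_sym (long y yI2)) (lp_sym l1) _ => v.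
  by rewrite in_setU1 => /orP[/eqP//|vI2]; rewrite inE in_setC vI2 andbF.
have sub : c2 |: I2 :|: I :&: ~: I2 \subset I.
  by rewrite !subUset sub1set c2X I2I subsetIl.
by have := lp_cons cI cy (lp_sub sub l2); rewrite addn0.
Qed.

End EndBlock.

(** * Shrinking a side *)

Section Shrink.
Variables (G : sgraph) (C : seq G).
Implicit Types (A B I S X T : {set G}) (x y z u v w c : G) (R : seq G).
Notation e := (@adj G).
Notation F := (off_cycle C).

(** A path that starts outside [I] could enter it only from [v], which is its end. *)
Lemma lp_avoid B I x v : lp B x v 0 -> x \notin I ->
  (forall a b, a \in I -> b \in B -> e a b -> b \in v |: I) -> lp (B :\: I) x v 0.
Proof.
move=> l xI H; rewrite setDE; apply: lp_stay => //; first by rewrite in_setC.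
move=> a b; rewrite !in_setC => aI av aB ab _; apply/negP => bI.
by have := H b a bI aB (adjC ab); rewrite in_setU1 (negPf av) (negPf aI).
Qed.

Lemma far_of_paths A c R w (SS : {set G}) (f : G -> seq G) : side C A c R -> w \in C ->
  SS = [set c; w] ->
  (forall a, a \in SS -> [/\ path e a (f a), uniq (a :: f a), last a (f a) \in R
     & {subset a :: f a <= w |: (c |: A)}]) ->
  (forall a, a \in SS -> {in f a, forall v, v \notin [set c; w]} /\
     {in belast a (f a), forall v, v \notin R}) ->
  (forall a a' v, a \in SS -> a' \in SS -> v \in a :: f a -> v \in a' :: f a' -> a = a') ->
  far A c w (uphalf (size R)).
Proof.
move=> [[AF cF cA] [clo toc cR RA]] wC ES Hf Hn dis.
have wF : w \notin F by rewrite inF wC.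
have wcA : w \notin c |: A.
  by rewrite in_setU1 negb_or; apply/andP; split; [apply: contraNneq wF => -> | apply: contra wF => /(subsetP AF)].
have cw : c != w by apply: contraNneq wF => <-.
have cS : c \in SS by rewrite ES !inE eqxx.
have wS : w \in SS by rewrite ES !inE eqxx orbT.
have [p1 u1 l1 s1] := Hf _ cS; have [p2 u2 l2 s2] := Hf _ wS.
have [n1 m1] := Hn _ cS; have [n2 m2] := Hn _ wS.
case E : (f w) p2 u2 l2 s2 n2 m2 => [|z p] p2 u2 l2 s2 n2 m2.
  by have := RA _ l2; rewrite (negPf wcA).
have [wz pz] : e w z /\ path e z p by move: p2 => /= /andP[].
have uz : uniq (z :: p) by case/andP: u2.
exists z => //.
set r := last z p in l2; set r' := last c (f c) in l1.
have rr : r != r'.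
  apply/negP => /eqP Er; have : c = w; last by move/eqP: cw.
  apply: (dis c w r') => //; first exact: mem_last.
  by rewrite -Er E /= inE mem_last orbT.
have la := path_lp pz uz; have lb := path_lp p1 u1.
have lR := half_arc cR l2 l1 rr.
have lc : lp ([set v in z :: p] :|: [set v in R]) z r' (0 + uphalf (size R)).
  apply: lp_cat (lp_le (leq0n _) la) lR _ => v; rewrite !inE -in_cons => vp vR.
  move: vp; rewrite lastI mem_rcons in_cons => /orP[/eqP//|vb].
  by have := m2 v; rewrite /= inE vb orbT vR => /(_ isT).
have ld := lp_cat lc (lp_le (leq0n _) (lp_sym lb)).
apply: lp_sub (lp_le (n := 0 + uphalf (size R) + 0) _ (ld _)); last 1 first.
- move=> v; rewrite in_setU !inE -!in_cons => /orP[vp|vR] vf.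
    have : c = w; last by move/eqP: cw.
    by apply: (dis c w v) => //; rewrite E inE vp orbT.
  move: vf; rewrite lastI mem_rcons in_cons => /orP[/eqP//|vb].
  by have := m1 v vb; rewrite vR.
- have dropw v : v \in w |: (c |: A) -> v != w -> v \in c |: A by rewrite in_setU1 => /orP[->|].
  apply/subsetP => v; rewrite !in_setU => /orP[/orP[|]|]; rewrite inE -?in_setU.
  + move=> vp; apply: dropw; first by apply: s2; rewrite inE vp orbT.
    by apply: contraTneq vp => ->; case/andP: u2.
  + exact: RA.
  + move=> vf; apply: dropw; first exact: s1.
    move: vf; rewrite inE => /orP[/eqP->//|/n1]; by rewrite !inE negb_or => /andP[].
- by rewrite add0n addn0.
Qed.

(** Two disjoint paths from [c] and [w] to [R] would make [w] far, so by Menger's theorem one vertex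
    [v] separates both from [R]. What [R] reaches in the side without [v] is a side with cut vertex
    [v], and it misses [x]. *)
Lemma shrink_side A c R w x : side C A c R -> w \in C -> x \in A -> e w x ->
  ~ far A c w (uphalf (size R)) ->
  exists A' v, [/\ side C A' v R, A' \proper A, v \in c |: A & lp ((c |: A) :\: A') c v 0].
Proof.
move=> sd wC xA wx nf; have [[AF cF cA] [clo toc cR RA]] := sd.
have R0 : exists r, r \in R by case: (R) cR => // r R' _; exists r; rewrite mem_head.
have lRc r : r \in R -> lp (c |: A) r c 0.
  by move=> /RA; rewrite in_setU1 => /orP[/eqP->|/toc//]; apply/lp_refl; rewrite in_setU1 eqxx.
have wF : w \notin F by rewrite inF wC.
have wcA : w \notin c |: A.
  by rewrite in_setU1 negb_or; apply/andP; split; [apply: contraNneq wF => -> | apply: contra wF => /(subsetP AF)].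
have cw : c != w by apply: contraNneq wF => <-.
have [X [cX no]] : exists X, #|X| < 2 /\
    ~ exists a b, [/\ a \in [set c; w], b \in [set x in R] & lp ((w |: (c |: A)) :\: X) a b 0].
  apply: NNPP => H; apply: nf.
  have [X cX|S [f [[SS cS] h1 h2 h3]]] := @inner_linkage G (w |: (c |: A)) [set c; w] [set x in R] 2.
    by apply: NNPP => no; apply: H; exists X.
  apply: (@far_of_paths A c R w S f sd wC).
  - by apply/eqP; rewrite eqEcard SS cS cards2 cw.
  - by move=> a /h1[q1 q2 q3 q4]; split => //; move: q3; rewrite inE.
  - move=> a /h2[q1 q2]; split => // v /q2; by rewrite inE.
  - exact: h3.
(* As [c] is joined to [R] inside [c |: A], the separating set has a vertex there. *)
have [v vX] : exists2 v, v \in c |: A & X = [set v].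
  have [r rR] := R0; have lrc := lRc r rR.
  have [v vX vA] : exists2 v, v \in X & v \in c |: A.
    apply: NNPP => H; apply: no; exists c, r; split; rewrite ?inE ?eqxx //.
    apply: lp_sub (lp_sym lrc); apply/subsetP => y yA; rewrite in_setD in_setU yA orbT andbT.
    by apply/negP => yX; apply: H; exists y.
  exists v => //; apply/esym/eqP; rewrite eqEcard sub1set vX cards1 -ltnS.
  exact: cX.
move=> vX'; rewrite {}vX' in no; clear X cX.
have noc b : b \in R -> lp ((c |: A) :\ v) c b 0 -> False.
  move=> bR l; apply: no; exists c, b; rewrite !inE eqxx; split => //.
  by apply: lp_sub l; apply/setSD/subsetUr.
pose T := (c |: A) :\ v.
pose A' := [set y in T | [exists r in R, (r \in T) && connect (fun a b => e a b && (b \in T)) r y]].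
have A'P y : y \in A' -> exists2 r, r \in R & lp T r y 0.
  rewrite inE => /andP[yT /existsP[r /and3P[rR rT cr]]]; exists r => //; exact: connect_lp.
have A'I r y : r \in R -> lp T r y 0 -> y \in A'.
  move=> rR l; have [rT yT] := lp_in l; rewrite inE yT; apply/existsP; exists r.
  by rewrite rR rT; apply: lp_connect l.
have A'T : A' \subset T by apply/subsetP => y; rewrite inE => /andP[].
have cA' : c \notin A' by apply/negP => /A'P[r rR /lp_sym]; apply: noc.
have A'A : A' \subset A.
  apply/subsetP => y yA'; have := subsetP A'T _ yA'; rewrite in_setD1 in_setU1 => /andP[_ /orP[/eqP E|//]].
  by rewrite -E yA' in cA'.
have vA' : v \notin A' by apply/negP => /(subsetP A'T); rewrite in_setD1 eqxx.
have wv : w != v by apply: contraNneq wcA => ->.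
have xA' : x \notin A'.
  apply/negP => /A'P[r rR l]; apply: no; exists w, r; rewrite !inE eqxx orbT; split => //.
  apply: lp_le (leq0n 1) _.
  apply: lp_sub (lp_cons _ wx (lp_sym l)); last first.
    by apply: contra wcA; rewrite in_setD1 => /andP[].
  rewrite subUset sub1set in_setD1 in_setU1 eqxx wv /=; exact/setSD/subsetUr.
have clo' y z : y \in A' -> z \in F -> e y z -> z \in v |: A'.
  move=> yA' zF yz; have [->|zv] := eqVneq z v; first by rewrite in_setU1 eqxx.
  have zT : z \in T by rewrite in_setD1 zv (clo y) // (subsetP A'A).
  have [r rR l] := A'P y yA'; rewrite in_setU1 (A'I r) ?orbT //.
  by apply: lp_trans0 l (lp_le (leq0n 1) (lp_edge _ zT yz)); apply: subsetP A'T _ yA'.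
have cAF : c |: A \subset F by apply: side_F sd.
exists A', v; split => //.
- split; split => //.
  + exact: subset_trans A'A AF.
  + exact: subsetP cAF _ vX.
  + move=> y yA'; have yA := subsetP A'A _ yA'.
    have [z zT l] := lp_hit (T := [pred u | u \notin A']) (toc y yA) cA'.
    have l2 : lp (z |: A') y z 0.
      apply: lp_sub l; apply/subsetP => u; rewrite in_setD in_setU1 => /andP[+ _].
      by rewrite !inE; case: (u =P z) => //= _; rewrite andbT negbK.
    have yz : y != z by apply: contraNneq zT => <-.
    have [u zu lu] := lp_uncons zT yz (lp_sym l2).
    have [uA' _] := lp_in lu; have [_ zD] := lp_in l.
    have zF : z \in F by apply: subsetP cAF _ _; move: zD; rewrite in_setD => /andP[].
    have := clo' u z uA' zF (adjC zu); rewrite in_setU1 (negPf zT) orbF => /eqP E.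
    by rewrite -E.
  + move=> r rR; have [->|rv] := eqVneq r v; first by rewrite in_setU1 eqxx.
    by rewrite in_setU1 (A'I r) ?orbT //; apply: lp_refl; rewrite in_setD1 rv RA.
- by apply/properP; split => //; exists x.
- have lcv : lp (c |: A) c v 0.
    move: vX; rewrite in_setU1 => /orP[/eqP->|/toc/lp_sym//]; by apply: lp_refl; rewrite in_setU1 eqxx.
  by apply: lp_avoid lcv cA' _ => a b aA' /(subsetP cAF); apply: clo'.
Qed.

Lemma shrink_apart A c A2 c2 A' v : apart C A c A2 c2 -> A' \subset A -> v \in c |: A ->
  c |: A \subset F -> lp ((c |: A) :\: A') c v 0 -> apart C A' v A2 c2.
Proof.
move=> [dA cA2 c2A lJ] A'A vA cAF lcv.
have dA2 u : u \in c |: A -> u \notin A2.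
  rewrite in_setU1 => /orP[/eqP->//|uA]; apply/negP => uA2; exact: disjP dA uA uA2.
split.
- exact: disjointWl A'A dA.
- exact: dA2.
- by apply: contra c2A; apply: subsetP.
- apply: lp_trans0 (lp_sub _ (lp_sym lcv)) (lp_sub _ lJ).
  + apply/subsetP => u; rewrite in_setD => /andP[uA' uA]; rewrite in_setD (subsetP cAF) // andbT.
    by rewrite in_setU negb_or uA' dA2.
  + exact/setDS/setSU.
Qed.

End Shrink.

(** * Counting spread vertices on a cycle *)

Section Spread.
Variables (T : finType) (s : seq T).
Hypothesis us : uniq s.
Implicit Types (U W : {set T}) (w : T).

Lemma spread_bound U g : {subset U <= s} -> 1 < #|U| ->
  (forall w w', w \in U -> w' \in U -> w != w' -> g <= cdist s w w') -> #|U| * g <= size s.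
Proof.
move=> Us U1 H; apply: leq_trans (nextin_sum us Us U1).
rewrite -sum_nat_const; apply: leq_sum => w wU; have [nU nw _] := nextinP s U1 wU.
by apply: H => //; rewrite eq_sym.
Qed.

(** [P] is neither empty nor all of [U], so at least one step leaves it. *)
Lemma inner_steps U (P : {set T}) : {subset U <= s} -> 1 < #|U| -> P \subset U ->
  P != set0 -> (exists2 w, w \in U & w \notin P) ->
  \sum_(w in U) ((w \in P) && (nextin s U w \in P)) < #|P|.
Proof.
move=> Us U1 PU P0 out.
have [|w [wU wP nP]] := @nextin_change T s U Us U1 (mem P) _ out.
  by have [w wP] := set0Pn _ P0; exists w => //; apply: subsetP PU _ wP.
have -> : \sum_(w in U) ((w \in P) && (nextin s U w \in P)) = #|[set w in P | nextin s U w \in P]|.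
  rewrite -sum1_card big_mkcond [RHS]big_mkcond; apply: eq_bigr => v _; rewrite inE.
  case: (boolP (v \in P)) => [vP|]; last by case: ifP.
  by rewrite (subsetP PU) //; case: ifP.
apply: proper_card; apply/properP; split; first by apply/subsetP => v; rewrite inE => /andP[].
by exists w => //; rewrite inE negb_and; apply/orP; right.
Qed.

(** Only steps inside [W1 :\: W2] or inside [W2 :\: W1] may be short, each losing [g]. If these
    differences have [p] elements, each contains fewer than [p] such steps, while the union has [p]
    elements more than [W1]; the balance is [#|W1| + 1] full gaps. *)
Lemma two_class_bound W1 W2 g : {subset W1 <= s} -> {subset W2 <= s} ->
  #|W1| = #|W2| -> W1 != W2 ->
  (forall w w', w \in W1 -> w' \in W1 -> w != w' -> g + 2 <= cdist s w w') ->
  (forall w w', w \in W2 -> w' \in W2 -> w != w' -> g + 2 <= cdist s w w') ->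
  (forall w w', w \in W1 -> w' \in W2 -> w != w' ->
     g + g + 2 <= cdist s w w' /\ g + g + 2 <= cdist s w' w) ->
  #|W1|.+1 * (g + g + 2) <= size s.
Proof.
move=> W1s W2s cW nW g1 g2 g12.
pose U := W1 :|: W2; pose P := W1 :\: W2; pose Q := W2 :\: W1.
have cP := cardsID W2 W1; have cQ := cardsID W1 W2; rewrite -/P in cP; rewrite -/Q in cQ.
have PQ : #|P| = #|Q|.
  by move: cP cQ; rewrite setIC cW => <- /eqP; rewrite eqn_add2l => /eqP.
have P0 : P != set0.
  apply: contra_neq nW => /eqP; rewrite setD_eq0 => sW.
  by apply/eqP; rewrite eqEcard sW cW leqnn.
have Q0 : Q != set0 by rewrite -card_gt0 -PQ card_gt0.
have cU : #|U| = #|W1| + #|P|.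
  by have := cardsUI W1 W2; rewrite -/U; move: cP cQ PQ; rewrite (setIC W2); clear; nlia.
have Us : {subset U <= s} by move=> w; rewrite in_setU => /orP[/W1s|/W2s].
have PU : P \subset U by apply/subsetP => w; rewrite in_setD in_setU => /andP[_ ->].
have QU : Q \subset U by apply/subsetP => w; rewrite in_setD in_setU => /andP[_ ->]; rewrite orbT.
have [p pP] := set0Pn _ P0; have [q qQ] := set0Pn _ Q0.
have pq : p != q.
  apply/negP => /eqP E; move: pP qQ; rewrite E !in_setD => /andP[/negP h _] /andP[_ h']; exact: h.
have U1 : 1 < #|U|.
  apply: leq_trans (_ : #|[set p; q]| <= _); first by rewrite cards2 pq.
  by apply/subset_leq_card; rewrite subUset !sub1set (subsetP PU) ?(subsetP QU).
have out1 : exists2 w, w \in U & w \notin P.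
  exists q; first exact: subsetP QU _ qQ.
  by move: qQ; rewrite !in_setD => /andP[_ ->].
have out2 : exists2 w, w \in U & w \notin Q.
  exists p; first exact: subsetP PU _ pP.
  by move: pP; rewrite !in_setD => /andP[_ ->].
have b1 := inner_steps Us U1 PU P0 out1; have b2 := inner_steps Us U1 QU Q0 out2.
have tot := nextin_sum us Us U1.
have : \sum_(w in U) (g + g + 2) <= \sum_(w in U) cdist s w (nextin s U w) +
   g * \sum_(w in U) ((w \in P) && (nextin s U w \in P)) +
   g * \sum_(w in U) ((w \in Q) && (nextin s U w \in Q)).
{ rewrite !big_distrr -!big_split /=; apply: leq_sum => w wU.
  have [nU nw _] := nextinP s U1 wU; move: (nextin s U w) nU nw => w' w'U nw.
  have ww' : w != w' by rewrite eq_sym.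
  have h11 := g1 w w'; have h22 := g2 w w'; have h12 := g12 w w'; have h21 := g12 w' w.
  move: wU w'U; rewrite !in_setU !in_setD => wU w'U.
  move: h11 h22 h12 h21 wU w'U; rewrite ww' nw.
  case: (w \in W1); case: (w \in W2); case: (w' \in W1); case: (w' \in W2) => //= h1 h2 h3 h4 _ _.
  all: try (have {}h1 := h1 isT isT isT); try (have {}h2 := h2 isT isT isT).
  all: try (have [{}h3 _] := h3 isT isT isT); try (have [_ {}h4] := h4 isT isT isT).
  all: nlia. }
rewrite sum_nat_const cU; move: tot b1 b2; rewrite -PQ.
set a := \sum_(w in U) cdist _ _ _; set b := \sum_(w in U) _; set c := \sum_(w in U) _.
move: a b c #|P| #|W1| (size s); clear => a b c d x y h1 h2 h3 h4; nia.
Qed.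

End Spread.

(** * The bound from two sides *)

Section TwoSides.
Variables (G : sgraph) (C : seq G).
Implicit Types (A I X T W : {set G}) (x y z u v w c : G) (R : seq G).
Notation e := (@adj G).
Notation F := (off_cycle C).
Notation SC := [set x in C].
Hypothesis HC : longest_in setT C.
Let cC : is_cycle C. Proof. by case: HC. Qed.
Let uC : uniq C. Proof. exact: is_cycle_uniq. Qed.
Variables k mu : nat.
Hypothesis k1 : 1 < k.
Hypothesis kC : k <= size C.
Hypothesis deg : forall x, k + mu <= #|[set y | e x y]|.
Hypothesis conn : connected_avoiding G k.

Lemma far_le A c w m n : m <= n -> far A c w n -> far A c w m.
Proof. by move=> mn [z wz l]; exists z => //; apply: lp_le l. Qed.

(** With attachments only in [W], vertices of [A] keep [mu + 1] neighbours in the side, and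
    [end_block] gives paths with [mu + 1] edges. Each [w] is adjacent to the end block, since
    otherwise [c'] and the rest of [W] would separate it by fewer than [k] vertices. *)
Lemma attached_far A c R W : side C A c R -> 1 < size R -> {subset W <= C} -> #|W|.+1 = k ->
  (forall x w, x \in A -> w \in C -> e w x -> w \in W) ->
  forall w, w \in W -> far A c w mu.+1.
Proof.
move=> sd R1 WC cW att w wW; have [[AF cF cA] [clo toc cR RA]] := sd.
have uR := is_cycle_uniq cR.
have A0 : A != set0.
  apply/negP => /eqP E; have : #|[set v in R]| <= #|[set c]|.
    by apply/subset_leq_card/subsetP => v; rewrite inE => /RA; rewrite E setU0.
  by rewrite card_seq_set // cards1 leqNgt R1.
have degA x : x \in A -> mu.+1 <= #|nb (c |: A) x|.
  move=> xA; have := deg x; rewrite (degree_split C x) -cW.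
  have h1 : #|nb SC x| <= #|W|.
    apply/subset_leq_card/subsetP => v; rewrite !inE => /andP[vC xv].
    by apply: att xA vC _; rewrite adj_sym.
  have h2 : #|nb F x| <= #|nb (c |: A) x|.
    apply/subset_leq_card/subsetP => v; rewrite in_set => /andP[vF xv].
    by rewrite in_set xv andbT; apply: clo xv.
  by move: h1 h2; clear; nlia.
have [I [c' [[I0 IA c'A c'I cloI] long]]] := end_block (isT : 0 < mu.+1) A0 cA degA.
have cAF := side_F sd.
have wI : w \notin I by apply: contraTN (WC _ wW) => /(subsetP IA)/(subsetP AF); rewrite inF.
have wc' : w != c' by apply: contraTneq (WC _ wW) => ->; rewrite -inF; apply: subsetP cAF _ c'A.
have [z zI wz] : exists2 z, z \in I & e w z.
  apply: NNPP => no; have [x xI] := set0Pn _ I0.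
  have xc' : x != c' by apply: contraNneq c'I => <-.
  have := conn (X := c' |: W :\ w) (x := x) (y := w).
  have -> : #|c' |: W :\ w| < k.
    rewrite -cW ltnS; apply: leq_trans (_ : (c' \notin W :\ w) + #|W :\ w| <= _); first by rewrite cardsU1.
    by rewrite (cardsD1 w W) wW leq_add2r; case: (_ \notin _).
  have xW : x \notin W by apply/negP => /WC; have := subsetP AF _ (subsetP IA _ xI); rewrite inF => /negP.
  rewrite !in_setU1 !in_setD1 (negPf xc') (negPf xW) (negPf wc') eqxx andbF => /(_ isT isT isT) l.
  suff lI : lp (~: (c' |: W :\ w) :&: I) x w 0 by have [_] := lp_in lI; rewrite in_setI (negPf wI) andbF.
  apply: lp_stay l xI _ => u v uI _ _ uv; rewrite in_setC in_setU1 in_setD1 !negb_or => /andP[vc' vW].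
  have uA := subsetP IA _ uI.
  have [vF|vF] := boolP (v \in F).
    have := cloI u v uI (clo u v uA vF uv) uv; by rewrite in_setU1 (negPf vc').
  rewrite inF negbK in vF; have vw := att u v uA vF (adjC uv).
  by move: vW; rewrite vw andbT negbK => /eqP E; case: no; exists u => //; rewrite -E adj_sym.
have ll := long z zI; exists z => //.
have lcc' : lp (c |: A) c c' 0.
  move: c'A; rewrite in_setU1 => /orP[/eqP->|/toc/lp_sym//].
  by apply: lp_refl; rewrite in_setU1 eqxx.
have cI : c \notin I by apply: contra cA; apply: subsetP.
have l2 := lp_avoid lcc' cI (fun a b aI bA => cloI a b aI bA).
have l3 : lp (c' |: I :|: (c |: A) :\: I) z c (mu.+1 + 0).
  apply: lp_cat (lp_sym ll) (lp_sym l2) _ => v; rewrite in_setU1 => /orP[/eqP//|vI].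
  by rewrite in_setD vI.
rewrite addn0 in l3; apply: lp_sub l3; rewrite !subUset sub1set c'A (subset_trans IA (subsetUr _ _)) /=.
exact: subsetDl.
Qed.

(** The cut vertex reaches [C] without [w0], and by a path avoiding [A], whose only attachment is
    [w0]. This gives a second point of [C] with gap [n + 2] in both directions. *)
Lemma exit_gap A c R w0 n : side C A c R -> w0 \in C -> far A c w0 n ->
  (forall x w, x \in A -> w \in C -> e w x -> w = w0) ->
  2 * (n + 2) <= size C.
Proof.
move=> sd w0C [z wz l] att; have [[AF cF cA] [clo toc cR RA]] := sd.
have C1 : 1 < size C by apply: leq_trans kC.
have [w' w'C ww'] : exists2 w', w' \in C & w' != w0.
  have [|x xS x0] := @not_covered G SC [set w0]; first by rewrite cards1 card_seq_set.
  by rewrite !inE in xS x0; exists x.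
have cw0 : c \notin [set w0] by rewrite inE; apply: contraTneq cF => ->; rewrite inF w0C.
have [|||w1 w1C l1] := lp_hit (T := mem SC) (conn (X := [set w0]) (x := c) (y := w') _ cw0 _).
- by rewrite cards1.
- by rewrite inE.
- by rewrite inE.
have w1F : w1 \notin F by rewrite inF; move: w1C; rewrite inE => ->.
have [_ w1D] := lp_in l1; have w10 : w1 != w0 by move: w1D; rewrite !inE => /andP[].
rewrite inE in w1C.
have l2 : lp (w1 |: F) w1 c 0.
  apply: lp_sub (lp_sym l1); apply/subsetP => v; rewrite in_setD in_setU1 inE negb_and negbK inE inF.
  by case: eqP => //= _ /andP[]; rewrite orbF.
have cw1 : c != w1 by apply: contraNneq w1F => <-.
have [z1 wz1 l3] := lp_uncons w1F cw1 l2.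
have z1A : z1 \notin A by apply/negP => zA; have := att _ _ zA w1C wz1 => /eqP; rewrite (negPf w10).
have l4 := lp_avoid l3 z1A (fun a b aA bF => clo a b aA bF).
have l5 : lp (c |: A :|: F :\: A) z z1 (n + 0).
  apply: lp_cat l (lp_sym l4) _ => v; rewrite in_setU1 => /orP[/eqP//|vA].
  by rewrite in_setD vA.
rewrite addn0 in l5; have sub : c |: A :|: F :\: A \subset F.
  by rewrite subUset (side_F sd) subsetDl.
have w01 : w0 != w1 by rewrite eq_sym.
have h1 := Cgap HC w0C w1C w01 l5 sub wz wz1.
have h2 := Cgap HC w1C w0C w10 (lp_sym l5) sub wz1 wz.
have := cdistC w0C w1C w01; move: h1 h2; clear; nlia.
Qed.

(** The sides are shrunk until all vertices of [C] attached to them are far. If their link ends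
    differ, or a further vertex is attached, there are [k] gaps of order [2 * g + 2]; otherwise both
    sides attach to the same [k - 1] vertices only, and [attached_far] applies. *)
Lemma two_sides_bound A1 c1 R1 A2 c2 R2 : side C A1 c1 R1 -> side C A2 c2 R2 -> apart C A1 c1 A2 c2 ->
  maxn k (mu + 2) <= size R1 -> maxn k (mu + 2) <= size R2 -> k * (mu + 2) <= size C.
Proof.
have [n] := ubnP (#|A1| + #|A2|); elim: n => // n IH in A1 c1 A2 c2 *; rewrite ltnS => le sd1 sd2 ap s1 s2.
set M := maxn k (mu + 2) in s1 s2; set g := uphalf M.
have gM : M <= g + g by rewrite /g uphalf_half; lia.
have mM : mu + 2 <= M by apply: leq_maxr.
have kM : k <= M by apply: leq_maxl.
have gR1 : g <= uphalf (size R1) by rewrite /g !uphalf_half; move: s1; clear; lia.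
have gR2 : g <= uphalf (size R2) by rewrite /g !uphalf_half; move: s2; clear; lia.
have [[x [w [xA wC wx nf]]]|all1] := classic (exists x w, [/\ x \in A1, w \in C, e w x & ~ far A1 c1 w (uphalf (size R1))]).
  have [A' [v [sd' pA vA lv]]] := shrink_side sd1 wC xA wx nf.
  apply: IH sd' sd2 _ s1 s2; first by apply: leq_trans le; rewrite ltn_add2r; apply: proper_card.
  by apply: shrink_apart ap (proper_sub pA) vA (side_F sd1) lv.
have [[x [w [xA wC wx nf]]]|all2] := classic (exists x w, [/\ x \in A2, w \in C, e w x & ~ far A2 c2 w (uphalf (size R2))]).
  have [A' [v [sd' pA vA lv]]] := shrink_side sd2 wC xA wx nf.
  apply: IH sd1 sd' _ s1 s2; first by apply: leq_trans le; rewrite ltn_add2l; apply: proper_card.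
  by apply/apart_sym/(shrink_apart (apart_sym ap) (proper_sub pA) vA (side_F sd2) lv).
have {}all1 x w : x \in A1 -> w \in C -> e w x -> far A1 c1 w g.
  move=> xA wC wx; apply: far_le gR1 _; apply: NNPP => nf; apply: all1; by exists x, w.
have {}all2 x w : x \in A2 -> w \in C -> e w x -> far A2 c2 w g.
  move=> xA wC wx; apply: far_le gR2 _; apply: NNPP => nf; apply: all2; by exists x, w.
have k0 : 0 < k by apply: ltnW.
have [W1 [? [? [? [? [? [lk1 cW1]]]]]]] := side_links HC conn sd1 (leq_trans kM s1) kC k0.
have [W2 [? [? [? [? [? [lk2 cW2]]]]]]] := side_links HC conn sd2 (leq_trans kM s2) kC k0.
have W1C : {subset W1 <= C} by case: lk1.
have W2C : {subset W2 <= C} by case: lk2.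
have [_ [_ _ cR1 RA1]] := sd1; have [_ [_ _ cR2 RA2]] := sd2.
have far1 w : w \in W1 -> far A1 c1 w g by move=> wW; apply: far_le gR1 (side_linkage_far cR1 RA1 lk1 wW).
have far2 w : w \in W2 -> far A2 c2 w g by move=> wW; apply: far_le gR2 (side_linkage_far cR2 RA2 lk2 wW).
have big : k * (g + g + 2) <= size C -> k * (mu + 2) <= size C.
  by apply: leq_trans; rewrite leq_mul2l; apply/orP; right; move: mM gM; clear; nlia.
have kW1 : #|W1|.+1 = k by rewrite cW1 prednK.
have [E|nW] := eqVneq W1 W2; last first.
  apply: big; rewrite -kW1; apply: (two_class_bound uC W1C W2C _ nW).
  - by rewrite cW1 cW2.
  - move=> w w' wW w'W ww'; apply: leq_trans (side_linkage_gap HC sd1 lk1 wW w'W ww').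
    by rewrite leq_add2r.
  - move=> w w' wW w'W ww'; apply: leq_trans (side_linkage_gap HC sd2 lk2 wW w'W ww').
    by rewrite leq_add2r.
  - move=> w w' wW w'W ww'.
    exact (far_gap2 HC sd1 sd2 ap (W1C _ wW) (W2C _ w'W) ww' (far1 w wW) (far2 w' w'W)).
rewrite -E in far2.
have extra w : w \in C -> w \notin W1 -> far A1 c1 w g \/ far A2 c2 w g -> k * (mu + 2) <= size C.
  move=> wC wW f; apply: big; have cU : #|w |: W1| = k by rewrite cardsU1 wW add1n.
  rewrite -cU; apply: (spread_bound uC); rewrite ?cU //.
    by move=> v; rewrite in_setU1 => /orP[/eqP->|/W1C].
  move=> v v'; rewrite !in_setU1 => /orP[/eqP->|vW] /orP[/eqP->|v'W] vv'.
  - by rewrite eqxx in vv'.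
  - case: f => f; first exact: proj1 (far_gap2 HC sd1 sd2 ap wC (W1C _ v'W) vv' f (far2 v' v'W)).
    rewrite eq_sym in vv'; exact: proj2 (far_gap2 HC sd1 sd2 ap (W1C _ v'W) wC vv' (far1 v' v'W) f).
  - case: f => f; last exact: proj1 (far_gap2 HC sd1 sd2 ap (W1C _ vW) wC vv' (far1 v vW) f).
    rewrite eq_sym in vv'; exact: proj2 (far_gap2 HC sd1 sd2 ap wC (W1C _ vW) vv' f (far2 v vW)).
  - exact: proj1 (far_gap2 HC sd1 sd2 ap (W1C _ vW) (W1C _ v'W) vv' (far1 v vW) (far2 v' v'W)).
apply: NNPP => no.
have att1 x w : x \in A1 -> w \in C -> e w x -> w \in W1.
  move=> xA wC wx; apply: contraT => wW; case: no; apply: (extra w wC wW); left; exact: all1 wx.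
have att2 x w : x \in A2 -> w \in C -> e w x -> w \in W1.
  move=> xA wC wx; apply: contraT => wW; case: no; apply: (extra w wC wW); right; exact: all2 wx.
have R11 : 1 < size R1 by apply: leq_trans (leq_trans kM s1).
have R21 : 1 < size R2 by apply: leq_trans (leq_trans kM s2).
have f1 := attached_far sd1 R11 W1C kW1 att1.
have f2 := attached_far sd2 R21 W1C kW1 att2.
(* Gaps of [2 * (mu + 2)] between [k - 1] vertices suffice, as [2 * (k - 1) >= k]. For [k = 2] there
   is just one vertex and no gap, and [exit_gap] provides a second vertex. *)
apply: no; have [k3|k2] := ltnP 2 k.
  apply: leq_trans (_ : #|W1| * (mu.+1 + mu.+1 + 2) <= _).
    by move: k3; rewrite -kW1; move: #|W1|; clear => a; nia.
  apply: (spread_bound uC W1C); first by rewrite -ltnS kW1.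
  move=> v v' vW v'W vv'.
  exact: proj1 (far_gap2 HC sd1 sd2 ap (W1C _ vW) (W1C _ v'W) vv' (f1 v vW) (f2 v' v'W)).
have Ek : k = 2 by apply/eqP; rewrite eqn_leq k2 k1.
have /cards1P[w0 EW] : #|W1| == 1 by rewrite -eqSS kW1 Ek.
have w0W : w0 \in W1 by rewrite EW inE.
apply: leq_trans (exit_gap sd1 (W1C _ w0W) (f1 _ w0W) _); first by rewrite Ek; clear; lia.
by move=> x w xA wC wx; have := att1 x w xA wC wx; rewrite EW inE => /eqP.
Qed.

End TwoSides.

(** * The theorem *)

Section Dense.
Variables (G : sgraph) (C D : seq G).
Hypothesis HC : longest_in setT C.
Hypothesis HD : longest_in (off_cycle C) D.

Lemma dense_bound k mu : 1 < k -> k <= size D -> mu < size D ->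
  (forall x : G, k + mu <= #|[set y | adj x y]|) -> connected_avoiding G k ->
  k * (mu + 2) <= size C.
Proof.
move=> k1 kh mh deg conn; have kC := leq_trans kh (size_D_C HC HD).
have [//|[u [p bad]]] := bound_or_bad_tail HC HD k1 kh mh deg conn.
have [q [d [S [a [_ _ cl [t ll]]]]]] := bad_tail_cluster HD bad.
have [dM|dM] := leqP d (maxn (k - 2) mu).
  exact: (small_cluster HC HD k1 kh mh deg conn cl ll dM).
have [A1 [A2 [c [sd1 sd2 ap _]]]] := dense_side HD cl ll.
have [_ [[_ _ _ dh _] _]] := cl; have [tL dL _ _ _] := ll.
(* Now [d + 1] is at least [k] and at least [mu + 2], and the cycles of both sides have more than
   [d] vertices. *)
apply: (two_sides_bound HC k1 kC deg conn sd1 sd2 ap).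
  by move: dM dh; clear; nlia.
rewrite size_drop /=; move: dM dL tL; clear; nlia.
Qed.

End Dense.

Lemma deleted_lp (G : sgraph) (X : {set G}) x y : connected (delete X) ->
  x \notin X -> y \notin X -> lp (~: X) x y 0.
Proof.
move=> cn xX yX; have xX' : x \in ~: X by rewrite in_setC.
have yX' : y \in ~: X by rewrite in_setC.
move: cn => /forallP/(_ (Sub x xX'))/forallP/(_ (Sub y yX'))/connectP[p pp Ey].
apply: connect_lp => //; apply/connectP; exists (map val p).
  by apply: homo_path pp => a b ab; rewrite (valP b) andbT.
by rewrite -[x]/(val (Sub x xX' : {z | z \in ~: X})) last_map -Ey.
Qed.

Lemma k_connected_avoiding (G : sgraph) k1 k : k_connected k G -> k1 <= k -> connected_avoiding G k1.
Proof. by move=> [_ cn] le X x y cX; apply: deleted_lp; apply: cn; apply: leq_trans le. Qed.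

Lemma min_degree_le (G : sgraph) (x : G) : min_degree G <= degree x.
Proof.
rewrite /min_degree; have := mem_index_enum x; elim: (index_enum G) => // y s IH.
rewrite inE big_cons => /orP[/eqP<-|/IH]; first exact: geq_minl.
by apply: leq_trans (geq_minr _ _).
Qed.

Lemma min_degree_attained (G : sgraph) : min_degree G < #|G| -> exists x : G, degree x = min_degree G.
Proof.
move=> lt; apply: NNPP => no.
suff : min_degree G < min_degree G by rewrite ltnn.
rewrite {2}/min_degree; elim/big_rec: _ => // x m _ lm; rewrite leq_min lm andbT.
by rewrite ltn_neqAle min_degree_le andbT; apply/eqP => E; apply: no; exists x.
Qed.

(** Otherwise the neighbours of a vertex of minimum degree would be fewer than [k] and separate it
    from another vertex. In the theorem this excludes [lambda = 1]. *)
Lemma connectivity_le_min_degree (G : sgraph) k : k_connected k G -> k <= min_degree G.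
Proof.
move=> kc; have [kG _] := kc; rewrite leqNgt; apply/negP => lt.
have [v dv] := min_degree_attained (ltn_trans lt kG).
pose N := [set y | adj v y].
have cN : #|N| < k by rewrite -[#|N|]/(degree v) dv.
have vN : v \notin N by rewrite inE adj_irrefl.
have [|u uT uN] := @not_covered G setT (v |: N).
  by rewrite cardsT cardsU1 vN add1n; apply: leq_ltn_trans kG.
rewrite in_setU1 negb_or in uN; have /andP[uv {}uN] := uN.
have [[|y p] [pp _ lpu sp] _] := k_connected_avoiding kc (leqnn k) cN vN uN.
  by rewrite -lpu eqxx in uv.
have := sp y; rewrite !inE eqxx orbT => /(_ isT); by case/andP: pp => ->.
Qed.

Lemma circumference_attained (G : sgraph) n : 0 < n -> n <= circumference G ->
  exists s : seq G, is_cycle s /\ n <= size s.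
Proof.
case: n => // n _ le; apply: NNPP => no; move: le; apply/negP; rewrite -ltnNge ltnS.
apply/bigmax_leqP => k /existsP[t ct]; rewrite leqNgt; apply/negP => lt.
by apply: no; exists t; rewrite size_tuple.
Qed.

Lemma is_cycle_map (G : sgraph) (X : {set G}) (s : seq (delete X)) : is_cycle s -> is_cycle (map val s).
Proof.
case: s => [|x [|y s]] // /andP[cs us]; apply/andP; split.
  change (path (@adj G) (val x) (rcons (map val (y :: s)) (val x))).
  by rewrite -map_rcons; apply: homo_path cs.
by rewrite (map_inj_uniq val_inj).
Qed.

Lemma longest_in_exists (G : sgraph) (A : {set G}) (s : seq G) : is_cycle s -> {subset s <= A} ->
  exists2 D, longest_in A D & size s <= size D.
Proof.
move=> cs sA; have [||D [cD DA] mx] := @ex_max (seq G) (fun t => is_cycle t /\ {subset t <= A}) size #|G|.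
- by exists s.
- by move=> t [ct _]; apply: size_is_cycle.
- by exists D; [split => // t ct tA; apply: mx | apply: mx].
Qed.

(** The product [x * (s - x)] is concave in [x] and takes the same value at [a] and at [s - a]. *)
Lemma product_between (a b s : nat) : a <= b -> b <= s - a -> b <= s -> a * (s - a) <= b * (s - b).
Proof.
move=> ab bs bs'; have [c E] : exists c, b = a + c by exists (b - a); lia.
have [t ->] : exists t, s = a + (b + t) by exists (s - a - b); lia.
by rewrite addKn addnCA addKn E; nia.
Qed.

Theorem theorem7 (G : sgraph) (C : seq G) (lambda : nat) :
  1 <= lambda ->
  lambda <= min_degree G ->
  k_connected (min_degree G - lambda + 2) G ->
  longest_cycle C ->
  lambda - 1 <= circumference (delete [set x in C]) ->
  lambda * (min_degree G - lambda + 2) <= size C.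
Proof.
move=> l0 ld kc lC circ; have := connectivity_le_min_degree kc.
have deg := @min_degree_le G; move: (min_degree G) deg ld kc => delta deg ld kc kd.
have l1 : 1 < lambda by lia.
have l2 : 0 < lambda - 1 by lia.
have [s [cs le]] := circumference_attained l2 circ.
have HC : longest_in setT C by case: lC => cC mx; split => // t ct; [rewrite inE | move=> _; apply: mx].
have [|D HD sD] := @longest_in_exists G (off_cycle C) (map val s) (is_cycle_map cs).
  by move=> v /mapP[x _ ->]; apply: valP.
rewrite size_map in sD; have {le sD} lD : lambda - 1 <= size D := leq_trans le sD.
have main k mu : 1 < k -> k <= size D -> mu < size D -> k + mu = delta ->
    k <= delta - lambda + 2 -> k * (mu + 2) <= size C.
  move=> k1 kh mh E kl; apply: (dense_bound HC HD k1 kh mh _ (k_connected_avoiding kc kl)).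
  by move=> x; rewrite E; apply: deg.
have [kh|hk] := leqP (delta - lambda + 2) (size D).
  rewrite mulnC; have := @main (delta - lambda + 2) (lambda - 2).
  by rewrite subnK //; apply; lia.
apply: leq_trans (_ : (size D + 1) * (delta - size D + 1) <= _).
  have := @product_between lambda (size D + 1) (delta + 2).
  have -> : delta + 2 - lambda = delta - lambda + 2 by lia.
  have -> : delta + 2 - (size D + 1) = delta - size D + 1 by lia.
  by apply; lia.
have [kh|kh] := leqP (delta - size D + 1) (size D).
  rewrite mulnC; have := @main (delta - size D + 1) (size D - 1).
  have -> : size D - 1 + 2 = size D + 1 by lia.
  by apply; lia.
(* Here [size D < delta - size D + 1], that is [2 * size D <= delta]. All vertices of [D] may carry
   tails, and the constant value switches the third criterion off. *)
have [tl bt] := best_tails_exist C D [set x in D] (fun=> 0).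
by apply: (sparse_bound HC HD _ _ bt) => [x|]; [apply: deg | lia].
Qed.
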